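(* Let $\mathcal{F}$ be a family of extrapolation pairs on $\mathbb{R}^n$. Suppose that $u$ and $v$ are weights such that $v\in L^1_{\mathrm{loc}}(\mathbb{R}^n)$, and $\mathbb{X}_v$ is a Banach function space over $(\mathbb{R}^n,v\,dx)$. Assume that there exist $r>1$ and $s>0$ such that $u^{\frac1s}v^{-\frac1{sr'}}\in A_1$ and, for some constant $K_0$, $$\|M'_{v^{1/r}}f\|_{\mathbb{X}_v'}\le K_0\,\|f\|_{\mathbb{X}_v'}\qquad\text{for all measurable } f.$$ If for some $p_0\in(0,\infty)$ and for every $w\in A_\infty$, $$\|f\|_{L^{p_0}(w)}\le C\,\|g\|_{L^{p_0}(w)},\qquad (f,g)\in\mathcal{F},$$ where $C$ is independent of $(f,g)$ and depends on $w$ only through its $A_\infty$ characteristic, then there is a constant $C$ such that $$\Big\|\frac fu\Big\|_{\mathbb{X}_v}\le C\,\Big\|\frac gu\Big\|_{\mathbb{X}_v},\qquad (f,g)\in\mathcal{F}.$$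
   Context: A weight on $\mathbb{R}^n$ is a measurable $w$ with $0<w<\infty$ a.e.; $w(E)=\int_E w\,dx$; $\|f\|_{L^p(w)}=(\int|f|^p w\,dx)^{1/p}$; $1/r+1/r'=1$. The Hardy–Littlewood maximal operator is $Mf(x)=\sup_{Q\ni x}\frac1{|Q|}\int_Q|f|\,dy$ (sup over cubes $Q\ni x$). For a weight $\omega$, $M'_\omega f(x)=M(f\omega)(x)/\omega(x)$ if $\omega(x)\ne0$ and $0$ otherwise. For $1<p<\infty$, $w\in A_p$ if $[w]_{A_p}=\sup_Q\big(\frac1{|Q|}\int_Q w\big)\big(\frac1{|Q|}\int_Q w^{1-p'}\big)^{p-1}<\infty$; $w\in A_1$ if $[w]_{A_1}=\|Mw/w\|_{L^\infty}<\infty$; $A_\infty=\bigcup_{p\ge1}A_p$. A constant depends on $w\in A_\infty$ only through its $A_\infty$ characteristic if, for every $q\in[1,\infty)$ and $K\ge1$, the same constant can be taken for all $w$ with $[w]_{A_q}\le K$. A family of extrapolation pairs is a collection of pairs $(f,g)$ of nonnegative measurable functions on $\mathbb{R}^n$. Let $\mathbb{M}$ be the set of (classes of) measurable functions on $\mathbb{R}^n$. A Banach function space (BFS) over $(\mathbb{R}^n,v\,dx)$ is $\mathbb{X}_v=\{f\in\mathbb{M}:\|f\|_{\mathbb{X}_v}<\infty\}$, where $\|\cdot\|=\|\cdot\|_{\mathbb{X}_v}:\mathbb{M}\to[0,\infty]$ satisfies: (1) $\|f\|=\||f|\|$, and $\|f\|=0$ iff $f=0$ a.e.; (2) $\|f+g\|\le\|f\|+\|g\|$;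 (3) $\|\lambda f\|=|\lambda|\|f\|$; (4) $|f|\le|g|$ a.e. implies $\|f\|\le\|g\|$; (5) $|f_j|\uparrow|f|$ a.e. implies $\|f_j\|\uparrow\|f\|$; (6) if $v(E)<\infty$ then $\|\mathbf{1}_E\|<\infty$ and $\int_E|f|\,v\,dx\le C_E\|f\|$. The associate space $\mathbb{X}_v'$ has norm $\|f\|_{\mathbb{X}_v'}=\sup\{\int|fg|\,v\,dx:\|g\|_{\mathbb{X}_v}\le1\}$. Functions not in a space have norm $+\infty$. *)

(* Defs.v *)
From HB Require Import structures.
From mathcomp Require Import all_boot all_order all_algebra.
From mathcomp Require Import all_classical all_reals all_analysis.
From mathcomp Require Import measurable_realfun.

Set Implicit Arguments.
Unset Strict Implicit.
Unset Printing Implicit Defensive.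

Import Order.TTheory GRing.Theory Num.Theory.
Import numFieldNormedType.Exports.

Local Open Scope classical_set_scope.
Local Open Scope ring_scope.
Local Open Scope ereal_scope.

(* MathComp-Analysis has a sigma-algebra on n.-tuple T but no n-fold product
   measure, so Lebesgue measure on R^n is built here in two steps: the product
   of n copies of the one-dimensional measure on the Borel sets of
   n.-tuple R, and then its completion. *)
Section tuple_measure.
Context (R : realType).
Local Notation RB := (measurableTypeR R).

Definition tuple_cons n (p : RB * n.-tuple RB) : n.+1.-tuple RB :=
  [the n.+1.-tuple RB of p.1 :: p.2].

Lemma measurable_tuple_cons n : measurable_fun setT (@tuple_cons n).
Proof. exact: measurable_cons. Qed.

Section step.
Context n (m : {sigma_finite_measure set (n.-tuple RB) -> \bar R}).

Definition tuple_measureS : set (n.+1.-tuple RB) -> \bar R :=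
  pushforward (@lebesgue_measure R \x m) (@tuple_cons n).

Let tuple_measureS0 : tuple_measureS set0 = 0.
Proof. by rewrite /tuple_measureS /pushforward preimage_set0 measure0. Qed.

Let tuple_measureS_ge0 A : 0 <= tuple_measureS A.
Proof. exact: (measure_ge0 (@lebesgue_measure R \x m)). Qed.

Let tuple_measureS_sigma_additive : semi_sigma_additive tuple_measureS.
Proof.
move=> F mF tF mUF; rewrite /tuple_measureS /pushforward preimage_bigcup.
have mpre A : measurable A -> measurable (@tuple_cons n @^-1` A).
  by move=> mA; rewrite -[X in measurable X]setTI; exact: measurable_tuple_cons.
apply: measure_semi_sigma_additive => [i||]; first exact: mpre.
- apply/trivIsetP => /= i j _ _ ij; rewrite -preimage_setI.
  by move/trivIsetP : tF => /(_ _ _ _ _ ij) ->//; rewrite preimage_set0.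
- by rewrite -preimage_bigcup; exact: mpre.
Qed.

HB.instance Definition _ := isMeasure.Build _ _ _ tuple_measureS
  tuple_measureS0 tuple_measureS_ge0 tuple_measureS_sigma_additive.

Let tuple_measureS_sigma_finite : sigma_finite setT tuple_measureS.
Proof.
have /sigma_finiteP[F [TF ndF Foo]] := sigma_finiteT (@lebesgue_measure R).
have /sigma_finiteP[G [TG ndG Goo]] := sigma_finiteT m.
pose split (x : n.+1.-tuple RB) : RB * n.-tuple RB :=
  (thead x, [tuple of behead x]).
have consK : cancel (@tuple_cons n) split.
  by move=> [a t]; rewrite /split /=; congr (_, _); exact: val_inj.
have msplit : measurable_fun setT split.
  apply: measurable_fun_pair; first exact: (measurable_tnth ord0).
  exact: measurable_behead.
exists (fun k => split @^-1` (F k `*` G k)).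
  apply/esym; rewrite -subTset => x _.
  have [i _ Fi] : (\bigcup_i F i) (split x).1 by rewrite -TF.
  have [j _ Gj] : (\bigcup_j G j) (split x).2 by rewrite -TG.
  exists (maxn i j) => //; split.
  - by move: Fi; exact/subsetPset/ndF/leq_maxl.
  - by move: Gj; exact/subsetPset/ndG/leq_maxr.
move=> k; have [mFk Fk] := Foo k; have [mGk Gk] := Goo k.
have mFG : measurable (F k `*` G k) by exact: measurableX.
split; first by rewrite -[X in measurable X]setTI; exact: msplit.
rewrite /= /tuple_measureS /pushforward.
rewrite (_ : _ @^-1` _ = F k `*` G k); last first.
  by apply/funext => x; rewrite /preimage /mkset consK.
by rewrite product_measure1E// lte_mul_pinfty// ge0_fin_numE.
Qed.

HB.instance Definition _ := @Measure_isSigmaFinite.Build _ _ _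
  tuple_measureS tuple_measureS_sigma_finite.
End step.

Fixpoint borel_lebesgue n :
    {sigma_finite_measure set (n.-tuple RB) -> \bar R} :=
  match n with
  | 0 => [the {sigma_finite_measure set (0.-tuple RB) -> \bar R}
           of \d_ ([tuple] : 0.-tuple RB)]
  | n'.+1 => [the {sigma_finite_measure set (n'.+1.-tuple RB) -> \bar R}
           of tuple_measureS (borel_lebesgue n')]
  end.

Lemma measurable_box n (A : 'I_n -> set RB) :
  (forall i, measurable (A i)) ->
  measurable [set x : n.-tuple RB | forall i, A i (tnth x i)].
Proof.
move=> mA.
rewrite (_ : [set _ | _] = \bigcap_(i in [set: 'I_n])
    ((fun x : n.-tuple RB => tnth x i) @^-1` A i)); last first.
  by apply/seteqP; split => x /= h i; [move=> _; exact: h|exact: h].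
apply: fin_bigcap_measurable => // i _.
by rewrite -[X in measurable X]setTI; exact: measurable_tnth.
Qed.

Lemma borel_lebesgue_box n (A : 'I_n -> set RB) :
  (forall i, measurable (A i)) ->
  borel_lebesgue n [set x | forall i, A i (tnth x i)] =
  \big[*%E/1]_(i < n) lebesgue_measure (A i).
Proof.
elim: n A => [|n IHn] A mA.
  rewrite big_ord0 /= diracE mem_set//.
  by move=> [].
rewrite big_ord_recl /= /tuple_measureS /pushforward.
rewrite -IHn; last by move=> i; exact: mA.
rewrite -(product_measure1E _ _ (mA ord0)); last first.
  exact: (measurable_box (fun i => mA (lift ord0 i))).
congr (_ _); apply/seteqP; split => -[a t] /= => [h|[h0 h] i].
  split; first exact: (h ord0).
  by move=> i; have := h (lift ord0 i); rewrite tnthS.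
have [->//|i0] := eqVneq i ord0.
case: (unliftP ord0 i) i0 => [j -> _|->]; last by rewrite eqxx.
by rewrite tnthS; exact: h.
Qed.
End tuple_measure.

(* R^n with the sigma-algebra of Lebesgue measurable sets. *)
Definition Rn (R : realType) (n : nat) : measurableType _ :=
  caratheodory_type (mu_ext (borel_lebesgue R n)).

Definition lebesgue_n {R : realType} {n : nat} : set (Rn R n) -> \bar R :=
  @completed_measure_extension _ _ _ (borel_lebesgue R n).

HB.instance Definition _ (R : realType) n := Measure.on (@lebesgue_n R n).

Lemma lebesgue_n_sigma_finite (R : realType) n :
  sigma_finite setT (@lebesgue_n R n).
Proof.
exact/completed_measure_extension_sigma_finite/sigma_finiteT.
Qed.

HB.instance Definition _ (R : realType) n := @Measure_isSigmaFinite.Build _ _ _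
  (@lebesgue_n R n) (lebesgue_n_sigma_finite R n).

Lemma lebesgue_n_complete (R : realType) n :
  measure_is_complete (@lebesgue_n R n).
Proof. exact: measure_is_complete_caratheodory. Qed.

Section extrapolation.
Context {R : realType} {n : nat}.
Local Notation mu := (@lebesgue_n R n).
Local Notation RRn := (Rn R n).
Implicit Types (f g u v w : RRn -> \bar R) (N : (RRn -> \bar R) -> \bar R).

(* The sides are parallel to the axes. Open cubes give the same maximal
   function and the same A_p characteristics as closed ones. *)
Definition cube (c : n.-tuple R) (l : R) : set RRn :=
  [set x | forall i, (tnth c i < tnth x i < tnth c i + l)%R].

Lemma lebesgue_n_cube c (l : R) : (0 < l)%R -> mu (cube c l) = (l ^+ n)%:E.
Proof.
move=> l0; pose A i : set (measurableTypeR R) := `](tnth c i), (tnth c i + l)%R[%classic.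
have mA i : measurable (A i) by exact: measurable_itv.
have -> : cube c l = [set x | forall i, A i (tnth x i)].
  by apply/seteqP; split => x h i; have := h i; rewrite /A /= in_itv.
rewrite /lebesgue_n /completed_measure_extension measurable_mu_extE /=.
  rewrite borel_lebesgue_box// (eq_bigr (fun=> l%:E)); last first.
    move=> i _; rewrite /A lebesgue_measure_itv /= lte_fin ltrDl l0.
    by rewrite -EFinD addrAC subrr add0r.
  rewrite big_const card_ord; elim: n {c A mA} => [//|k IHk].
  by rewrite iterS IHk exprS EFinM.
exact: measurable_box.
Qed.

Definition cubes : set (set RRn) :=
  [set Q | exists c l, (0 < l)%R /\ Q = cube c l].

Definition average (Q : set RRn) f : \bar R :=
  (mu Q)^-1 * \int[mu]_(y in Q) f y.

Definition maximal f : RRn -> \bar R := fun x =>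
  ereal_sup [set average Q (abse \o f) | Q in [set Q | cubes Q /\ Q x]].

Definition maximal' w f : RRn -> \bar R := fun x =>
  if w x != 0 then maximal (f \* w) x / w x else 0.

(* Functions take values in \bar R. The library's conventions 0^-1 = +oo,
   0 `^ a = 0 and +oo `^ a = +oo for a < 0 are met only on the null set where a
   weight is not in ]0, +oo[. *)
Definition weight w : Prop :=
  measurable_fun setT w /\ {ae mu, forall x, 0 < w x < +oo}.

(* R^n is represented by tuples, whose type has no topology in the library;
   compactness is that of the corresponding set of row vectors. *)
Definition locally_integrable_n f : Prop :=
  measurable_fun setT f /\
  forall K : set RRn,
    compact [set (\row_(i < n) tnth x i : 'rV[R]_n) | x in K] ->
    \int[mu]_(x in K) `|f x| < +oo.

Definition conjugate (p : R) : R := ((1 - p^-1)^-1)%R.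

Definition Ap_char (p : R) w : \bar R :=
  if p == 1%R then Lnorm mu +oo (fun x => maximal w x / w x)
  else ereal_sup
    [set average Q w *
         (average Q (fun x => w x `^ (1 - conjugate p))) `^ (p - 1) |
     Q in cubes].

Definition Ap (p : R) w : Prop := weight w /\ Ap_char p w < +oo.

Definition Ainfty w : Prop := exists2 p : R, (1 <= p)%R & Ap p w.

Definition weighted_norm (p : R) w f : \bar R :=
  (\int[mu]_x (`|f x| `^ p * w x)) `^ p^-1.

(* P w C holds for every w in A_infty with a constant C which depends on w
   only through its A_infty characteristic. *)
Definition Ainfty_constant (P : (RRn -> \bar R) -> R -> Prop) : Prop :=
  (forall w, Ainfty w -> exists2 C : R, (0 < C)%R & P w C) /\
  (forall q K : R, (1 <= q)%R -> (1 <= K)%R ->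
    exists2 C : R, (0 < C)%R &
      forall w, weight w -> Ap_char q w <= K%:E -> P w C).

Definition extrapolation_family
    (F : set ((RRn -> \bar R) * (RRn -> \bar R))) : Prop :=
  forall f g, F (f, g) ->
    [/\ measurable_fun setT f, forall x, 0 <= f x,
        measurable_fun setT g & forall x, 0 <= g x].

(* N is the norm of a Banach function space over (R^n, v dx): the space is
   the set of (classes of) measurable f with N f < +oo. The values of N
   outside of measurable functions are irrelevant; that N is defined on
   classes follows from bfn_le. *)
Record banach_function_norm v N : Prop := BanachFunctionNorm {
  bfn_ge0 : forall f, measurable_fun setT f -> 0 <= N f;
  bfn_abs : forall f, measurable_fun setT f -> N f = N (abse \o f);
  bfn_eq0 : forall f, measurable_fun setT f ->
    N f = 0 <-> {ae mu, forall x, f x = 0};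
  bfn_triangle : forall f g, measurable_fun setT f -> measurable_fun setT g ->
    N (f \+ g) <= N f + N g;
  bfn_homogeneous : forall (a : R) f, measurable_fun setT f ->
    N (fun x => a%:E * f x) = `|a|%:E * N f;
  bfn_le : forall f g, measurable_fun setT f -> measurable_fun setT g ->
    {ae mu, forall x, `|f x| <= `|g x|} -> N f <= N g;
  bfn_fatou : forall (f_ : nat -> RRn -> \bar R) f,
    (forall j, measurable_fun setT (f_ j)) -> measurable_fun setT f ->
    {ae mu, forall x, nondecreasing_seq (fun j => `|f_ j x|) /\
                      (fun j => `|f_ j x|) @ \oo --> `|f x|} ->
    nondecreasing_seq (fun j => N (f_ j)) /\ (fun j => N (f_ j)) @ \oo --> N f;
  bfn_indic : forall E : set RRn, measurable E ->
    \int[mu]_(x in E) v x < +oo ->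
    N (fun x => (\1_E x)%:E) < +oo /\
    exists2 C : R, (0 < C)%R &
      forall f, measurable_fun setT f ->
        \int[mu]_(x in E) (`|f x| * v x) <= C%:E * N f }.

Definition associate_norm v N f : \bar R :=
  ereal_sup [set \int[mu]_x (`|f x * g x| * v x) |
    g in [set g | measurable_fun setT g /\ N g <= 1]].

End extrapolation.

(* Main.v *)
Require Import Defs.
From HB Require Import structures.
From mathcomp Require Import all_boot all_order all_algebra.
From mathcomp Require Import all_classical all_reals all_analysis.
From mathcomp Require Import measurable_realfun.
From mathcomp Require Import ess_sup_inf ring lra.

Set Implicit Arguments.
Unset Strict Implicit.
Unset Printing Implicit Defensive.

Import Order.TTheory GRing.Theory Num.Theory.
Import numFieldNormedType.Exports.

Local Open Scope classical_set_scope.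
Local Open Scope ring_scope.
Local Open Scope ereal_scope.

(** The proof combines duality, the iteration of Rubio de Francia, and
    extrapolation between A_infty weights.

    Duality.  By the theorem of Lorentz and Luxemburg the norm N is recovered
    from the unit ball of its associate space, so that it is enough to bound
    int (f / u) h v for h >= 0 in this ball (lorentz_luxemburg,
    associate_dual).  The operator h |-> M (h v^(1/r)) / v^(1/r) is bounded on
    the associate space; the sum of its iterates with geometric weights is a
    majorant H of h of associate norm at most 2 for which H v^(1/r) is an A_1
    weight (rubio_de_francia, dual_A1_majorant).  Since
    b = u^(1/s) v^(-1/(s r')) is in A_1 too, the easy half of Jones'
    factorization puts
      w = (H v^(1/r)) b^(-s) = H v / u
    in A_(1+s), with a constant that does not depend on h (Muckenhoupt_of_A1).
    If the hypothesis holds with exponent 1, then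
      int (f / u) h v <= int f w <= C int g w = C int (g / u) H v
                      <= 2 C N (g / u),
    which is the claim (extrapolation_of_A1).

    From the exponent p0 to the exponent 1.  Let w be in A_(1+s) and let M_w
    be the maximal operator of the measure w dx.  This measure is doubling,
    hence M_w is bounded on L^p(w) for every p > 1, and the same iteration
    gives every function of L^p(w) a majorant c of comparable norm with
    M_w c <= K' c (A1_majorant).  Multiplying w by c, or by a negative power
    of c, gives an A_infty weight again, with control of the constant
    (Muckenhoupt_mul, Muckenhoupt_neg_power).  If p0 > 1, take for c a majorant
    of g^(1/2) in L^2(w) and use the weight c^(-2(p0-1)) w; if p0 < 1, take for
    c a majorant of f^(1-p0) in L^(1/(1-p0))(w) and use the weight c w.
    Pointwise inequalities then turn the hypothesis into int f w <= C int g w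
    (Ainfty_extrapolation).

    The maximal theorem.  For a doubling measure on R^n the weak (1,1) bound
    follows from Vitali's covering lemma, and the bound on L^p from
    interpolation (vitali_cubes, mean_max_weak11, marcinkiewicz).

    The geometry of cubes enters only in this last part, and in the fact that
    suprema over cubes are measurable, because a union of open cubes is a
    countable one (cubes_lindelof).  All the rest is carried out in a measure
    space with a family B of sets of positive finite measure, an increasing
    exhaustion E of the space by sets of B, and a relation dil of dilation
    between sets of B. *)

(** * Maximal operators over a family of sets *)

Section sup_over.
Context {d} {T : measurableType d} {R : realType} (B : set (set T)).
Implicit Types (phi : set T -> \bar R) (Q : set T).

Definition sup_over phi : T -> \bar R := fun x =>
  ereal_sup [set phi Q | Q in [set Q | B Q /\ Q x]].

Lemma sup_over_ub phi Q x : B Q -> Q x -> phi Q <= sup_over phi x.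
Proof. by move=> cQ Qx; apply: ereal_sup_ubound; exists Q. Qed.

Lemma sup_over_le phi x y :
  (forall Q, B Q -> Q x -> phi Q <= y) -> sup_over phi x <= y.
Proof. by move=> h; apply: ge_ereal_sup => _ [Q [cQ Qx] <-]; exact: h. Qed.

(** Superlevel sets of the supremum are unions of sets of B; measurability and
    the weak-type bound are both read off from this. *)
Lemma sup_over_gt phi y :
  [set x | y < sup_over phi x] = \bigcup_(Q in [set Q | B Q /\ y < phi Q]) Q.
Proof.
apply/seteqP; split => [x /= /ereal_sup_gt[_ [Q [cQ Qx] <-] yQ]|].
  by exists Q.
by move=> x [Q [cQ yQ] Qx] /=; exact: lt_le_trans yQ (sup_over_ub _ _ _).
Qed.
End sup_over.

Section mean_max.
Context {d} {T : measurableType d} {R : realType} (B : set (set T)).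
Variable nu : {measure set T -> \bar R}.
Implicit Types (f g : T -> \bar R) (Q : set T).

(** The maximal operator of the measure nu: the sets of B have positive finite
    measure, so that nothing is lost in taking the mean with fine. *)
Definition mean_max f : T -> \bar R :=
  sup_over B (fun Q => (fine (nu Q))^-1%:E * \int[nu]_(y in Q) f y).

Hypothesis mB : forall Q, B Q -> measurable Q.
Hypothesis nuB : forall Q, B Q -> 0 < nu Q < +oo.

Lemma nu_fineE Q : B Q -> exists2 r : R, (0 < r)%R & nu Q = r%:E.
Proof.
move=> /nuB; case: (nu Q) => [r| |] //=; last by rewrite ltxx andbF.
by rewrite lte_fin => /andP[r0 _]; exists r.
Qed.

Lemma mean_maxP f Q x : B Q -> Q x ->
  \int[nu]_(y in Q) f y <= mean_max f x * nu Q.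
Proof.
move=> cQ Qx; have := sup_over_ub (fun Q => (fine (nu Q))^-1%:E *
  \int[nu]_(y in Q) f y) cQ Qx.
have [r r0 ->] := nu_fineE cQ.
by rewrite lee_pdivrMl// muleC.
Qed.

Lemma mean_max_le f x (y : \bar R) :
  (forall Q, B Q -> Q x -> \int[nu]_(y in Q) f y <= y * nu Q) ->
  mean_max f x <= y.
Proof.
move=> h; apply: sup_over_le => Q cQ Qx; have := h Q cQ Qx.
by have [r r0 ->] := nu_fineE cQ; rewrite lee_pdivrMl// muleC.
Qed.

Lemma mean_max_ge0 f x : (exists2 Q, B Q & Q x) -> (forall x, 0 <= f x) ->
  0 <= mean_max f x.
Proof.
move=> [Q cQ Qx] f0; apply: le_trans (sup_over_ub _ cQ Qx).
by rewrite mule_ge0 ?lee_fin ?invr_ge0 ?fine_ge0//; exact: integral_ge0.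
Qed.

(** The maximal operator has norm 1 on bounded functions; in this form the bound
    lets one discard the part of f below a given height. *)
Lemma mean_max_shift f g (c : R) : measurable_fun setT f ->
  measurable_fun setT g -> (forall x, 0 <= f x) -> (forall x, 0 <= g x) ->
  (0 <= c)%R -> (forall x, f x <= g x + c%:E) ->
  forall x, mean_max f x <= mean_max g x + c%:E.
Proof.
move=> mf mg f0 g0 c0 fg x; apply: mean_max_le => Q cQ Qx.
have mQ := mB cQ.
apply: (@le_trans _ _ (\int[nu]_(y in Q) (g y + c%:E))).
  apply: ge0_le_integral => //; first exact: measurable_funTS.
  by apply: measurable_funTS; exact: emeasurable_funD.
rewrite ge0_integralD//; last exact: measurable_funTS.
rewrite integral_cst// ge0_muleDl ?mean_max_ge0//; last by exists Q.
by rewrite leeD2r// mean_maxP.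
Qed.

Lemma mean_maxZ f (a : R) : measurable_fun setT f -> (forall x, 0 <= f x) ->
  (0 < a)%R -> forall x, mean_max (fun y => a%:E * f y) x = a%:E * mean_max f x.
Proof.
move=> mf f0 a0 x.
have IZ Q : B Q -> \int[nu]_(y in Q) (a%:E * f y) = a%:E * \int[nu]_(y in Q) f y.
  move=> cQ; rewrite ge0_integralZl//; [exact: mB|exact: measurable_funTS|].
  by rewrite lee_fin ltW.
apply/eqP; rewrite eq_le; apply/andP; split.
  apply: mean_max_le => Q cQ Qx; rewrite IZ// -muleA lee_pmul2l// ?lte_fin//.
  exact: mean_maxP.
rewrite -lee_pdivlMl//; apply: mean_max_le => Q cQ Qx.
rewrite -muleA lee_pdivlMl// -IZ//; exact: mean_maxP.
Qed.

Lemma mean_max_series (f_ : nat -> T -> \bar R) :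
  (forall k, measurable_fun setT (f_ k)) -> (forall k x, 0 <= f_ k x) ->
  forall x, mean_max (fun y => \sum_(k <oo) f_ k y) x <=
            \sum_(k <oo) mean_max (f_ k) x.
Proof.
move=> mf f0 x; apply: mean_max_le => Q cQ Qx.
rewrite integral_nneseries//; [|exact: mB|by move=> k; exact: measurable_funTS].
have [r r0 nuQ] := nu_fineE cQ.
rewrite nuQ muleC -nneseriesZl => [|k _]; last by apply: mean_max_ge0 => //; exists Q.
apply: lee_nneseries => [k _ _|k _]; first exact: integral_ge0.
by rewrite muleC -nuQ mean_maxP.
Qed.
End mean_max.

(** * Cubes: measurability and covering *)

Section cubes.
Context {R : realType} {n : nat}.
Local Notation RRn := (Rn R n).
Implicit Types (c : n.-tuple R) (l : R) (Q : set RRn).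

Lemma measurable_open_box (a b : n.-tuple R) :
  measurable ([set x | forall i, (tnth a i < tnth x i < tnth b i)%R] : set RRn).
Proof.
apply: (@caratheodory_measurable_mu_ext _ R _ (borel_lebesgue R n)).
pose A i : set (measurableTypeR R) := `](tnth a i), (tnth b i)[%classic.
rewrite (_ : [set _ | _] = [set x | forall i, A i (tnth x i)]); last first.
  by apply/seteqP; split => x h i; have := h i; rewrite /A /= in_itv.
by apply: measurable_box => i; exact: measurable_itv.
Qed.

Lemma measurable_cube c l : measurable (cube c l).
Proof.
rewrite (_ : cube c l = [set x | forall i, (tnth c i < tnth x i <
   tnth [tuple (tnth c i + l)%R | i < n] i)%R]) //; first exact: measurable_open_box.
by apply/seteqP; split => x h i; have := h i; rewrite tnth_mktuple.
Qed.

Lemma measurable_cubes Q : cubes Q -> measurable Q.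
Proof. by move=> [c [l [_ ->]]]; exact: measurable_cube. Qed.

Lemma cubes_cover (x : RRn) : exists2 Q, cubes Q & Q x.
Proof.
exists (cube [tuple (tnth x i - 1)%R | i < n] 2).
  by exists [tuple (tnth x i - 1)%R | i < n], 2%R.
by move=> i; rewrite tnth_mktuple; lra.
Qed.

Let ratbox (t : n.-tuple rat * n.-tuple rat) : set RRn :=
  [set x | forall i, (ratr (tnth t.1 i) < tnth x i < ratr (tnth t.2 i))%R].

(** Open cubes are unions of boxes with rational vertices, and there are only
    countably many of these. *)
Lemma cubes_lindelof (QQ : set (set RRn)) : QQ `<=` cubes -> QQ !=set0 ->
  exists2 Q_ : nat -> set RRn, (forall k, QQ (Q_ k)) &
    \bigcup_(Q in QQ) Q = \bigcup_k Q_ k.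
Proof.
move=> Qcube [Q0 QQ0].
have pick k : {Q | QQ Q & forall t, unpickle k = Some t ->
    (exists2 Q', QQ Q' & ratbox t `<=` Q') -> ratbox t `<=` Q}.
  apply: cid2; case: (unpickle k) => [t|]; last by exists Q0.
  have [[Q' QQ' tQ']|h] := pselect (exists2 Q', QQ Q' & ratbox t `<=` Q').
    by exists Q' => // _ [<-].
  by exists Q0 => // _ [<-].
exists (fun k => s2val (pick k)) => [k|]; first by case: (pick k).
apply/seteqP; split => [x [Q QQQ Qx]|x [k _ kx]]; last first.
  by exists (s2val (pick k)) => //; case: (pick k).
have [c [l [l0 Ecl]]] := Qcube _ QQQ.
rewrite {}Ecl in QQQ Qx *.
have ex1 i : {q : rat | (tnth c i < ratr q < tnth x i)%R}.
  apply: cid; have /andP[h _] := Qx i.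
  by have [q] := rat_in_itvoo h; rewrite in_itv /= => ?; exists q.
have ex2 i : {q : rat | (tnth x i < ratr q < tnth c i + l)%R}.
  apply: cid; have /andP[_ h] := Qx i.
  by have [q] := rat_in_itvoo h; rewrite in_itv /= => ?; exists q.
pose t : n.-tuple rat * n.-tuple rat :=
  ([tuple sval (ex1 i) | i < n], [tuple sval (ex2 i) | i < n]).
have tx : ratbox t x.
  move=> i; rewrite !tnth_mktuple /=.
  by case: (ex1 i) => ? /= /andP[_ ->]; case: (ex2 i) => ? /= /andP[->].
have tQ : ratbox t `<=` cube c l.
  move=> y ty i; have := ty i; rewrite !tnth_mktuple /=.
  case: (ex1 i) => ? /= /andP[h1 _]; case: (ex2 i) => ? /= /andP[_ h2].
  by move=> /andP[h3 h4]; rewrite (lt_trans h1 h3) (lt_trans h4 h2).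
exists (pickle t) => //.
case: (pick _) => Q' QQ' /= /(_ t); rewrite pickleK; apply => //.
by exists (cube c l).
Qed.

Lemma measurable_sup_cubes_gt (phi : set RRn -> \bar R) y :
  measurable [set x | y < sup_over (@cubes R n) phi x].
Proof.
rewrite sup_over_gt.
have [->|/set0P QQ0] := eqVneq [set Q | cubes Q /\ y < phi Q] set0.
  by rewrite bigcup_set0.
have [Q_ QQ ->] := cubes_lindelof (fun Q (h : (cubes Q /\ _)) => h.1) QQ0.
by apply: bigcup_measurable => k _; have [/measurable_cubes] := QQ k.
Qed.

Lemma measurable_sup_cubes (phi : set RRn -> \bar R) :
  measurable_fun setT (sup_over (@cubes R n) phi).
Proof.
apply: (measurability _ (ErealGenOInfty.measurableE R)) => //.
move=> _ [_ [a ->] <-]; rewrite setTI.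
rewrite (_ : _ @^-1` _ = [set x | a%:E < sup_over (@cubes R n) phi x]).
  exact: measurable_sup_cubes_gt.
by apply/seteqP; split => x /=; rewrite in_itv/= ?andbT.
Qed.

(** A cube is given by its lower corner and its side; the cube with the same
    centre and three times the side. *)
Definition triple (q : n.-tuple R * R) : n.-tuple R * R :=
  ([tuple (tnth q.1 i - q.2)%R | i < n], (3 * q.2)%R).

Lemma sub_triple (p q : n.-tuple R * R) :
  (p.2 <= q.2)%R -> cube p.1 p.2 `&` cube q.1 q.2 !=set0 ->
  cube p.1 p.2 `<=` cube (triple q).1 (triple q).2.
Proof.
move=> pq [x [px qx]] y py i; rewrite tnth_mktuple /=.
have := px i; have := qx i; have := py i.
move=> /andP[? ?] /andP[? ?] /andP[? ?]; apply/andP; split; lra.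
Qed.

(** Vitali's covering argument for finitely many cubes: if the list is sorted
    by increasing side, the first cube is kept exactly when it meets none of
    those kept among the larger ones, in the triple of which it lies
    otherwise. *)
Lemma vitali_cubes (s : seq (n.-tuple R * R)) :
  (forall q, q \in s -> (0 < q.2)%R) ->
  exists t : seq (n.-tuple R * R),
  [/\ uniq t, {subset t <= s}, trivIset [set` t] (fun q => cube q.1 q.2) &
    forall q, q \in s -> exists2 q', q' \in t &
      cube q.1 q.2 `<=` cube (triple q').1 (triple q').2].
Proof.
move=> sgt0; pose le2 := (fun p q : n.-tuple R * R => p.2 <= q.2)%R.
have le2T : transitive le2 by move=> ? ? ?; exact: le_trans.
have : forall s, sorted le2 s -> (forall q, q \in s -> (0 < q.2)%R) ->
  exists t : seq (n.-tuple R * R),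
  [/\ uniq t, {subset t <= s}, trivIset [set` t] (fun q => cube q.1 q.2) &
    forall q, q \in s -> exists2 q', q' \in t &
      cube q.1 q.2 `<=` cube (triple q').1 (triple q').2].
  elim=> [|p s' IH] /=; first by exists nil; split => // x y; rewrite /= in_nil.
  rewrite (path_sortedE le2T) => /andP[/allP ps ss] s0.
  have [|t [ut ts tI tc]] := IH ss; first by move=> q qs; apply: s0; rewrite inE qs orbT.
  have [[q qt pq]|h] := pselect (exists2 q, q \in t &
      cube p.1 p.2 `&` cube q.1 q.2 !=set0).
    exists t; split => //; first by move=> ? /ts; rewrite inE orbC => ->.
    move=> q'; rewrite inE => /predU1P[->|]; last exact: tc.
    by exists q => //; apply: sub_triple => //; exact/ps/ts.
  have p0 : (0 < p.2)%R by apply: s0; rewrite mem_head.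
  have pp : cube p.1 p.2 `<=` cube (triple p).1 (triple p).2.
    by move=> x px i; rewrite tnth_mktuple /=; have := px i; lra.
  have p_ne : cube p.1 p.2 !=set0.
    exists [tuple (tnth p.1 i + p.2 / 2)%R | i < n] => i.
    by rewrite tnth_mktuple; lra.
  have pt : p \notin t.
    by apply/negP => pt; apply: h; exists p => //; rewrite setIid.
  exists (p :: t); split => //=; first by rewrite pt.
  - by move=> q; rewrite !inE => /predU1P[->|/ts ->]; rewrite ?eqxx ?orbT.
  - move=> q1 q2 /=; rewrite !inE => /predU1P[->|q1t] /predU1P[->|q2t] => // q12.
    + by exfalso; apply: h; exists q2.
    + by exfalso; apply: h; exists q1 => //; rewrite setIC.
    + exact: tI.
  - move=> q; rewrite inE => /predU1P[->|qs].
      by exists p => //; exact: mem_head.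
    by have [q' q't ?] := tc _ qs; exists q' => //; rewrite inE q't orbT.
move=> /(_ (sort le2 s)) [||t [ut ts tI tc]].
- by apply: sort_sorted => p q; exact: le_total.
- by move=> q; rewrite mem_sort; exact: sgt0.
- exists t; split => // q; first by move/ts; rewrite mem_sort.
  by move=> qs; apply: tc; rewrite mem_sort.
Qed.
End cubes.

(** * Series and dyadic sums *)

Lemma nneseries_ge_term (R : realType) (u : (\bar R)^nat) k :
  (forall i, 0 <= u i) -> u k <= \sum_(i <oo) u i.
Proof.
move=> u0; apply: (@le_trans _ _ (\sum_(0 <= i < k.+1) u i)).
  by rewrite big_nat_recr//= leeDr// sume_ge0.
by apply: nneseries_lim_ge => i _ _; exact: u0.
Qed.

Lemma nneseries_le (R : realType) (u : (\bar R)^nat) y :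
  (forall i, 0 <= u i) -> (forall k, \sum_(0 <= i < k) u i <= y) ->
  \sum_(i <oo) u i <= y.
Proof.
move=> u0 uy; apply: lime_le; last exact: nearW.
by apply: is_cvg_nneseries => i _ _; exact: u0.
Qed.

Lemma nneseries_geometric_half (R : realType) (c : R) m : (0 <= c)%R ->
  \sum_(i <oo) (c * 2 ^- (m + i))%:E <= (2 * c * 2 ^- m)%:E.
Proof.
move=> c0; apply: nneseries_le => [i|k].
  by rewrite lee_fin mulr_ge0// invr_ge0 exprn_ge0.
rewrite sumEFin lee_fin.
have -> : (\sum_(0 <= i < k) c * 2 ^- (m + i) = 2 * c * 2 ^- m * (1 - 2 ^- k))%R.
  elim: k => [|k IH]; first by rewrite big_nil expr0 invr1 subrr mulr0.
  rewrite big_nat_recr//= IH !exprD exprS; field.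
  by rewrite !expf_neq0.
rewrite ler_piMr ?gerBl ?invr_ge0 ?exprn_ge0//.
by rewrite !mulr_ge0// invr_ge0 exprn_ge0.
Qed.

Lemma nneseriesM (R : realType) (a : (\bar R)^nat) (y : \bar R) :
  (forall k, 0 <= a k) -> 0 <= y ->
  (\sum_(k <oo) a k) * y = \sum_(k <oo) a k * y.
Proof.
move=> a0; case: y => [y| |//] y0.
  rewrite muleC -nneseriesZl//.
  by apply: eq_eseriesr => k _; rewrite muleC.
have [[k ak]|nex] := pselect (exists k, 0 < a k).
  rewrite gt0_muley; last exact: lt_le_trans ak (nneseries_ge_term k a0).
  apply/esym/eqP; rewrite -leye_eq.
  apply: le_trans (nneseries_ge_term k _) => [|i]; first by rewrite gt0_muley.
  by rewrite mule_ge0.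
have az k : a k = 0.
  by apply/le_anti; rewrite a0 andbT leNgt; apply/negP => ak; apply: nex; exists k.
by rewrite !eseries0 ?mul0e// => k _ _; rewrite az// mul0e.
Qed.

Section dyadic.
Context {R : realType}.
Implicit Types (p : R) (x y : \bar R).

(** The layer-cake formula with dyadic levels, as an inequality: the term of the
    largest 2^j < y is already at least y^p. *)
Lemma poweR_le_dyadic p y : (0 < p)%R -> 1 < y ->
  y `^ p <= \sum_(j <oo)
    (if (2 ^+ j)%:E < y then (((2 : R) `^ p) ^+ j.+1)%:E else 0).
Proof.
move=> p0 y1.
have ge0 j : 0 <= (if (2 ^+ j)%:E < y then (((2 : R) `^ p) ^+ j.+1)%:E else 0).
  by case: ifP => // _; rewrite lee_fin exprn_ge0// powR_ge0.
have A1 : (1 <= (2:R) `^ p)%R by rewrite -[leLHS](powRr0 2) ler_powR// ?ler1n// ltW.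
case: y y1 ge0 => [y| |//] y1 ge0; last first.
  set S := (X in _ <= X); suff -> : S = +oo by rewrite leey.
  apply/eq_infty => r; pose k := (Num.truncn r).+1.
  apply: (@le_trans _ _ (\sum_(0 <= j < k) (1 : \bar R))).
    rewrite sumEFin big_const_nat iter_addr_0 subn0 lee_fin /k.
    exact: ltW (truncnS_gt _).
  apply: le_trans (nneseries_lim_ge k (fun i _ _ => ge0 i)).
  apply: lee_sum => j _; rewrite ltry lee_fin; exact: exprn_ege1.
have [k0 k0y] : exists k, (y <= 2 ^+ k)%R.
  exists (Num.truncn y).+1; apply: le_trans (ltW (truncnS_gt y)) _.
  by rewrite -natrX ler_nat ltnW// ltn_expl.
have [[|j] yj jmin] := ex_minnP (ex_intro (fun k => (y <= 2 ^+ k)%R) k0 k0y).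
  by move: y1 yj; rewrite expr0 lte_fin leNgt => ->.
have jy : ((2 ^+ j)%:E < y%:E).
  by rewrite lte_fin ltNge; apply/negP => /jmin; rewrite ltnn.
apply: le_trans (nneseries_ge_term j ge0); rewrite jy poweR_EFin lee_fin.
rewrite -powR_mulrn ?powR_ge0// -powRrM mulrC powRrM powR_mulrn//.
by rewrite ge0_ler_powR// ?ltW// ?nnegrE ?exprn_ge0// ltW// (lt_trans ltr01).
Qed.

(** The converse bound for the moment of order p - 1.  The terms form a
    geometric progression of ratio 2^(p-1) > 1 stopped at 2^j < 2 x, hence the
    sum is comparable to its last term. *)
Lemma dyadic_le_poweR p x : (1 < p)%R -> 0 <= x ->
  \sum_(j <oo) (if (2 ^+ j)%:E < 2%:E * x
                then (((2 : R) `^ (p - 1)) ^+ j)%:E * x else 0) <=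
  (((2 : R) `^ (p - 1)) ^+ 2 / ((2 : R) `^ (p - 1) - 1))%:E * x `^ p.
Proof.
move=> p1 x0; set rho := ((2 : R) `^ (p - 1))%R.
have p10 : (0 < p - 1)%R by rewrite subr_gt0.
have rho1 : (1 < rho)%R.
  have : (1 `^ (p - 1) < (2 : R) `^ (p - 1))%R.
    by rewrite gt0_ltr_powR ?nnegrE ?ltr1n.
  by rewrite powR1.
have rho0 : (0 < rho)%R by exact: lt_trans rho1.
have C0 : (0 < rho ^+ 2 / (rho - 1))%R.
  by rewrite divr_gt0 ?exprn_gt0 ?subr_gt0// (lt_trans ltr01).
case: x x0 => [x| |//] x0; last first.
  rewrite poweRyr; last by rewrite gt_eqF// (lt_trans ltr01).
  by rewrite [leRHS]gt0_muley ?lte_fin// leey.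
apply: nneseries_le => [j|k].
  by case: ifP => // _; rewrite mule_ge0// lee_fin exprn_ge0// ltW.
pose S := fun m : nat => (\sum_(0 <= j < m) (if 2 ^+ j < 2 * x then rho ^+ j else 0))%R.
have -> : \sum_(0 <= j < k)
    (if (2 ^+ j)%:E < 2%:E * x%:E then (rho ^+ j)%:E * x%:E else 0) =
    (S k * x)%:E.
  rewrite /S mulr_suml -sumEFin; apply: eq_bigr => j _.
  by rewrite -EFinM lte_fin; case: ifP; rewrite ?mul0r.
have SG j : ((rho - 1) * S j <= rho ^+ j - 1)%R.
  elim: j => [|j IH]; first by rewrite /S big_nil mulr0 expr0 subrr.
  rewrite /S big_nat_recr//= -/(S j) mulrDr exprS.
  have rj : (0 <= rho ^+ j)%R by rewrite exprn_ge0// ltW// (lt_trans ltr01).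
  have h : ((rho - 1) * (if 2 ^+ j < 2 * x then rho ^+ j else 0) <=
         (rho - 1) * rho ^+ j)%R.
    by rewrite ler_wpM2l// ?subr_ge0 ?(ltW rho1)//; case: ifP.
  apply: le_trans (lerD IH h) _.
  by rewrite le_eqVlt; apply/orP; left; apply/eqP; ring.
have Sx j : ((rho - 1) * S j <= rho * (2 * x) `^ (p - 1))%R.
  elim: j => [|j IH].
    by rewrite /S big_nil mulr0 mulr_ge0 ?powR_ge0.
  have := SG j.+1; rewrite /S big_nat_recr//= -/(S j).
  case: ifP => [jx|_ _]; last by rewrite addr0.
  move/le_trans; apply.
  apply: (@le_trans _ _ (rho ^+ j.+1)%R); first by rewrite gerBl.
  rewrite exprS ler_pM2l; last exact: lt_trans rho1.
  rewrite -powR_mulrn ?powR_ge0// -powRrM mulrC powRrM powR_mulrn//.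
  by rewrite ge0_ler_powR// ?ltW// ?nnegrE ?exprn_ge0// mulr_ge0.
rewrite poweR_EFin -EFinM lee_fin.
have h : (1 + (p - 1) = p)%R by rewrite addrC subrK.
have -> : (x `^ p = x * x `^ (p - 1))%R.
  have : (x `^ (1 + (p - 1)) = x `^ 1 * x `^ (p - 1))%R.
    by apply: powRD; rewrite h gt_eqF// (lt_trans ltr01).
  by rewrite h powRr1.
have [->|xn0] := eqVneq x 0%R; first by rewrite mulr0 mul0r mulr0.
rewrite [leRHS]mulrCA [leRHS]mulrC ler_pM2r; last by rewrite lt_neqAle eq_sym xn0.
rewrite -mulrA -[X in (_ <= _ * X)%R]mulrC mulrA ler_pdivlMr ?subr_gt0//.
rewrite mulrC; apply: le_trans (Sx k) _.
by rewrite powRM// -/rho expr2 mulrA.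
Qed.
End dyadic.

(** * Interpolation between weak (1,1) and bounded functions *)

Section marcinkiewicz.
Context {d} {T : measurableType d} {R : realType}.
Variables (nu : {measure set T -> \bar R}) (M : (T -> \bar R) -> T -> \bar R).
Variables (D p : R).
Hypothesis D0 : (0 <= D)%R.
Hypothesis p1 : (1 < p)%R.
Implicit Types f g : T -> \bar R.
Hypothesis measurable_M : forall f, measurable_fun setT f ->
  (forall x, 0 <= f x) -> measurable_fun setT (M f).
Hypothesis M_ge0 : forall f, measurable_fun setT f -> (forall x, 0 <= f x) ->
  forall x, 0 <= M f x.
Hypothesis M_shift : forall f g (c : R), measurable_fun setT f ->
  measurable_fun setT g -> (forall x, 0 <= f x) -> (forall x, 0 <= g x) ->
  (0 <= c)%R -> (forall x, f x <= g x + c%:E) ->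
  forall x, M f x <= M g x + c%:E.
Hypothesis MZ : forall f (a : R), measurable_fun setT f ->
  (forall x, 0 <= f x) -> (0 < a)%R ->
  forall x, M (fun y => a%:E * f y) x = a%:E * M f x.
Hypothesis M_weak11 : forall f (t : R), measurable_fun setT f ->
  (forall x, 0 <= f x) -> (0 < t)%R ->
  t%:E * nu [set x | t%:E < M f x] <= D%:E * \int[nu]_x f x.

Let rho := ((2 : R) `^ (p - 1))%R.
Definition marcinkiewicz_constant := (4 * rho * D * (rho ^+ 2 / (rho - 1)))%R.
Local Notation C := marcinkiewicz_constant.

Let high f j : T -> \bar R :=
  fun x => if (2 ^+ j)%:E < 2%:E * f x then f x else 0.

Let measurable_high f j : measurable_fun setT f -> measurable_fun setT (high f j).
Proof.
move=> mf; apply: measurable_fun_ifT => //.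
by apply: measurable_fun_lte => //; exact: measurable_funeM.
Qed.

Let high_ge0 f j : (forall x, 0 <= f x) -> forall x, 0 <= high f j x.
Proof. by move=> f0 x; rewrite /high; case: ifP. Qed.

Let M_high f j : measurable_fun setT f -> (forall x, 0 <= f x) ->
  [set x | (2 ^+ j)%:E < M f x] `<=` [set x | (2 ^+ j / 2)%:E < M (high f j) x].
Proof.
move=> mf f0 x /= h.
have t0 : (0 <= 2 ^+ j / 2 :> R)%R by rewrite divr_ge0// exprn_ge0.
suff : M f x <= M (high f j) x + (2 ^+ j / 2)%:E.
  move=> /(lt_le_trans h); rewrite {1}(splitr (2 ^+ j)) EFinD.
  by rewrite lteD2rE.
apply: M_shift => //; [exact: measurable_high|exact: high_ge0|move=> y].
rewrite /high; case: ifPn => [_|]; first by rewrite leeDl// lee_fin.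
by rewrite -leNgt add0e [(_ / _)%R]mulrC EFinM lee_pdivlMl.
Qed.

Let A := ((2 : R) `^ p)%R.

Let AE : A = (2 * rho)%R.
Proof.
have : (2 `^ (1 + (p - 1)) = 2 `^ 1 * 2 `^ (p - 1) :> R)%R.
  by apply: powRD; rewrite implybE pnatr_eq0 orbT.
by rewrite addrC subrK powRr1.
Qed.

(** At the level 2^j the part of f below 2^j / 2 adds at most 2^j / 2 to M f, and
    the weak bound applies to the rest.  Summed over j, this bounds the
    integral of (M f)^p over the set where M f > 1. *)
Lemma marcinkiewicz_gt1 f : measurable_fun setT f -> (forall x, 0 <= f x) ->
  \int[nu]_x (if 1 < M f x then M f x `^ p else 0) <=
  C%:E * \int[nu]_x (f x `^ p).
Proof.
move=> mf f0.
have p0 : (0 < p)%R by exact: lt_trans p1.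
have rho0 : (0 < rho)%R by rewrite powR_gt0.
have A0 : (0 < A)%R by rewrite powR_gt0.
have mgt y : measurable [set x | y < M f x].
  by rewrite -[X in measurable X]setTI; apply: emeasurable_fun_o_infty => //; exact: measurable_M.
have mgth j y : measurable [set x | y < M (high f j) x].
  rewrite -[X in measurable X]setTI; apply: emeasurable_fun_o_infty => //.
  by apply: measurable_M; [exact: measurable_high|exact: high_ge0].
pose u j x := if (2 ^+ j)%:E < M f x then (A ^+ j.+1)%:E else 0.
have mu_ j : measurable_fun setT (u j).
  apply: measurable_fun_ifT => //; apply: measurable_fun_lte => //.
  exact: measurable_M.
have u0 j x : 0 <= u j x by rewrite /u; case: ifP => // _; rewrite lee_fin exprn_ge0// ltW.
have mM : measurable_fun setT (fun x => M f x `^ p).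
  apply: (measurableT_comp (measurable_poweR _)); exact: measurable_M.
apply: (@le_trans _ _ (\int[nu]_x \sum_(j <oo) u j x)).
  apply: ge0_le_integral => //.
  - by move=> x _; case: ifP => // _; exact: poweR_ge0.
  - apply: measurable_fun_ifT => //; apply: measurable_fun_lte => //.
    exact: measurable_M.
  - exact: ge0_emeasurable_sum.
  - move=> x _; case: ifPn => [h|_]; last by apply: nneseries_ge0.
    exact: poweR_le_dyadic.
rewrite integral_nneseries//.
pose w j x := (rho ^+ j)%:E * high f j x.
have w0 j x : 0 <= w j x by rewrite mule_ge0 ?high_ge0// lee_fin exprn_ge0// ltW.
have mw j : measurable_fun setT (w j) by apply: measurable_funeM; exact: measurable_high.
apply: (@le_trans _ _ (\sum_(j <oo) (4 * rho * D)%:E * \int[nu]_x w j x)).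
  apply: lee_nneseries => [j _ _|j _]; first exact: integral_ge0.
  have -> : \int[nu]_x u j x = (A ^+ j.+1)%:E * nu [set x | (2 ^+ j)%:E < M f x].
    rewrite -integral_cst; last exact: mgt.
    rewrite [RHS]integral_mkcond; apply: eq_integral => x _.
    rewrite /u patchE; case: ifPn => h; first by rewrite mem_set.
    by rewrite memNset// => /= h'; rewrite h' in h.
  have t0 : (0 < 2 ^+ j / 2 :> R)%R by rewrite divr_gt0// exprn_gt0.
  have := M_weak11 (measurable_high j mf) (high_ge0 j f0) t0.
  rewrite ge0_integralZl//; [|exact: measurable_high|by move=> x _; exact: high_ge0|by rewrite lee_fin exprn_ge0// ltW].
  set I := (X in D%:E * X); set S := (X in _ * X <= _) => h.
  apply: (@le_trans _ _ ((A ^+ j.+1)%:E * S)).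
    apply: lee_wpmul2l; first by rewrite lee_fin exprn_ge0// ltW.
    rewrite le_measure ?inE//; [exact: mgt..|].
    exact: M_high.
  have -> : ((A ^+ j.+1)%:E * S = (4 * rho * rho ^+ j)%:E * ((2 ^+ j / 2)%:E * S)).
    rewrite muleA -EFinM; congr (_%:E * _).
    by rewrite AE exprMn !exprS; field.
  apply: (@le_trans _ _ ((4 * rho * rho ^+ j)%:E * (D%:E * I))).
    by apply: lee_wpmul2l => //; rewrite lee_fin !mulr_ge0 ?exprn_ge0// ltW.
  rewrite !muleA -!EFinM le_eqVlt; apply/orP; left; apply/eqP.
  by congr (_%:E * _); ring.
rewrite nneseriesZl//; last by move=> j _; exact: integral_ge0.
rewrite -integral_nneseries// /marcinkiewicz_constant -/rho [X in _ <= X * _]EFinM -muleA.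
apply: lee_wpmul2l.
  by rewrite lee_fin !mulr_ge0// ltW.
rewrite -ge0_integralZl//; last 3 first.
- apply: (measurableT_comp (measurable_poweR _)); exact: mf.
- by move=> x _; exact: poweR_ge0.
- rewrite lee_fin divr_ge0 ?exprn_ge0 ?(ltW rho0)//.
  by rewrite subr_ge0 -(powRr0 2) ler_powR ?ler1n// subr_ge0 ltW.
apply: ge0_le_integral => //.
- by move=> x _; exact: nneseries_ge0.
- exact: ge0_emeasurable_sum.
- apply: measurable_funeM; apply: (measurableT_comp (measurable_poweR _)); exact: mf.
move=> x _; apply: le_trans (dyadic_le_poweR p1 (f0 x)).
apply: lee_nneseries => [j _ _|j _] //; rewrite /w /high.
by case: ifP => _; rewrite ?mule0.
Qed.

(** The dyadic levels start at 1; applied to 2^m f the previous lemma covers the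
    set where M f > 2^-m, with the same constant. *)
Lemma marcinkiewicz f : measurable_fun setT f -> (forall x, 0 <= f x) ->
  \int[nu]_x (M f x `^ p) <= C%:E * \int[nu]_x (f x `^ p).
Proof.
move=> mf f0.
have p0 : (0 < p)%R by exact: lt_trans p1.
pose g m x := if (2 ^- m)%:E < M f x then M f x `^ p else 0.
have M0 x : 0 <= M f x by exact: M_ge0.
have mM : measurable_fun setT (fun x => M f x `^ p).
  apply: (measurableT_comp (measurable_poweR _)); exact: measurable_M.
have mg m : measurable_fun setT (g m).
  apply: measurable_fun_ifT => //; apply: measurable_fun_lte => //.
  exact: measurable_M.
have g0 m x : 0 <= g m x by rewrite /g; case: ifP => // _; exact: poweR_ge0.
have ndg x : nondecreasing_seq (g ^~ x).
  apply/nondecreasing_seqP => m; rewrite /g; case: ifPn => [h|_]; last exact: g0.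
  rewrite ifT//; apply: le_lt_trans h.
  by rewrite lee_fin lef_pV2 ?posrE ?exprn_gt0// ler_eXn2l// ?ltr1n.
have -> : \int[nu]_x (M f x `^ p) = \int[nu]_x limn (g ^~ x).
  apply: eq_integral => x _; apply/esym/cvg_lim => //.
  have := M0 x; rewrite le_eqVlt => /predU1P[Mx0|Mx0].
    rewrite /g -Mx0 poweR0r ?gt_eqF//.
    by under eq_fun do rewrite if_same; exact: cvg_cst.
  apply: cvg_near_cst.
  have [m0 hm0] : exists m, (2 ^- m)%:E < M f x.
    case: (M f x) Mx0 => [y| |//]; last by exists 0%N; rewrite ltry.
    rewrite lte_fin => y0; exists (Num.truncn y^-1).+1; rewrite lte_fin.
    rewrite invf_plt ?posrE ?exprn_gt0//; apply: lt_trans (truncnS_gt _) _.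
    by rewrite -natrX ltr_nat ltn_expl.
  near=> m; rewrite /g ifT//; apply: le_lt_trans hm0.
  rewrite lee_fin lef_pV2 ?posrE ?exprn_gt0// ler_eXn2l// ?ltr1n//.
  by near: m; exists m0.
rewrite monotone_convergence//; apply: lime_le.
  apply: ereal_nondecreasing_is_cvgn => i j ij; apply: ge0_le_integral => // x _.
  exact: ndg.
apply: nearW => m.
have a0 : (0 < 2 ^+ m :> R)%R by rewrite exprn_gt0.
have ap0 : (0 < (2 ^+ m) `^ p :> R)%R by rewrite powR_gt0.
have mmf : measurable_fun setT (fun x => (2 ^+ m)%:E * f x) by exact: measurable_funeM.
have mf0 x : 0 <= (2 ^+ m)%:E * f x by rewrite mule_ge0// lee_fin ltW.
have := marcinkiewicz_gt1 mmf mf0.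
under eq_integral do rewrite MZ//.
have -> : \int[nu]_x (((2 ^+ m)%:E * f x) `^ p) = ((2 ^+ m) `^ p)%:E * \int[nu]_x (f x `^ p).
  rewrite -ge0_integralZl//; last 2 first.
  - apply: (measurableT_comp (measurable_poweR _)); exact: mf.
  - by move=> x _; exact: poweR_ge0.
  by apply: eq_integral => x _; rewrite poweRM ?lee_fin ?(ltW a0)// poweR_EFin.
have -> : \int[nu]_x (if 1 < (2 ^+ m)%:E * M f x
     then ((2 ^+ m)%:E * M f x) `^ p else 0) =
   ((2 ^+ m) `^ p)%:E * \int[nu]_x g m x.
  rewrite -ge0_integralZl//.
  apply: eq_integral => x _; rewrite /g -lte_pdivrMl// mule1.
  by case: ifP => _; rewrite ?mule0// poweRM ?lee_fin ?(ltW a0)// poweR_EFin.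
by rewrite muleCA lee_pmul2l// lte_fin.
Unshelve. all: by end_near. Qed.
End marcinkiewicz.

(** * The maximal theorem for doubling measures *)

Lemma le_measure_bigsetU d (T : measurableType d) (R : realType)
    (nu : {measure set T -> \bar R}) (I : Type) (s : seq I) (F : I -> set T) :
  (forall i, measurable (F i)) ->
  nu (\big[setU/set0]_(i <- s) F i) <= \sum_(i <- s) nu (F i).
Proof.
move=> mF; elim: s => [|i s IH]; first by rewrite !big_nil measure0.
rewrite !big_cons; apply: le_trans (leeD2l _ IH).
by apply: measureU2 => //; exact: bigsetU_measurable.
Qed.

Section doubling_measure.
Context {R : realType} {n : nat} (nu : {measure set (Rn R n) -> \bar R}).
Local Notation RRn := (Rn R n).
Implicit Types (f g : RRn -> \bar R) (Q : set RRn).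

Hypothesis nu_cube : forall Q, cubes Q -> 0 < nu Q < +oo.

Let nuE Q : cubes Q -> exists2 r : R, (0 < r)%R & nu Q = r%:E.
Proof. exact: nu_fineE. Qed.

Let cubeP (q : n.-tuple R * R) : (0 < q.2)%R -> cubes (cube q.1 q.2).
Proof. by move=> q0; exists q.1, q.2. Qed.

Variable D : R.
Hypothesis doubling : forall q : n.-tuple R * R, (0 < q.2)%R ->
  nu (cube (triple q).1 (triple q).2) <= D%:E * nu (cube q.1 q.2).

Lemma doubling_ge0 : (0 <= D)%R.
Proof.
pose q : n.-tuple R * R := ([tuple 0%R | i < n], 1%R).
have := @doubling q ltr01; have [r r0 ->] := nuE (@cubeP q ltr01).
move=> h; rewrite -(pmulr_lge0 _ r0) -lee_fin EFinM.
by apply: le_trans h; exact: measure_ge0.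
Qed.

(** The superlevel set at height t is a countable union of cubes on which the mean
    of f exceeds t.  Among finitely many of them Vitali's lemma selects disjoint
    ones whose triples cover the others, and each triple costs a factor D. *)
Lemma mean_max_weak11 f (t : R) : measurable_fun setT f ->
  (forall x, 0 <= f x) -> (0 < t)%R ->
  t%:E * nu [set x | t%:E < mean_max cubes nu f x] <= D%:E * \int[nu]_x f x.
Proof.
move=> mf f0 t0; rewrite /mean_max sup_over_gt.
set QQ := [set Q | _].
have If0 : 0 <= \int[nu]_x f x by exact: integral_ge0.
have [->|/set0P QQ0] := eqVneq QQ set0.
  by rewrite bigcup_set0 measure0 mule0 mule_ge0 ?lee_fin ?doubling_ge0.
have [Q_ QQ_ ->] := cubes_lindelof (fun Q (h : QQ Q) => h.1) QQ0.
have mQ k : measurable (Q_ k) by have [/measurable_cubes] := QQ_ k.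
rewrite -lee_pdivlMl// -bigcup_bigsetU_bigcup.
have : nu (\big[setU/set0]_(i < k.+1) Q_ i) @[k --> \oo] -->
    nu (\bigcup_k \big[setU/set0]_(i < k.+1) Q_ i).
  apply: nondecreasing_cvg_mu => [k||]; first exact: bigsetU_measurable.
    by apply: bigcupT_measurable => k; exact: bigsetU_measurable.
  by apply/nondecreasing_seqP => k; apply/subsetPset/subset_bigsetU.
move=> /cvg_lim <-//; apply: lime_le.
  apply: ereal_nondecreasing_is_cvgn; apply/nondecreasing_seqP => k.
  rewrite le_measure ?inE//; [exact: bigsetU_measurable..|].
  exact: subset_bigsetU.
apply: nearW => k.
have pick i : {q : n.-tuple R * R | (0 < q.2)%R & Q_ i = cube q.1 q.2}.
  by apply: cid2; have [[c [l [l0 E]]] _] := QQ_ i; exists (c, l).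
pose s := [seq s2val (pick i) | i <- iota 0 k.+1].
have [q|u [uu us uI uc]] := @vitali_cubes R n s.
  by move=> /mapP[i _ ->]; case: (pick i).
have u0 q : q \in u -> (0 < q.2)%R.
  by move=> /us /mapP[i _ ->]; case: (pick i).
pose U (F : n.-tuple R * R -> set RRn) := \big[setU/set0]_(q <- u) F q.
apply: (@le_trans _ _ (nu (U (fun q => cube (triple q).1 (triple q).2)))).
  rewrite le_measure ?inE//.
  - exact: bigsetU_measurable.
  - by apply: bigsetU_measurable => q _; exact: measurable_cube.
  rewrite -(bigcup_mkord k.+1 Q_) => x [i /= ik Qx].
  have := s2valP' (pick i); have : s2val (pick i) \in s.
    by apply/mapP; exists i => //; rewrite mem_iota.
  move: (s2val _) => q /uc[q' q'u qq'] Eq; rewrite /U -bigcup_seq.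
  by exists q' => //; apply: qq'; rewrite -Eq.
apply: le_trans (le_measure_bigsetU _ _ _) _ => [q|]; first exact: measurable_cube.
apply: (@le_trans _ _ (\sum_(q <- u) (t^-1 * D)%:E * \int[nu]_(x in cube q.1 q.2) f x)).
  rewrite big_seq [leRHS]big_seq; apply: lee_sum => q qu.
  apply: le_trans (doubling (u0 _ qu)) _.
  rewrite mulrC EFinM -muleA lee_wpmul2l ?lee_fin ?doubling_ge0//.
  have /mapP[i _ Eq] := us _ qu.
  have [cQ] := QQ_ i.
  have := s2valP' (pick i); rewrite -Eq => ->.
  have [r r0 ->] := nuE (cubeP (u0 _ qu)).
  rewrite lee_pdivlMl//= lte_pdivlMl// => /ltW.
  by rewrite muleC.
rewrite -ge0_sume_distrr; last first.
  by move=> q _; exact: integral_ge0.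
rewrite -ge0_integral_bigsetU//.
- rewrite EFinM muleA lee_wpmul2l//; first by rewrite mule_ge0 ?lee_fin ?invr_ge0 ?doubling_ge0// ltW.
  apply: ge0_subset_integral => //.
  by apply: bigsetU_measurable => q _; exact: measurable_cube.
- by move=> q; exact: measurable_cube.
- exact: measurable_funS mf.
Qed.

Lemma mean_max_strong p f : (1 < p)%R -> measurable_fun setT f ->
  (forall x, 0 <= f x) ->
  \int[nu]_x (mean_max cubes nu f x `^ p) <=
  (marcinkiewicz_constant D p)%:E * \int[nu]_x (f x `^ p).
Proof.
move=> p1 mf f0.
apply: (@marcinkiewicz _ RRn R nu (mean_max cubes nu) D p doubling_ge0 p1
  _ _ _ _ _ f mf f0).
- by move=> g _ _; exact: measurable_sup_cubes.
- by move=> g _ g0 x; exact: (mean_max_ge0 nu (cubes_cover x) g0).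
- exact: (mean_max_shift measurable_cubes nu_cube).
- exact: (mean_maxZ measurable_cubes nu_cube).
- exact: mean_max_weak11.
Qed.
End doubling_measure.

(** * Integrals of nonnegative functions *)

Section integral_real.
Context {d} {T : measurableType d} {R : realType}.
Variable nu : {measure set T -> \bar R}.

Lemma measurable_fun_powR (f : T -> R) (t : R) : measurable_fun setT f ->
  measurable_fun setT (fun x => f x `^ t)%R.
Proof. by move=> mf; exact: (measurableT_comp (measurable_powR _)). Qed.

Lemma measurable_fun_poweR (f : T -> \bar R) (t : R) : measurable_fun setT f ->
  measurable_fun setT (fun x => f x `^ t).
Proof. by move=> mf; exact: (measurableT_comp (measurable_poweR _)). Qed.

Lemma measurable_funM_EFin (f : T -> \bar R) (w : T -> R) :
  measurable_fun setT f -> measurable_fun setT w ->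
  measurable_fun setT (fun x => f x * (w x)%:E).
Proof. by move=> mf mw; apply: emeasurable_funM => //; exact/measurable_EFinP. Qed.

Lemma ge0_le_integralT (f g : T -> \bar R) : measurable_fun setT f ->
  measurable_fun setT g -> (forall x, 0 <= f x) -> (forall x, f x <= g x) ->
  \int[nu]_x f x <= \int[nu]_x g x.
Proof. by move=> mf mg f0 fg; apply: ge0_le_integral. Qed.

Lemma ge0_integralDT (f g : T -> \bar R) : measurable_fun setT f ->
  measurable_fun setT g -> (forall x, 0 <= f x) -> (forall x, 0 <= g x) ->
  \int[nu]_x (f x + g x) = \int[nu]_x f x + \int[nu]_x g x.
Proof. by move=> mf mg f0 g0; rewrite ge0_integralD. Qed.

Lemma ge0_integralZT (c : R) (f : T -> \bar R) : measurable_fun setT f ->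
  (forall x, 0 <= f x) -> (0 <= c)%R ->
  \int[nu]_x (c%:E * f x) = c%:E * \int[nu]_x f x.
Proof. by move=> mf f0 c0; rewrite ge0_integralZl. Qed.

Lemma le_integral_EFin (f g : T -> R) : measurable_fun setT f ->
  measurable_fun setT g -> (forall x, (0 <= f x)%R) ->
  (forall x, (f x <= g x)%R) -> \int[nu]_x (f x)%:E <= \int[nu]_x (g x)%:E.
Proof.
by move=> mf mg f0 fg; apply: ge0_le_integralT; [exact/measurable_EFinP..| |];
  move=> x; rewrite lee_fin.
Qed.

Lemma integralD_EFin (f g : T -> R) : measurable_fun setT f ->
  measurable_fun setT g -> (forall x, (0 <= f x)%R) -> (forall x, (0 <= g x)%R) ->
  \int[nu]_x (f x + g x)%:E = \int[nu]_x (f x)%:E + \int[nu]_x (g x)%:E.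
Proof.
move=> mf mg f0 g0; under eq_integral do rewrite EFinD.
by apply: ge0_integralDT; [exact/measurable_EFinP..| |];
  move=> x; rewrite lee_fin.
Qed.

Lemma integralZ_EFin (c : R) (f : T -> R) : measurable_fun setT f ->
  (forall x, (0 <= f x)%R) -> (0 <= c)%R ->
  \int[nu]_x (c * f x)%:E = c%:E * \int[nu]_x (f x)%:E.
Proof.
move=> mf f0 c0; under eq_integral do rewrite EFinM.
by apply: ge0_integralZT => //; exact/measurable_EFinP.
Qed.

Lemma measurable_eq_pinfty (f : T -> \bar R) : measurable_fun setT f ->
  measurable [set x | f x = +oo].
Proof. by move=> mf; rewrite -[X in measurable X]setTI; exact: (mf measurableT _ (emeasurable_set1 +oo)). Qed.

Lemma integral_fin_ae (f : T -> \bar R) :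
  measurable_fun setT f -> (forall x, 0 <= f x) -> \int[nu]_x f x < +oo ->
  nu [set x | f x = +oo] = 0.
Proof.
move=> mf f0 fi.
have : nu.-integrable setT f.
  apply/integrableP; split => //.
  by under eq_integral do rewrite gee0_abs//.
move=> /(integrable_ae measurableT) [N [mN N0 fN]].
have mI : measurable [set x | f x = +oo].
  exact: measurable_eq_pinfty.
apply: (subset_measure0 mI mN _ N0) => x /= fx; apply: fN => /= /(_ Logic.I).
by rewrite fx.
Qed.

End integral_real.

(** * A_1 weights from the maximal operator *)

Section positive_part.
Context {d} {T : measurableType d} {R : realType}.
Implicit Types H : T -> \bar R.

(** A weight is only almost everywhere in ]0, +oo[; changing it to 1 elsewhere
    gives a positive real function in its class. *)
Definition real_weight H (x : T) : R :=
  if 0 < H x < +oo then fine (H x) else 1%R.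

Lemma real_weight_gt0 H x : (0 < real_weight H x)%R.
Proof. by rewrite /real_weight; case: ifP => // /fine_gt0. Qed.

Lemma real_weightE H x : 0 < H x < +oo -> (real_weight H x)%:E = H x.
Proof.
move=> h; rewrite /real_weight h fineK//.
by case/andP: h => h0 h1; rewrite ge0_fin_numE// ltW.
Qed.

Lemma measurable_real_weight H : measurable_fun setT H ->
  measurable_fun setT (real_weight H).
Proof.
move=> mH; apply: measurable_fun_ifT => //.
  by apply: measurable_and; apply: measurable_fun_lte.
by apply: measurableT_comp => //; exact: fine_measurable.
Qed.
End positive_part.

Section A1_majorant.
Context {d} {T : measurableType d} {R : realType}.
Variables (nu : {measure set T -> \bar R}) (B : set (set T)).
Implicit Types (f H : T -> \bar R) (Q : set T).
Hypothesis mB : forall Q, B Q -> measurable Q.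
Hypothesis nuB : forall Q, B Q -> 0 < nu Q < +oo.
Variable E : nat -> set T.
Hypothesis BE : forall m, B (E m).
Hypothesis ndE : forall m, E m `<=` E m.+1.
Hypothesis covE : forall x, exists m, E m x.

Let covB x : exists2 Q, B Q & Q x.
Proof. by have [m Em] := covE x; exists (E m). Qed.

Lemma integral_gt0 f Q : measurable Q ->
  measurable_fun setT f -> (forall x, 0 < f x) -> 0 < nu Q ->
  0 < \int[nu]_(x in Q) f x.
Proof.
move=> mQ mf f0 nuQ; rewrite lt_neqAle integral_ge0 ?andbT//; last first.
  by move=> x _; rewrite ltW.
rewrite eq_sym; apply/eqP => I0.
have : \int[nu]_(y in Q) `|f y| = 0.
  by rewrite -[RHS]I0; apply: eq_integral => y _; rewrite gee0_abs// ltW.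
move/(ae_eq_integral_abs nu mQ (measurable_funTS mf)) => [N [mN N0 QN]].
have : nu Q <= nu N.
  rewrite le_measure ?inE// => y Qy; apply: QN => /= /(_ Qy) fy.
  by have := f0 y; rewrite fy ltxx.
by rewrite N0 leNgt nuQ.
Qed.

(** Every point lies in all large sets of the exhaustion, and a function which
    does not vanish almost everywhere has positive mean on one of them. *)
Lemma mean_max_gt0 f : measurable_fun setT f ->
  (forall x, 0 <= f x) -> ~ {ae nu, forall x, f x = 0} ->
  forall x, 0 < mean_max B nu f x.
Proof.
move=> mf f0 fn0 x.
have [m [Emx Im]] : exists m, E m x /\ 0 < \int[nu]_(y in E m) f y.
  apply: contrapT => nex; apply: fn0.
  have [m0 Em0] := covE x.
  have Ex m : (m0 <= m)%N -> E m x.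
    by move=> /subnKC <-; elim: (m - m0)%N => [|i IH]; rewrite ?addn0// addnS; exact: ndE.
  have z m : (m0 <= m)%N -> \int[nu]_(y in E m) `|f y| = 0.
    move=> mm; apply/eqP; rewrite eq_le integral_ge0 ?andbT//.
    under eq_integral do rewrite gee0_abs//.
    by rewrite leNgt; apply/negP => h; apply: nex; exists m; split => //; exact: Ex.
  have zm m : {ae nu, forall y, E (m0 + m)%N y -> f y = 0}.
    have := z (m0 + m)%N (leq_addr _ _).
    by move/(ae_eq_integral_abs nu (mB (BE _)) (measurable_funTS mf)).
  have : {ae nu, forall y m, E (m0 + m)%N y -> f y = 0} by exact/ae_foralln.
  apply: filterS => y hy; have [m Em] := covE y; apply: (hy m).
  by rewrite addnC; elim: m0 {hy Em0 Ex z zm} => [|i IH]; rewrite ?addn0// addnS; exact: ndE.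
have := mean_maxP nuB f (BE m) Emx; move=> /(lt_le_trans Im) h.
rewrite lt_neqAle mean_max_ge0// andbT eq_sym; apply/eqP => Mz.
by move: h; rewrite Mz mul0e ltxx.
Qed.

(** H is at least M H / K, and the maximal function of a nontrivial function is
    positive everywhere. *)
Lemma A1_gt0 H (K : R) : measurable_fun setT H -> (forall x, 0 <= H x) ->
  ~ {ae nu, forall x, H x = 0} ->
  (forall x, mean_max B nu H x <= K%:E * H x) -> forall x, 0 < H x.
Proof.
move=> mH H0 Hn0 MH x; have := lt_le_trans (mean_max_gt0 mH H0 Hn0 x) (MH x).
case: (eqVneq (H x) 0) (H0 x) => [->|]; first by rewrite mule0 ltxx.
by move=> h h0 _; rewrite lt_neqAle eq_sym h h0.
Qed.

Lemma real_weight_ae H : (forall x, 0 < H x) -> {ae nu, forall x, H x < +oo} ->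
  {ae nu, forall x, (real_weight H x)%:E = H x}.
Proof. by move=> H0; apply: filterS => x Hx; rewrite real_weightE// H0. Qed.

(** A function with M H <= K H is an A_1 weight: the mean m of H over Q is at most
    K H (x) at almost every point x of Q.  One such point with H (x) < +oo
    shows that m is finite. *)
Lemma A1_real_weight H (K : R) : measurable_fun setT H ->
  (forall x, 0 < H x) -> {ae nu, forall x, H x < +oo} ->
  {ae nu, forall x, mean_max B nu H x <= K%:E * H x} ->
  forall Q, B Q -> exists2 m : R, (0 < m)%R &
    \int[nu]_(x in Q) (real_weight H x)%:E <= m%:E * nu Q /\
    {ae nu, forall x, Q x -> (m <= K * real_weight H x)%R}.
Proof.
move=> mH H0 Hfin MH Q BQ; have [q q0 qE] := nu_fineE nuB BQ.
have cH := real_weight_ae H0 Hfin; have mQ := mB BQ.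
have IcH : \int[nu]_(x in Q) (real_weight H x)%:E = \int[nu]_(x in Q) H x.
  apply: ge0_ae_eq_integral => //.
  - apply: measurable_funTS; apply/measurable_EFinP; exact: measurable_real_weight.
  - exact: measurable_funTS.
  - by move=> x _; rewrite lee_fin ltW// real_weight_gt0.
  - by move=> x _; exact: ltW.
  - by apply: filterS cH => x -> _.
have HQ x : mean_max B nu H x <= K%:E * H x -> Q x ->
    \int[nu]_(y in Q) H y <= K%:E * H x * q%:E.
  move=> MHx Qx; apply: le_trans (mean_maxP nuB H BQ Qx) _.
  by rewrite qE lee_wpmul2r// lee_fin ltW.
have [x0 [Qx0 [MHx0 Hx0]]] :
    exists x, Q x /\ mean_max B nu H x <= K%:E * H x /\ H x < +oo.
  apply: contrapT => nex; have [X [mX X0 HX]] := filterI MH Hfin.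
  have : nu Q <= nu X.
    rewrite le_measure ?inE// => x Qx; apply: HX => /= h.
    by apply: nex; exists x.
  by rewrite X0 qE leNgt lte_fin q0.
have IQfin : \int[nu]_(y in Q) H y \is a fin_num.
  rewrite ge0_fin_numE ?integral_ge0//; last by move=> x _; exact: ltW.
  apply: le_lt_trans (HQ x0 MHx0 Qx0) _.
  by rewrite -(@real_weightE _ _ _ H x0) ?H0// -!EFinM ltry.
have IQpos : 0 < \int[nu]_(y in Q) H y.
  by apply: integral_gt0 => //; case/andP: (nuB BQ).
exists (fine (\int[nu]_(y in Q) H y) / q)%R.
  by rewrite divr_gt0// fine_gt0// IQpos ltey_eq IQfin.
split; first by rewrite IcH qE -EFinM divfK ?gt_eqF// fineK.
apply: filterS2 cH MH => x cx MHx Qx; have := HQ x MHx Qx.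
by rewrite -cx -(fineK IQfin) -!EFinM lee_fin ler_pdivrMr.
Qed.
End A1_majorant.

(** * Truncation *)

Section trunc.
Context {d} {T : measurableType d} {R : realType}.
Variables (E : nat -> set T) (g : T -> \bar R).
Hypothesis mE : forall m, measurable (E m).
Hypothesis ndE : forall m, E m `<=` E m.+1.
Hypothesis mg : measurable_fun setT g.
Hypothesis g0 : forall x, 0 <= g x.

Definition trunc (m : nat) (x : T) : R :=
  (fine (mine (g x) m%:R%:E) * \1_(E m) x)%R.

Let minE m x : (fine (mine (g x) m%:R%:E))%:E = mine (g x) m%:R%:E.
Proof.
rewrite fineK// ge0_fin_numE ?le_min ?g0 ?lee_fin ?ler0n//.
by rewrite (le_lt_trans _ (ltry m%:R))// ge_min lexx orbT.
Qed.

Lemma trunc_ge0 m x : (0 <= trunc m x)%R.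
Proof. by rewrite mulr_ge0// -lee_fin minE le_min g0 lee_fin ler0n. Qed.

Lemma trunc_le_indic m x : (trunc m x <= m%:R * \1_(E m) x)%R.
Proof. by rewrite ler_wpM2r// -lee_fin minE ge_min lexx orbT. Qed.

Lemma trunc_le m x : (trunc m x)%:E <= g x.
Proof.
rewrite /trunc indicE; case: (_ \in _); last by rewrite mulr0.
by rewrite mulr1 minE ge_min lexx.
Qed.

Lemma measurable_trunc m : measurable_fun setT (trunc m).
Proof.
apply: measurable_funM; last exact: measurable_indic.
apply: measurableT_comp; first exact: fine_measurable.
exact: measurable_mine.
Qed.

Lemma trunc_nd x : nondecreasing_seq (trunc ^~ x).
Proof.
apply/nondecreasing_seqP => m; rewrite /trunc !indicE.
have [xE|_] := boolP (x \in E m); last first.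
  by rewrite mulr0 mulr_ge0// -lee_fin minE le_min g0 lee_fin ler0n.
rewrite mem_set; last by apply: ndE; exact/set_mem.
rewrite !mulr1 -lee_fin !minE le_min ge_min lexx/= ge_min.
by rewrite lee_fin ler_nat leqnSn orbT.
Qed.

Lemma trunc_cvg x : (exists m, E m x) -> (fun m => (trunc m x)%:E) @ \oo --> g x.
Proof.
move=> [m0 Em0].
have Em m : (m0 <= m)%N -> x \in E m.
  move=> /subnKC <-; elim: (m - m0)%N => [|i IH]; first by rewrite addn0 mem_set.
  by rewrite addnS mem_set//; apply: ndE; exact/set_mem.
have nd : nondecreasing_seq (fun m => (trunc m x)%:E).
  by move=> i j ij; rewrite lee_fin; exact: trunc_nd.
suff -> : g x = ereal_sup (range (fun m => (trunc m x)%:E)).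
  exact: ereal_nondecreasing_cvgn.
apply/eqP; rewrite eq_le; apply/andP; split; last first.
  by apply: ge_ereal_sup => _ [m _ <-]; exact: trunc_le.
have trE m : (m0 <= m)%N -> (trunc m x)%:E = mine (g x) m%:R%:E.
  by move=> mm; rewrite /trunc indicE Em// mulr1 minE.
have ub m : (trunc m x)%:E <= ereal_sup (range (fun m => (trunc m x)%:E)).
  by apply: ereal_sup_ubound; exists m.
case gx : (g x) (g0 x) => [y| |//] y0.
  pose m := maxn m0 (Num.truncn y).+1; apply: le_trans (ub m).
  rewrite trE ?leq_maxl// gx le_min lexx/= lee_fin.
  apply: le_trans (ltW (truncnS_gt _)) _; by rewrite ler_nat leq_maxr.
rewrite leye_eq; apply/eqP/eq_infty => y.
pose m := maxn m0 (Num.truncn y).+1; apply: le_trans (ub m).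
rewrite trE ?leq_maxl// gx le_min leey/= lee_fin.
by apply: le_trans (ltW (truncnS_gt _)) _; rewrite ler_nat leq_maxr.
Qed.
End trunc.

(** * Measures with a density *)

Section density.
Context {d} {T : measurableType d} {R : realType}.
Variables (mu : {measure set T -> \bar R}) (w : T -> R).
Hypothesis mw : measurable_fun setT w.
Hypothesis w0 : forall x, (0 <= w x)%R.

Let dens (A : set T) := \int[mu]_(x in A) (w x)%:E.

Let dens0 : dens set0 = 0. Proof. by rewrite /dens integral_set0. Qed.

Let dens_ge0 A : 0 <= dens A.
Proof. by apply: integral_ge0 => x _; rewrite lee_fin. Qed.

Let dens_sigma_additive : semi_sigma_additive dens.
Proof.
move=> F mF tF mUF; rewrite /dens; apply: cvg_toP.
  apply: ereal_nondecreasing_is_cvgn => m n mn.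
  by apply: lee_sum_nneg_natr => // k _ _; exact: dens_ge0.
rewrite ge0_integral_bigcup//= => [|x _]; last by rewrite lee_fin.
by apply: measurable_funTS; exact/measurable_EFinP.
Qed.

HB.instance Definition _ :=
  isMeasure.Build _ _ _ dens dens0 dens_ge0 dens_sigma_additive.

Import HBNNSimple.

(** The integration formula holds by definition for indicator functions, hence
    for simple functions, and in general by monotone convergence. *)
Lemma exists_density_measure : exists nu : {measure set T -> \bar R},
  (forall A, nu A = \int[mu]_(x in A) (w x)%:E) /\
  forall A f, measurable A -> measurable_fun A f -> (forall x, 0 <= f x) ->
    \int[nu]_(x in A) f x = \int[mu]_(x in A) (f x * (w x)%:E).
Proof.
exists [the measure _ _ of dens]; split => // A f mA mfA f0.
set nu := [the measure _ _ of dens].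
have mwE : measurable_fun setT (EFin \o w) by exact/measurable_EFinP.
have w0E x : 0 <= (w x)%:E by rewrite lee_fin.
have simple (h : {nnsfun T >-> R}) :
    \int[nu]_x (h x)%:E = \int[mu]_x ((h x)%:E * (w x)%:E).
  rewrite integralT_nnsfun sintegralE.
  have term0 y x : 0 <= (y * \1_(h @^-1` [set y]) x)%:E * (w x)%:E.
    by rewrite mule_ge0//; exact: nnfun_muleindic_ge0.
  under [RHS]eq_integral => x _.
    rewrite (fimfunE h) -fsumEFin// ge0_mule_fsuml; last first.
      by move=> y; exact: nnfun_muleindic_ge0.
    over.
  rewrite /= ge0_integral_fsum//; last first.
    move=> y; apply: emeasurable_funM => //; apply/measurable_EFinP.
    exact: measurable_funM.
  apply: eq_fsbigr => y /set_mem[z _ <-].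
  have hz : 0 <= (h z)%:E by rewrite lee_fin.
  have mh : measurable (h @^-1` [set h z]) by exact: measurable_sfunP.
  under eq_integral do rewrite EFinM -muleA muleCA.
  rewrite /nu /= /dens; under [RHS]eq_integral do rewrite muleCA.
  rewrite ge0_integralZl//; last 2 first.
  - by apply: emeasurable_funM => //; apply/measurable_EFinP.
  - by move=> x _; rewrite mule_ge0// lee_fin.
  congr (_ * _); rewrite integral_mkcond; apply: eq_integral => x _.
  by rewrite epatch_indic muleC.
rewrite [LHS]integral_mkcond [RHS]integral_mkcond.
have mf : measurable_fun setT (f \_ A) by exact/(measurable_restrictT _ mA).
have fA0 x : 0 <= (f \_ A) x by apply: erestrict_ge0.
have -> : (fun x => f x * (w x)%:E) \_ A = fun x => (f \_ A) x * (w x)%:E.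
  by apply/funext => x; rewrite !patchE; case: ifP => //; rewrite mul0e.
pose h := nnsfun_approx measurableT mf.
have cvh x : (h n x)%:E @[n --> \oo] --> (f \_ A) x.
  by apply: (cvg_nnsfun_approx measurableT mf) => //.
have ndh x : nondecreasing_seq (fun n => (h n x)%:E).
  by move=> a b ab; rewrite lee_fin; exact/lefP/nd_nnsfun_approx.
have mh n : measurable_fun setT (fun x => (h n x)%:E) by exact/measurable_EFinP.
transitivity (\int[nu]_x limn (fun n => (h n x)%:E)).
  by apply: eq_integral => x _; apply/esym/cvg_lim => //; exact: cvh.
transitivity (\int[mu]_x limn (fun n => (h n x)%:E * (w x)%:E)); last first.
  by apply: eq_integral => x _; apply/cvg_lim => //; apply: cvgeZr => //; exact: cvh.
rewrite !monotone_convergence//.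
- by congr (limn _); apply/funext => n; exact: simple.
- by move=> n; exact: emeasurable_funM.
- by move=> n x _; rewrite mule_ge0// lee_fin.
- by move=> x _ a b ab; rewrite lee_wpmul2r//; exact: ndh.
- by move=> n x _; rewrite lee_fin.
Qed.
End density.

(** * The iteration of Rubio de Francia *)

(** The majorant is H = sum_k (4 K)^-k S^k h: applying S to the k-th term gives
    4 K times the next one, so that S H <= 4 K H by countable subadditivity.
    Size is expressed by a class P stable under S / K and a class P' which
    contains the sums of functions of P with weights 4^-k.  The ratio 4, instead
    of the usual 2, leaves a factor 2^-k with which the p-th power of the sum is
    bounded termwise when P is a ball of L^p (poweR_series_le). *)
Lemma rubio_de_francia d (T : measurableType d) (R : realType)
    (S : (T -> \bar R) -> T -> \bar R) (P P' : set (T -> \bar R)) (K : R) :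
  (0 < K)%R ->
  (forall f, measurable_fun setT f -> (forall x, 0 <= f x) ->
    measurable_fun setT (S f)) ->
  (forall f, measurable_fun setT f -> (forall x, 0 <= f x) ->
    forall x, 0 <= S f x) ->
  (forall f_ : nat -> T -> \bar R, (forall k, measurable_fun setT (f_ k)) ->
    (forall k x, 0 <= f_ k x) -> forall x,
    S (fun y => \sum_(k <oo) f_ k y) x <= \sum_(k <oo) S (f_ k) x) ->
  (forall f (a : R), measurable_fun setT f -> (forall x, 0 <= f x) ->
    (0 < a)%R -> forall x, S (fun y => a%:E * f y) x = a%:E * S f x) ->
  (forall f, measurable_fun setT f -> (forall x, 0 <= f x) -> P f ->
    P (fun x => K^-1%:E * S f x)) ->
  (forall f_ : nat -> T -> \bar R, (forall k, measurable_fun setT (f_ k)) ->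
    (forall k x, 0 <= f_ k x) -> (forall k, P (f_ k)) ->
    P' (fun x => \sum_(k <oo) (4 ^- k)%:E * f_ k x)) ->
  forall h, measurable_fun setT h -> (forall x, 0 <= h x) -> P h ->
  exists H, [/\ measurable_fun setT H, forall x, h x <= H x,
    forall x, S H x <= (4 * K)%:E * H x & P' H].
Proof.
move=> K0 mS S0 Sseries SZ PS P'series h mh h0 Ph.
pose f_ k := iter k (fun f x => K^-1%:E * S f x) h.
have fP k : [/\ measurable_fun setT (f_ k), forall x, 0 <= f_ k x & P (f_ k)].
  elim: k => [//|k [mf f0 Pf]]; split => /=; last exact: PS.
  - by apply: measurable_funeM; exact: mS.
  - by move=> x; rewrite mule_ge0 ?lee_fin ?invr_ge0 ?S0// ltW.
have mf k : measurable_fun setT (f_ k) by case: (fP k).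
have f0 k x : 0 <= f_ k x by case: (fP k).
have c0 k : (0 < 4 ^- k :> R)%R by rewrite invr_gt0 exprn_gt0.
pose t k x := (4 ^- k)%:E * f_ k x.
have mt k : measurable_fun setT (t k) by exact: measurable_funeM.
have t0 k x : 0 <= t k x by rewrite mule_ge0 ?lee_fin// ltW.
exists (fun x => \sum_(k <oo) t k x); split.
- exact: ge0_emeasurable_sum.
- move=> x; apply: le_trans (nneseries_ge_term 0 (fun k => t0 k x)).
  by rewrite /t expr0 invr1 mul1e.
- move=> x; apply: le_trans (Sseries _ mt t0 x) _.
  have E k : S (t k) x = (4 * K)%:E * t k.+1 x.
    rewrite SZ// /t /= !muleA -!EFinM; congr (_%:E * _).
    by rewrite exprS; field; rewrite gt_eqF ?exprn_gt0//= gt_eqF.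
  under eq_eseriesr do rewrite E.
  rewrite nneseriesZl//; apply: lee_wpmul2l.
    by rewrite lee_fin mulr_ge0// ltW.
  rewrite [leRHS]nneseries_recl// -[leLHS]add0e; apply: leeD => //.
  rewrite -(nneseries_addn 1)//.
  by under [leRHS]eq_eseriesr do rewrite addn1.
- by apply: P'series => // k; case: (fP k).
Qed.

(** * The theorem of Lorentz and Luxemburg *)

Section lorentz_luxemburg.
Context {d} {T : measurableType d} {R : realType}.
Variables (nu : {measure set T -> \bar R}) (N : (T -> \bar R) -> \bar R).
Hypothesis N_le : forall f g : T -> \bar R, measurable_fun setT f -> measurable_fun setT g ->
  (forall x, 0 <= f x) -> (forall x, 0 <= g x) ->
  {ae nu, forall x, f x <= g x} -> N f <= N g.
Hypothesis N_triangle : forall f g : T -> \bar R, measurable_fun setT f ->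
  measurable_fun setT g -> (forall x, 0 <= f x) -> (forall x, 0 <= g x) ->
  N (f \+ g) <= N f + N g.
Hypothesis N_homogeneous : forall (a : R) (f : T -> \bar R), measurable_fun setT f ->
  (forall x, 0 <= f x) -> (0 <= a)%R -> N (fun x => a%:E * f x) = a%:E * N f.
Hypothesis N_fatou : forall (f_ : nat -> T -> \bar R) (f : T -> \bar R) (y : \bar R),
  (forall k, measurable_fun setT (f_ k)) -> measurable_fun setT f ->
  (forall k x, 0 <= f_ k x) -> (forall x, 0 <= f x) ->
  (forall x, nondecreasing_seq (f_ ^~ x)) ->
  (forall x, f_ ^~ x @ \oo --> f x) -> (forall k, N (f_ k) <= y) -> N f <= y.

(** First for F bounded and supported in a set E of finite measure.  Instead of
    separating F from the ball of radius B by the theorem of Hahn and Banach,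
    take the element g0 of the ball that is nearest to F in L^2 among those
    between 0 and F: the residual F - g0 defines the separating functional. *)
Section bounded.
Variables (E : set T) (F : T -> R) (k B : R).
Hypothesis mE : measurable E.
Hypothesis nuE : nu E < +oo.
Hypothesis mF : measurable_fun setT F.
Hypothesis F_ge0 : forall x, (0 <= F x)%R.
Hypothesis F_le : forall x, (F x <= k * \1_E x)%R.
Hypothesis k0 : (0 < k)%R.
Hypothesis B0 : (0 < B)%R.

Let J (g : T -> R) := \int[nu]_x ((F x - g x) ^+ 2)%:E.

Let S (g : T -> R) := [/\ measurable_fun setT g, forall x, (0 <= g x)%R,
  forall x, (g x <= F x)%R & N (EFin \o g) <= B%:E].

Let m_fin : nu E \is a fin_num.
Proof. by rewrite ge0_fin_numE// measure_ge0. Qed.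

Let S0 : S (fun=> 0%R).
Proof.
split => //.
have -> : EFin \o (fun=> 0%R) = (fun x : T => 0%:E * (EFin \o F) x).
  by apply/funext => x /=; rewrite mul0e.
rewrite N_homogeneous//; last exact/measurable_EFinP.
by rewrite mul0e lee_fin ltW.
Qed.

Let mJ' (g : T -> R) : measurable_fun setT g ->
  measurable_fun setT (fun x => (F x - g x) ^+ 2)%R.
Proof. by move=> mg; apply: measurable_funX; exact: measurable_funB. Qed.

Let mJ (g : T -> R) : measurable_fun setT g ->
  measurable_fun setT (fun x => ((F x - g x) ^+ 2)%:E).
Proof. by move=> mg; apply/measurable_EFinP; exact: mJ'. Qed.

Let int_le (g : T -> R) (c : R) : measurable_fun setT g -> (0 <= c)%R ->
  (forall x, 0 <= g x)%R -> (forall x, g x <= c * \1_E x)%R ->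
  \int[nu]_x (g x)%:E <= (c * fine (nu E))%:E.
Proof.
move=> mg c0 g0 gc; apply: (@le_trans _ _ (\int[nu]_x (c * \1_E x)%:E)).
  by apply: le_integral_EFin => //; apply: measurable_funM.
rewrite integralZ_EFin//; by rewrite integral_indic// setIT EFinM fineK.
Qed.

Let S_mid (g1 g2 : T -> R) (a : R) : S g1 -> S g2 -> (0 <= a <= 1)%R ->
  S (fun x => (1 - a) * g1 x + a * g2 x)%R.
Proof.
move=> [m1 p1 l1 N1] [m2 p2 l2 N2] /andP[a0 a1].
have a1' : (0 <= 1 - a)%R by rewrite subr_ge0.
split => [|x|x|].
- by apply: measurable_funD; apply: measurable_funM.
- by rewrite addr_ge0// mulr_ge0.
- have -> : F x = ((1 - a) * F x + a * F x)%R by ring.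
  by rewrite lerD// ler_wpM2l.
- pose G1 x := (1 - a)%:E * (EFin \o g1) x; pose G2 x := a%:E * (EFin \o g2) x.
  have mG1 : measurable_fun setT G1 by apply: measurable_funeM; exact/measurable_EFinP.
  have mG2 : measurable_fun setT G2 by apply: measurable_funeM; exact/measurable_EFinP.
  apply: (@le_trans _ _ (N G1 + N G2)).
    rewrite (_ : _ \o _ = G1 \+ G2).
      by apply: N_triangle => // x; rewrite /G1 /G2 mule_ge0 ?lee_fin//=.
    by apply/funext => x /=; rewrite /G1 /G2 /= -!EFinM -EFinD.
  rewrite !N_homogeneous//; try exact/measurable_EFinP.
  have -> : B%:E = (1 - a)%:E * B%:E + a%:E * B%:E.
    by rewrite -!EFinM -EFinD; congr EFin; ring.
  by rewrite leeD// lee_wpmul2l.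
Qed.

Let J_le (g : T -> R) : S g -> J g <= (k ^+ 2 * fine (nu E))%:E.
Proof.
move=> [mg g0 gF _]; apply: int_le => //.
- by apply: measurable_funX; exact: measurable_funB.
- by rewrite exprn_ge0// ltW.
- by move=> x; rewrite exprn_even_ge0.
- move=> x; have := F_le x; have := gF x; have := g0 x; rewrite indicE.
  by case: (x \in E) => /=; rewrite ?mulr1 ?mulr0; nra.
Qed.

(** The infimum of J over the convex set S is attained: by the parallelogram
    identity a minimizing sequence is Cauchy in L^2, fast enough for its
    increments to be summable in L^1 on E; the pointwise lower limit is then a
    minimizer, and belongs to S by the Fatou property. *)
Let minimizer : exists2 g0, S g0 & forall g : T -> R, S g -> J g0 <= J g.
Proof.
pose dd := ereal_inf [set J g | g in S].
have J0 (g : T -> R) : 0 <= J g by apply: integral_ge0 => x _; rewrite lee_fin sqr_ge0.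
have dd_le (g : T -> R) : S g -> dd <= J g by move=> Sg; apply: ereal_inf_lbound; exists g.
have dd0 : 0 <= dd by apply: le_ereal_inf_tmp => _ [g _ <-].
have dd_fin : dd \is a fin_num.
  rewrite ge0_fin_numE//; apply: le_lt_trans (dd_le _ S0) _.
  exact: le_lt_trans (J_le S0) (ltry _).
have pick j : {g | S g & J g < dd + (8 ^- j)%:E}.
  apply: cid2; have e0 : (0 < 8 ^- j :> R)%R by rewrite invr_gt0 exprn_gt0.
  by have [_ [g Sg <-] ?] := lb_ereal_inf_adherent e0 dd_fin; exists g.
pose g j := s2val (pick j).
have Sg j : S (g j) by rewrite /g; case: (pick j).
have Jg j : J (g j) <= dd + (8 ^- j)%:E by rewrite /g; case: (pick j) => ? ? /= /ltW.
have mg j : measurable_fun setT (g j) by case: (Sg j).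
have g0 j x : (0 <= g j x)%R by case: (Sg j).
have gF j x : (g j x <= F x)%R by case: (Sg j).
pose D j x : R := `|g j.+1 x - g j x|%R.
have mD j : measurable_fun setT (D j).
  by apply: measurableT_comp => //; exact: measurable_funB.
have D0 j x : (0 <= D j x)%R by rewrite /D.
(* The midpoint of g_j and g_(j+1) lies in S, so J is at least dd there. *)
have D2 j : \int[nu]_x (D j x ^+ 2)%:E <= (4 * 8 ^- j)%:E.
  have half : (0 <= (1 / 2 : R) <= 1)%R by lra.
  have SM := S_mid (Sg j) (Sg j.+1) half.
  set M := (fun x => _)%R in SM.
  have : J M + \int[nu]_x (4^-1 * D j x ^+ 2)%:E =
     (1/2)%:E * J (g j) + (1/2)%:E * J (g j.+1).
    rewrite -!integralZ_EFin//; try exact: mJ'; try by move=> x; rewrite sqr_ge0.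
    rewrite -!integralD_EFin//.
    + apply: eq_integral => x _; congr EFin.
      by rewrite /M /D real_normK ?num_real//; field.
    + by apply: measurable_funM => //; exact: mJ'.
    + by apply: measurable_funM => //; exact: mJ'.
    + by move=> x; rewrite mulr_ge0// sqr_ge0.
    + by move=> x; rewrite mulr_ge0// sqr_ge0.
    + by apply: mJ'; case: SM.
    + by apply: measurable_funM => //; exact: measurable_funX.
    + by move=> x; rewrite sqr_ge0.
    + by move=> x; rewrite mulr_ge0// sqr_ge0.
  rewrite integralZ_EFin//; last 2 first.
  - exact: measurable_funX.
  - by move=> x; rewrite sqr_ge0.
  move=> E1.
  have : dd + 4^-1%:E * \int[nu]_x (D j x ^+ 2)%:E <= dd + (8 ^- j)%:E.
    apply: (@le_trans _ _ ((1/2)%:E * J (g j) + (1/2)%:E * J (g j.+1))).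
      by rewrite -E1 leeD2r// dd_le.
    have -> : dd + (8 ^- j)%:E = (1/2)%:E * (dd + (8 ^- j)%:E) + (1/2)%:E * (dd + (8 ^- j)%:E).
      by rewrite -ge0_muleDl// -EFinD -splitr mul1e.
    rewrite leeD// lee_wpmul2l// (le_trans (Jg j.+1))// leeD2l// lee_fin.
    by rewrite lef_pV2 ?posrE ?exprn_gt0// ler_weXn2l// ler1n.
  rewrite leeD2lE// => h; rewrite EFinM -lee_pdivrMl//.
(* From L^2 to L^1 on E: either D <= 2^-j, or D <= 2^j D^2; the precision 8^-j
   makes both parts of order 2^-j. *)
have D1 j : \int[nu]_x (D j x)%:E <= ((fine (nu E) + 4) * 2 ^- j)%:E.
  apply: (@le_trans _ _ (\int[nu]_x (2 ^- j * \1_E x + 2 ^+ j * D j x ^+ 2)%:E)).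
    apply: le_integral_EFin => //.
    + by apply: measurable_funD; apply: measurable_funM => //; exact: measurable_funX.
    + move=> x; rewrite indicE.
      have p2 : (0 < 2 ^+ j :> R)%R by rewrite exprn_gt0.
      have [xE|xE] := boolP (x \in E); last first.
        have Fx : (F x <= 0)%R by have := F_le x; rewrite indicE (negbTE xE) mulr0.
        have gz i : g i x = 0%R.
          by apply/le_anti; rewrite g0 andbT (le_trans (gF i x)).
        have -> : D j x = 0%R by rewrite /D !gz subrr normr0.
        by rewrite !mulr0 expr0n/= mulr0 addr0.
      rewrite mulr1; have [Dj|Dj] := leP (D j x) (2 ^- j).
        by rewrite ler_wpDr// mulr_ge0 ?sqr_ge0// ltW.
      rewrite ler_wpDl ?invr_ge0 ?(ltW p2)// expr2 mulrA ler_peMl//.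
      by rewrite -ler_pdivrMl// mulr1 ltW.
  have m1 : measurable_fun setT (fun x => 2 ^- j * \1_E x : R)%R.
    exact: measurable_funM.
  have m2 : measurable_fun setT (fun x => 2 ^+ j * D j x ^+ 2)%R.
    by apply: measurable_funM => //; exact: measurable_funX.
  have p1 x : (0 <= 2 ^- j * \1_E x :> R)%R by rewrite mulr_ge0// invr_ge0 exprn_ge0.
  have p2 x : (0 <= 2 ^+ j * D j x ^+ 2)%R by rewrite mulr_ge0 ?sqr_ge0// exprn_ge0.
  rewrite integralD_EFin//.
  rewrite mulrDl EFinD; apply: leeD.
    by rewrite [(fine _ * _)%R]mulrC; apply: int_le; rewrite ?invr_ge0 ?exprn_ge0.
  have m3 : measurable_fun setT (fun x => D j x ^+ 2)%R by exact: measurable_funX.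
  have p3 x : (0 <= D j x ^+ 2)%R by rewrite sqr_ge0.
  rewrite integralZ_EFin// ?exprn_ge0//.
  apply: (@le_trans _ _ ((2 ^+ j)%:E * (4 * 8 ^- j)%:E)).
    by rewrite lee_wpmul2l// lee_fin exprn_ge0.
  rewrite -EFinM lee_fin.
  have -> : (8 = 2 * 2 * 2 :> R)%R by ring.
  rewrite !exprMn; have y1 : (1 <= 2 ^+ j :> R)%R by rewrite exprn_ege1// ler1n.
  set y := (2 ^+ j)%R in y1 *; have y0 : (0 < y)%R by exact: lt_le_trans y1.
  have -> : (y * (4 / (y * y * y)) = 4 / y * y^-1)%R by field; rewrite gt_eqF.
  by rewrite -[leRHS]mulr1 ler_wpM2l ?divr_ge0 ?invf_le1// ltW.
pose ge j x := (g j x)%:E.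
pose gl x := fine (limn_einf (ge ^~ x)).
have ei_g m i x : (m <= i)%N -> einfs (ge ^~ x) m <= ge i x.
  by move=> mi; apply: ereal_inf_lbound; exists i.
have ei_bnd m x : 0 <= einfs (ge ^~ x) m <= (F x)%:E.
  apply/andP; split.
    by apply: le_ereal_inf_tmp => _ [i /= mi <-]; rewrite lee_fin.
  by apply: le_trans (ei_g m m x (leqnn m)) _; rewrite lee_fin.
have ndei x : nondecreasing_seq (einfs (ge ^~ x)) by exact: nondecreasing_einfs.
have glE x : limn_einf (ge ^~ x) = (gl x)%:E.
  rewrite /gl fineK// limn_einf_lim fin_numElt; apply/andP; split.
    apply: (@lt_le_trans _ _ 0) => //; apply: lime_ge; first exact: ereal_nondecreasing_is_cvgn.
    by apply: nearW => m; case/andP: (ei_bnd m x).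
  apply: (@le_lt_trans _ _ (F x)%:E); last exact: ltry.
  apply: lime_le; first exact: ereal_nondecreasing_is_cvgn.
  by apply: nearW => m; case/andP: (ei_bnd m x).
have ei_gl m x : einfs (ge ^~ x) m <= (gl x)%:E.
  rewrite -glE limn_einf_lim.
  rewrite (cvg_lim _ (ereal_nondecreasing_cvgn (ndei x)))//.
  by apply: ereal_sup_ubound; exists m.
have gl0 x : (0 <= gl x)%R.
  by rewrite -lee_fin; apply: le_trans (ei_gl 0%N x); case/andP: (ei_bnd 0%N x).
have glF x : (gl x <= F x)%R.
  rewrite -lee_fin -glE limn_einf_lim; apply: lime_le; first exact: ereal_nondecreasing_is_cvgn.
  by apply: nearW => m; case/andP: (ei_bnd m x).
have mge j : measurable_fun setT (ge j) by exact/measurable_EFinP.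
have mei m : measurable_fun setT (fun x => einfs (ge ^~ x) m) by exact: measurable_fun_einfs.
have ei_cvg x : (fun m => einfs (ge ^~ x) m) @ \oo --> (EFin \o gl) x.
  by rewrite /= -glE limn_einf_lim; exact: ereal_nondecreasing_is_cvgn.
have mgl : measurable_fun setT gl.
  by apply/measurable_EFinP; apply: emeasurable_fun_cvg mei _ => x _; exact: ei_cvg.
have Sgl : S gl.
  split => //; apply: (N_fatou mei) => //.
  - exact/measurable_EFinP.
  - by move=> m x; case/andP: (ei_bnd m x).
  - move=> m; case: (Sg m) => _ _ _; apply: le_trans; apply: N_le => //.
    + exact/measurable_EFinP.
    + by move=> x; case/andP: (ei_bnd m x).
    + by move=> x; rewrite lee_fin.
    + by apply: aeW => x; exact: ei_g.
exists gl => // g' Sg'; apply: le_trans (dd_le _ Sg').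
pose e m x := \sum_(i <oo) (D (m + i)%N x)%:E.
have e0 m x : 0 <= e m x by apply: nneseries_ge0 => i _ _; rewrite lee_fin.
have me m : measurable_fun setT (e m).
  by apply: ge0_emeasurable_sum => i *; [rewrite lee_fin|exact/measurable_EFinP].
have tele m i x : (g m x)%:E <= (g (m + i)%N x)%:E + e m x.
  apply: (@le_trans _ _ ((g (m + i)%N x)%:E + \sum_(0 <= l < i) (D (m + l)%N x)%:E)); last first.
    by rewrite leeD2l//; apply: nneseries_lim_ge => l _ _; rewrite lee_fin.
  rewrite sumEFin -EFinD lee_fin; elim: i => [|i IH]; first by rewrite addn0 big_nil addr0.
  rewrite big_nat_recr//= addnS; apply: le_trans IH _.
  by rewrite [leRHS]addrCA [leLHS]addrC lerD2l /D -lerBlDl distrC ler_norm.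
have ei_e m x : (g m x)%:E <= (gl x)%:E + e m x.
  case: (e m x) (e0 m x) (fun i => tele m i x) => [r| |//] r0 h; last by rewrite addey// leey.
  rewrite -leeBlDr//; apply: le_trans (ei_gl m x).
  apply: le_ereal_inf_tmp => _ [i mi <-]; rewrite leeBlDr// -(subnKC mi).
  exact: h.
have Jgl m : J gl <= dd + (8 ^- m + 2 * k * (2 * (fine (nu E) + 4) * 2 ^- m))%:E.
  rewrite EFinD addeA.
  apply: (@le_trans _ _ (J (g m) + (2 * k)%:E * \int[nu]_x e m x)); last first.
    apply: leeD => //; rewrite [leRHS]EFinM lee_wpmul2l ?lee_fin ?mulr_ge0 ?(ltW k0)//.
    rewrite integral_nneseries//; last 2 first.
    - by move=> i; exact/measurable_EFinP.
    - by move=> i x _; rewrite lee_fin.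
    apply: le_trans (nneseries_geometric_half m _).
      apply: lee_nneseries => [i _ _|i _]; last exact: D1.
      by apply: integral_ge0 => x _; rewrite lee_fin.
    by rewrite addr_ge0// fine_ge0// measure_ge0.
  have k20 : (0 <= 2 * k)%R by rewrite mulr_ge0// ltW.
  have m1 : measurable_fun setT (fun x => (2 * k)%:E * e m x) by exact: measurable_funeM.
  have p1 x : 0 <= (2 * k)%:E * e m x by rewrite mule_ge0.
  have p2 x : 0 <= ((F x - g m x) ^+ 2)%:E by rewrite lee_fin sqr_ge0.
  rewrite -ge0_integralZT// -ge0_integralDT//; last exact: mJ.
  apply: ge0_le_integralT.
  + exact: mJ.
  + by apply: emeasurable_funD; [exact: mJ|exact: measurable_funeM].
  + by move=> x; rewrite lee_fin sqr_ge0.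
  move=> x; case: (e m x) (e0 m x) (ei_e m x) => [r| |//]; last first.
    by move=> _ _; rewrite gt0_muley ?addey ?leey// lte_fin mulr_gt0.
  rewrite -EFinM -!EFinD => + + ; rewrite !lee_fin => r0 gr.
  have Fk : (F x <= k)%R.
    apply: le_trans (F_le x) _; rewrite indicE; case: (_ \in _); rewrite ?mulr1//.
    by rewrite mulr0 ltW.
  have := g0 m x; have := gF m x; have := gl0 x; have := glF x.
  move: (g m x) (gl x) (F x) gr Fk => a b c abr ck bc b0' ac a0.
  have h1 : (c - b <= c - a + r)%R by lra.
  have [h2|h2] := leP a b; first by rewrite ler_wpDr ?mulr_ge0 ?(ltW k0)//; nra.
  nra.
apply/lee_addgt0Pr => eps eps0.
pose A := (1 + 2 * k * (2 * (fine (nu E) + 4)))%R.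
have A0 : (0 < A)%R.
  by rewrite ltr_pwDl// !mulr_ge0// ?(ltW k0)// addr_ge0// fine_ge0// measure_ge0.
have [m hm] : exists m, (A * 2 ^- m <= eps)%R.
  exists (Num.truncn (A / eps)).+1; rewrite ler_pdivrMr ?exprn_gt0// -ler_pdivrMl//.
  rewrite mulrC; apply: le_trans (ltW (truncnS_gt _)) _.
  by rewrite -natrX ler_nat ltnW// ltn_expl.
apply: le_trans (Jgl m) _; rewrite leeD2l// lee_fin; apply: le_trans hm.
have -> : (A * 2 ^- m = 2 ^- m + 2 * k * (2 * (fine (nu E) + 4) * 2 ^- m))%R.
  by rewrite /A; ring.
rewrite lerD2r lef_pV2 ?posrE ?exprn_gt0//.
by rewrite lerXn2r ?nnegrE ?ler_nat.
Qed.

(** At a minimizer g0 the residual h = F - g0 is an outer normal of the unit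
    ball: moving from g0 towards any competitor g and truncating at F cannot
    decrease J. *)
Let variational (g0 g : T -> R) (A : R) : S g0 -> (forall g', S g' -> J g0 <= J g') ->
  measurable_fun setT g -> (forall x, 0 <= g x)%R ->
  (forall x, g x <= A * \1_E x)%R -> N (EFin \o g) <= B%:E ->
  \int[nu]_x (g x * (F x - g0 x))%:E <= \int[nu]_x (g0 x * (F x - g0 x))%:E.
Proof.
move=> Sg0 g0min mg gp gA Ng.
have [mg0 g0p g0F Ng0] := Sg0.
pose A' := (`|A| + k)%R.
have A'0 : (0 <= A')%R by rewrite addr_ge0// ltW.
have m1 : measurable_fun setT (fun x => g x * (F x - g0 x))%R.
  by apply: measurable_funM => //; exact: measurable_funB.
have m2 : measurable_fun setT (fun x => g0 x * (F x - g0 x))%R.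
  by apply: measurable_funM => //; exact: measurable_funB.
have p1 x : (0 <= g x * (F x - g0 x))%R by rewrite mulr_ge0// subr_ge0.
have p2 x : (0 <= g0 x * (F x - g0 x))%R by rewrite mulr_ge0// subr_ge0.
have Fk x : (F x <= k)%R.
  apply: le_trans (F_le x) _; rewrite indicE; case: (_ \in _); rewrite ?mulr1//.
  by rewrite mulr0 ltW.
have int2 : \int[nu]_x (g0 x * (F x - g0 x))%:E <= (k ^+ 2 * fine (nu E))%:E.
  apply: int_le => //; first by rewrite exprn_ge0// ltW.
  move=> x; have := F_le x; have := g0F x; have := g0p x; rewrite indicE.
  by case: (x \in E) => /=; rewrite ?mulr1 ?mulr0; nra.
apply/lee_addgt0Pr => eps eps0.
pose C := (A' ^+ 2 * fine (nu E))%R.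
have C0 : (0 <= C)%R by rewrite mulr_ge0 ?sqr_ge0// fine_ge0// measure_ge0.
pose t := Num.min 1%R (eps / (C + 1))%R.
have t0 : (0 < t)%R by rewrite lt_min ltr01 divr_gt0// ltr_wpDl.
have t1 : (t <= 1)%R by rewrite ge_min lexx.
have tC : (t * C <= eps)%R.
  apply: (@le_trans _ _ (eps / (C + 1) * C)%R).
    by rewrite ler_wpM2r// ge_min lexx orbT.
  rewrite -mulrA ler_piMr ?(ltW eps0)// mulrC ler_pdivrMr ?ltr_wpDl// mul1r.
  by rewrite lerDl.
pose gt x := Num.min ((1 - t) * g0 x + t * g x)%R (F x).
have mix0 x : (0 <= (1 - t) * g0 x + t * g x)%R.
  by rewrite addr_ge0// mulr_ge0// ?subr_ge0// ltW.
have mmix : measurable_fun setT (fun x => (1 - t) * g0 x + t * g x)%R.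
  by apply: measurable_funD; apply: measurable_funM.
have mgt : measurable_fun setT gt by exact: measurable_minr.
have Sgt : S gt.
  split => // [x|x|].
  - by rewrite le_min mix0 F_ge0.
  - by rewrite ge_min lexx orbT.
  pose G1 x := (1 - t)%:E * (EFin \o g0) x; pose G2 x := t%:E * (EFin \o g) x.
  have mG1 : measurable_fun setT G1 by apply: measurable_funeM; exact/measurable_EFinP.
  have mG2 : measurable_fun setT G2 by apply: measurable_funeM; exact/measurable_EFinP.
  have G10 x : 0 <= G1 x by rewrite mule_ge0 ?lee_fin//= subr_ge0.
  have G20 x : 0 <= G2 x by rewrite mule_ge0 ?lee_fin//= ltW.
  apply: (@le_trans _ _ (N (G1 \+ G2))).
    apply: N_le => //; [exact/measurable_EFinP|exact: emeasurable_funD| |].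
    - by move=> x; rewrite lee_fin le_min mix0 F_ge0.
    - by apply: aeW => x; rewrite /G1 /G2 /= -!EFinM -EFinD lee_fin ge_min lexx.
  apply: (@le_trans _ _ (N G1 + N G2)); first exact: N_triangle.
  rewrite !N_homogeneous//; try exact/measurable_EFinP; rewrite ?subr_ge0 ?(ltW t0)//.
  have -> : B%:E = (1 - t)%:E * B%:E + t%:E * B%:E.
    by rewrite -!EFinM -EFinD; congr EFin; ring.
  by rewrite leeD// lee_wpmul2l// lee_fin ?subr_ge0// ltW.
have key x : ((F x - gt x) ^+ 2 + 2 * t * (g x * (F x - g0 x)) <=
    (F x - g0 x) ^+ 2 + (2 * t * (g0 x * (F x - g0 x)) + t ^+ 2 * (A' ^+ 2 * \1_E x)))%R.
  have sq : ((F x - gt x) ^+ 2 <= (F x - ((1 - t) * g0 x + t * g x)) ^+ 2)%R.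
    rewrite /gt; case: (leP ((1 - t) * g0 x + t * g x)%R (F x)) => _ //.
    by rewrite subrr expr0n/= sqr_ge0.
  have dif : ((g x - g0 x) ^+ 2 <= A' ^+ 2 * \1_E x)%R.
    move: (gA x) (F_le x) (g0F x) (gp x) (g0p x); rewrite indicE.
    case: (x \in E) => /=; rewrite ?mulr1 ?mulr0; last first.
      move=> h1 h2 h3 h4 h5.
      have -> : g x = 0%R by apply/le_anti; rewrite h1.
      have -> : g0 x = 0%R by apply/le_anti; rewrite h5 (le_trans h3).
      by rewrite subrr expr0n.
    move=> h1 h2 h3 h4 h5; rewrite -[leLHS]real_normK ?num_real// ler_pXn2r ?nnegrE//.
    rewrite ler_norml /A'; apply/andP; split.
      rewrite lerNl opprB; apply: (@le_trans _ _ k); last by rewrite lerDr.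
      by rewrite lerBlDr; apply: le_trans (le_trans h3 h2) _; rewrite lerDl.
    rewrite lerBlDr; apply: le_trans (le_trans h1 (ler_norm A)) _.
    by rewrite -addrA lerDl addr_ge0// ltW.
  apply: (@le_trans _ _ ((F x - ((1 - t) * g0 x + t * g x)) ^+ 2 +
     2 * t * (g x * (F x - g0 x)))%R); first by rewrite lerD2r.
  have -> : ((F x - ((1 - t) * g0 x + t * g x)) ^+ 2 + 2 * t * (g x * (F x - g0 x)) =
    (F x - g0 x) ^+ 2 + (2 * t * (g0 x * (F x - g0 x)) + t ^+ 2 * (g x - g0 x) ^+ 2))%R.
    by ring.
  by rewrite !lerD2l ler_wpM2l// sqr_ge0.
have m3 : measurable_fun setT (fun x => t ^+ 2 * (A' ^+ 2 * \1_E x))%R.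
  by apply: measurable_funM => //; apply: measurable_funM.
have p3 x : (0 <= t ^+ 2 * (A' ^+ 2 * \1_E x))%R by rewrite mulr_ge0 ?sqr_ge0// mulr_ge0 ?sqr_ge0.
have tt0 : (0 <= 2 * t)%R by rewrite mulr_ge0// ltW.
have I1 : J gt + (2 * t)%:E * \int[nu]_x (g x * (F x - g0 x))%:E <=
    J g0 + ((2 * t)%:E * \int[nu]_x (g0 x * (F x - g0 x))%:E + (t ^+ 2 * C)%:E).
  apply: (@le_trans _ _ (J g0 + ((2 * t)%:E * \int[nu]_x (g0 x * (F x - g0 x))%:E +
      \int[nu]_x (t ^+ 2 * (A' ^+ 2 * \1_E x))%:E))); last first.
    rewrite leeD2l// leeD2l//.
    rewrite (_ : t ^+ 2 * C = t ^+ 2 * A' ^+ 2 * fine (nu E))%R; last by rewrite /C mulrA.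
    apply: int_le => //; first by rewrite mulr_ge0 ?sqr_ge0.
    by move=> x; rewrite mulrA.
  have m4 : measurable_fun setT (fun x => 2 * t * (g x * (F x - g0 x)))%R by exact: measurable_funM.
  have m5 : measurable_fun setT (fun x => 2 * t * (g0 x * (F x - g0 x)))%R by exact: measurable_funM.
  have p4 x : (0 <= 2 * t * (g x * (F x - g0 x)))%R by rewrite mulr_ge0.
  have p5 x : (0 <= 2 * t * (g0 x * (F x - g0 x)))%R by rewrite mulr_ge0.
  have p6 x : (0 <= (F x - g0 x) ^+ 2)%R by rewrite sqr_ge0.
  have p7 x : (0 <= (F x - gt x) ^+ 2)%R by rewrite sqr_ge0.
  have m6 := mJ' mg0; have m7 := mJ' mgt.
  rewrite -!integralZ_EFin// -integralD_EFin// -[X in _ <= _ + X]integralD_EFin//.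
  rewrite -integralD_EFin//.
  - apply: le_integral_EFin => //; first exact: measurable_funD.
      by apply: measurable_funD => //; exact: measurable_funD.
    by move=> x; rewrite addr_ge0.
  - exact: measurable_funD.
  - by move=> x; rewrite addr_ge0.
have Jfin : J g0 \is a fin_num.
  rewrite ge0_fin_numE; last by apply: integral_ge0 => x _; rewrite lee_fin sqr_ge0.
  by apply: le_lt_trans (J_le Sg0) _; exact: ltry.
have : J g0 + (2 * t)%:E * \int[nu]_x (g x * (F x - g0 x))%:E <=
    J g0 + ((2 * t)%:E * \int[nu]_x (g0 x * (F x - g0 x))%:E + (t ^+ 2 * C)%:E).
  by apply: le_trans I1; rewrite leeD2r// g0min.
rewrite leeD2lE//.
have t2 : (0 < 2 * t)%R by rewrite mulr_gt0.
have -> : (t ^+ 2 * C)%:E = (2 * t)%:E * (t * C / 2)%:E.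
  by rewrite -EFinM; congr EFin; field.
rewrite -ge0_muleDr//; last 2 first.
- by apply: integral_ge0 => x _; rewrite lee_fin.
- by rewrite lee_fin divr_ge0// mulr_ge0// ltW.
rewrite lee_pmul2l// ?lte_fin// => /le_trans; apply.
rewrite leeD2l// lee_fin; apply: le_trans tC; rewrite ler_pdivrMr// ler_peMr//.
  by rewrite mulr_ge0// ltW.
by rewrite ler1n.
Qed.

(** Let h = F - g0 and G = int g0 h.  By the variational inequality h is at most G
    on the ball of radius B, so that B h / G lies in the dual ball and the
    hypothesis gives int F h <= G.  But int F h = int h^2 + G, hence h = 0.  In
    the proof G / B is replaced by c = G / B + eta, because G may vanish. *)
Lemma lorentz_luxemburg_bounded :
  (forall h : T -> R, measurable_fun setT h -> (forall x, 0 <= h x)%R ->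
    (forall g : T -> \bar R, measurable_fun setT g -> (forall x, 0 <= g x) ->
       N g <= 1 -> \int[nu]_x ((h x)%:E * g x) <= 1) ->
    \int[nu]_x (F x * h x)%:E <= B%:E) ->
  N (EFin \o F) <= B%:E.
Proof.
move=> dual; have [g0 Sg0 g0min] := minimizer.
have [mg0 g0p g0F Ng0] := Sg0.
pose h x := (F x - g0 x)%R.
have mh : measurable_fun setT h by exact: measurable_funB.
have h0 x : (0 <= h x)%R by rewrite subr_ge0.
pose G := \int[nu]_x (g0 x * h x)%:E.
have m2 : measurable_fun setT (fun x => g0 x * h x)%R by exact: measurable_funM.
have p2 x : (0 <= g0 x * h x)%R by rewrite mulr_ge0.
have G0 : 0 <= G by apply: integral_ge0 => x _; rewrite lee_fin.
have Gfin : G \is a fin_num.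
  rewrite ge0_fin_numE//; apply: (@le_lt_trans _ _ (k ^+ 2 * fine (nu E))%:E); last exact: ltry.
  apply: int_le => //; first by rewrite exprn_ge0// ltW.
  move=> x; have := F_le x; have := g0F x; have := g0p x; rewrite /h indicE.
  by case: (x \in E) => /=; rewrite ?mulr1 ?mulr0; nra.
have Jfin : J g0 \is a fin_num.
  rewrite ge0_fin_numE; last by apply: integral_ge0 => x _; rewrite lee_fin sqr_ge0.
  by apply: le_lt_trans (J_le Sg0) _; exact: ltry.
have hE x : h x = (h x * \1_E x)%R.
  rewrite indicE; case: (boolP (x \in E)) => xE; rewrite ?mulr1// mulr0.
  have := F_le x; rewrite indicE (negbTE xE) mulr0 => Fx.
  apply/le_anti; rewrite h0 andbT lerBlDr add0r; exact: le_trans (g0p x).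
have hG (g : T -> \bar R) : measurable_fun setT g -> (forall x, 0 <= g x) ->
    N g <= 1 -> \int[nu]_x ((h x)%:E * g x) <= B^-1%:E * G.
  move=> mg gp Ng.
  pose tr := trunc (fun=> E) g.
  have mtr m : measurable_fun setT (tr m) by exact: measurable_trunc.
  have tr0 m x : (0 <= tr m x)%R by exact: trunc_ge0.
  have ndE (m : nat) : E `<=` E by [].
  have ndtr x : nondecreasing_seq (tr ^~ x) by exact: (trunc_nd ndE).
  have mht m : measurable_fun setT (fun x => h x * tr m x)%R by exact: measurable_funM.
  have ht0 m x : (0 <= h x * tr m x)%R by rewrite mulr_ge0.
  have -> : \int[nu]_x ((h x)%:E * g x) = \int[nu]_x limn (fun m => (h x * tr m x)%:E).
    apply: eq_integral => x _; apply/esym/cvg_lim => //.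
    have [xE|xE] := pselect (E x).
      under eq_fun do rewrite EFinM.
      apply: cvgeZl; first by [].
      by apply: (trunc_cvg ndE gp); exists 0%N.
    rewrite hE indicE memNset// mulr0 mul0e.
    by under eq_fun do rewrite mul0r; exact: cvg_cst.
  rewrite monotone_convergence//; last 3 first.
  - by move=> m; exact/measurable_EFinP.
  - by move=> m x _; rewrite lee_fin.
  - by move=> x _ i j ij; rewrite lee_fin ler_wpM2l// ndtr.
  apply: lime_le.
    apply: ereal_nondecreasing_is_cvgn => i j ij; apply: le_integral_EFin => // x.
    by rewrite ler_wpM2l// ndtr.
  apply: nearW => m.
  have mBt : measurable_fun setT (fun x => B * tr m x)%R by exact: measurable_funM.
  have Bt0 x : (0 <= B * tr m x)%R by rewrite mulr_ge0// ltW.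
  have Btm x : (B * tr m x <= B * m%:R * \1_E x)%R.
    by rewrite -mulrA ler_wpM2l ?(ltW B0)// trunc_le_indic.
  have NBt : N (EFin \o (fun x => B * tr m x)%R) <= B%:E.
    rewrite (_ : _ \o _ = (fun x => B%:E * (EFin \o tr m) x)); last first.
      by apply/funext => x /=; rewrite EFinM.
    have mEt : measurable_fun setT (EFin \o tr m) by exact/measurable_EFinP.
    have Et0 x : 0 <= (EFin \o tr m) x by rewrite lee_fin.
    rewrite (N_homogeneous mEt Et0 (ltW B0)).
    rewrite -[leRHS]mule1 lee_wpmul2l// ?lee_fin ?(ltW B0)//.
    apply: le_trans Ng; apply: N_le => //.
    by apply: aeW => x; exact: trunc_le.
  have := variational Sg0 g0min mBt Bt0 Btm NBt.
  rewrite -/G lee_pdivlMl// => H; apply: le_trans H.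
  rewrite -integralZ_EFin ?(ltW B0)//; apply: le_integral_EFin => //.
  - exact: measurable_funM.
  - exact: measurable_funM.
  - by move=> x; rewrite mulr_ge0// ltW.
  - by move=> x; rewrite -/(h x) [(h x * _)%R]mulrC mulrA.
have FhE : \int[nu]_x (F x * h x)%:E = J g0 + G.
  rewrite -integralD_EFin//; last 2 first.
  - exact: mJ'.
  - by move=> x; rewrite sqr_ge0.
  by apply: eq_integral => x _; congr EFin; rewrite /h; ring.
have Jle (eta : R) : (0 < eta)%R -> J g0 <= (B * eta)%:E.
  move=> eta0.
  pose c := (B^-1 * fine G + eta)%R.
  have c0 : (0 < c)%R by rewrite ltr_wpDl// mulr_ge0 ?invr_ge0 ?(ltW B0)// fine_ge0.
  have ci0 : (0 <= c^-1)%R by rewrite invr_ge0 ltW.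
  have := @dual (fun x => c^-1 * h x)%R.
  have mch : measurable_fun setT (fun x => c^-1 * h x)%R by exact: measurable_funM.
  have ch0 x : (0 <= c^-1 * h x)%R by rewrite mulr_ge0.
  move=> /(_ mch ch0) dualc.
  have : \int[nu]_x (F x * (c^-1 * h x))%:E <= B%:E.
    apply: dualc => g mg gp Ng.
    under eq_integral do rewrite EFinM -muleA.
    rewrite ge0_integralZT//; last 2 first.
    - by apply: emeasurable_funM => //; exact/measurable_EFinP.
    - by move=> x; rewrite mule_ge0// lee_fin.
    rewrite lee_pdivrMl// mule1; apply: le_trans (hG g mg gp Ng) _.
    by rewrite -(fineK Gfin) -EFinM lee_fin /c lerDl ltW.
  under eq_integral do rewrite mulrCA.
  have mFh : measurable_fun setT (fun x => F x * h x)%R by exact: measurable_funM.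
  rewrite integralZ_EFin// => [|x]; last by rewrite mulr_ge0.
  rewrite FhE lee_pdivrMl// -(fineK Gfin) -(fineK Jfin) -EFinD -EFinM !lee_fin.
  rewrite /c mulrDl mulrAC mulVf ?gt_eqF// mul1r addrC lerD2l mulrC.
  done.
have J00 : J g0 = 0.
  apply/eqP; rewrite eq_le; apply/andP; split; last first.
    by apply: integral_ge0 => x _; rewrite lee_fin sqr_ge0.
  apply/lee_addgt0Pr => eps eps0; rewrite add0e.
  apply: le_trans (Jle (eps / B)%R _) _; first by rewrite divr_gt0.
  by rewrite mulrC divfK ?gt_eqF.
apply: le_trans Ng0; apply: N_le => //; [exact/measurable_EFinP..|].
have J0' : \int[nu]_x `|((F x - g0 x) ^+ 2)%:E| = 0.
  by rewrite -J00; apply: eq_integral => x _; rewrite gee0_abs// lee_fin sqr_ge0.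
have /(ae_eq_integral_abs nu measurableT (mJ mg0)) := J0'.
apply: filterS => x /(_ Logic.I) /= [] /eqP; rewrite sqrf_eq0 subr_eq0 => /eqP ->.
by [].
Qed.
End bounded.

(** The general case follows by truncation, from the Fatou property of N. *)
Theorem lorentz_luxemburg (E : nat -> set T) (F : T -> \bar R) (B : R) :
  (forall m, measurable (E m)) -> (forall m, E m `<=` E m.+1) ->
  (forall x, exists m, E m x) -> (forall m, nu (E m) < +oo) -> (0 < B)%R ->
  measurable_fun setT F -> (forall x, 0 <= F x) ->
  (forall h : T -> R, measurable_fun setT h -> (forall x, 0 <= h x)%R ->
    (forall g : T -> \bar R, measurable_fun setT g -> (forall x, 0 <= g x) ->
       N g <= 1 -> \int[nu]_x ((h x)%:E * g x) <= 1) ->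
    \int[nu]_x (F x * (h x)%:E) <= B%:E) ->
  N F <= B%:E.
Proof.
move=> mE ndE covE nuE B0 mF F0 dual.
have mtr m := measurable_trunc mE mF m.
have tr0 m x : (0 <= trunc E F m x)%R by exact: trunc_ge0.
apply: (N_fatou (f_ := fun m => EFin \o trunc E F m)) => //.
- by move=> m; exact/measurable_EFinP.
- by move=> x i j ij; rewrite lee_fin; exact: (trunc_nd ndE).
- by move=> x; exact: trunc_cvg.
move=> m; apply: (@lorentz_luxemburg_bounded (E m) _ m.+1%:R) => //.
  move=> x; apply: le_trans (trunc_le_indic _ F0 m x) _.
  by rewrite ler_wpM2r// ler_nat.
move=> h mh h0 hN; apply: le_trans (dual h mh h0 hN).
apply: ge0_le_integralT.
- by apply/measurable_EFinP; exact: measurable_funM.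
- by apply: emeasurable_funM => //; exact/measurable_EFinP.
- by move=> x; rewrite lee_fin mulr_ge0.
- by move=> x; rewrite EFinM lee_wpmul2r ?lee_fin// trunc_le.
Qed.
End lorentz_luxemburg.

(** * Muckenhoupt weights *)

(** Let S be the sum on the right.  Every term gives a_k <= 2^k S^(1/p), and
    the bounds 4^-k a_k <= 2^-k S^(1/p) can be summed. *)
Lemma poweR_series_le (R : realType) (p : R) (a : nat -> \bar R) :
  (1 <= p)%R -> (forall k, 0 <= a k) ->
  (\sum_(k <oo) (4 ^- k)%:E * a k) `^ p <=
  ((2 : R) `^ p)%:E * \sum_(k <oo) (2 ^- k)%:E * a k `^ p.
Proof.
move=> p1 a0; have p0 : (0 < p)%R by exact: lt_le_trans p1.
set S := (X in _ <= _ * X).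
have S0 : 0 <= S.
  by apply: nneseries_ge0 => k _ _; rewrite mule_ge0 ?poweR_ge0// lee_fin invr_ge0 exprn_ge0.
have lesum k : (2 ^- k)%:E * a k `^ p <= S.
  apply: (nneseries_ge_term k) => i.
  by rewrite mule_ge0 ?poweR_ge0// lee_fin invr_ge0 exprn_ge0.
clearbody S; case: S S0 lesum => [S| |//] S0 lesum; last first.
  by rewrite gt0_muley ?leey// lte_fin powR_gt0.
have S0' : (0 <= S)%R := S0.
pose z := (S `^ p^-1)%R.
have z0 : (0 <= z)%R by exact: powR_ge0.
have zp : (z `^ p = S)%R by rewrite -powRrM mulVf ?gt_eqF// powRr1.
have ak k : (4 ^- k)%:E * a k <= (z * 2 ^- (0 + k))%:E.
  have p2 : (0 < 2 ^+ k :> R)%R by rewrite exprn_gt0.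
  have h : a k <= (2 ^+ k * z)%:E.
    have := lesum k; rewrite lee_pdivrMl//.
    case: (a k) (a0 k) => [y| |//] y0; last first.
      by rewrite poweRyr ?gt_eqF// leye_eq -EFinM.
    rewrite poweR_EFin -EFinM !lee_fin => h.
    have : (y `^ p <= (2 ^+ k * z) `^ p)%R.
      apply: le_trans h _; rewrite powRM ?(ltW p2)// zp ler_wpM2r//.
      by rewrite -[leLHS]powRr1 ?(ltW p2)// ler_powR// exprn_ege1// ler1n.
    apply: contraTT; rewrite -!ltNge => h'.
    by rewrite gt0_ltr_powR ?nnegrE// mulr_ge0// ltW.
  rewrite add0n lee_pdivrMl ?exprn_gt0//; apply: le_trans h _.
  rewrite -EFinM lee_fin (_ : 4 = 2 * 2)%R; last by rewrite -natrM.
  by rewrite exprMn mulrCA -!mulrA mulfV ?gt_eqF// mulr1 mulrC.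
have sumle : \sum_(k <oo) (4 ^- k)%:E * a k <= (2 * z)%:E.
  apply: (@le_trans _ _ (\sum_(k <oo) (z * 2 ^- (0 + k))%:E)).
    apply: lee_nneseries => [k _ _|k _]; last exact: ak.
    by rewrite mule_ge0// lee_fin invr_ge0 exprn_ge0.
  by apply: le_trans (nneseries_geometric_half 0 z0) _; rewrite expr0 invr1 mulr1.
apply: (@le_trans _ _ ((2 * z)%:E `^ p)).
  apply: gt0_ler_poweR => //; first exact: ltW.
  - rewrite in_itv/= leey andbT; apply: nneseries_ge0 => k _ _.
    by rewrite mule_ge0// lee_fin invr_ge0 exprn_ge0.
  - by rewrite in_itv/= leey andbT lee_fin mulr_ge0.
by rewrite poweR_EFin powRM// zp EFinM.
Qed.

Section weights.
Context {d} {T : measurableType d} {R : realType}.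
Variables (mu : {measure set T -> \bar R}) (B : set (set T)).
Implicit Types (w : T -> R) (Q : set T).

(** The condition A_(1+s) with constant K, for a weight with real values: a and b
    bound the means of w and of its dual weight w^(-1/s). *)
Definition Muckenhoupt (s K : R) w := [/\ measurable_fun setT w,
  forall x, (0 < w x)%R & forall Q, B Q -> exists a b : R,
  [/\ (0 < a)%R, (0 < b)%R, \int[mu]_(x in Q) (w x)%:E <= a%:E * mu Q,
      \int[mu]_(x in Q) (w x `^ (- s^-1))%:E <= b%:E * mu Q &
      (a * b `^ s <= K)%R]].

Lemma null_density w A : measurable_fun setT w -> (forall x, (0 < w x)%R) ->
  measurable A -> \int[mu]_(x in A) (w x)%:E = 0 -> mu A = 0.
Proof.
move=> mw w0 mA.
have -> : \int[mu]_(x in A) (w x)%:E = \int[mu]_(x in A) `|(w x)%:E|.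
  by apply: eq_integral => x _; rewrite gee0_abs// lee_fin ltW.
move/(ae_eq_integral_abs mu mA) => /(_ _)[].
  by apply: measurable_funTS; exact/measurable_EFinP.
move=> N [mN N0 AN]; apply: (subset_measure0 mA mN _ N0) => x Ax; apply: AN => /=.
by move=> /(_ Ax) [] /eqP; rewrite gt_eqF.
Qed.

Hypothesis mB : forall Q, B Q -> measurable Q.
Hypothesis muB : forall Q, B Q -> 0 < mu Q < +oo.
Variables (dil : set T -> set T -> Prop) (c : R).
Hypothesis c0 : (0 < c)%R.
Hypothesis dilB : forall Q, B Q -> exists Q', dil Q Q'.
Hypothesis dilP : forall Q Q', B Q -> dil Q Q' ->
  [/\ B Q', Q `<=` Q' & mu Q' <= c%:E * mu Q].

(** Let b be the bound of the dual weight on the dilated set Q'.  The part of Q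
    where w^(-1/s) > y has measure at most b c mu Q / y, which is mu Q / 2 for
    y = 2 b c; on the rest w >= y^(-s).  So nu Q is at least a multiple of mu Q,
    while nu Q' is at most a multiple of mu Q' and of mu Q. *)
Lemma Muckenhoupt_doubling s K w (nu : {measure set T -> \bar R}) :
  (0 < s)%R -> Muckenhoupt s K w ->
  (forall A, nu A = \int[mu]_(x in A) (w x)%:E) ->
  (forall Q, B Q -> 0 < nu Q < +oo) /\
  (forall Q Q', B Q -> dil Q Q' ->
     nu Q' <= (2 * c * (2 * c) `^ s * K)%:E * nu Q).
Proof.
move=> s0 [mw w0 wA] nuE.
have fin Q : B Q -> nu Q < +oo.
  move=> BQ; have [a [b [a0 b0 + _ _]]] := wA Q BQ.
  rewrite nuE => /le_lt_trans; apply; have [r r0 ->] := nu_fineE muB BQ.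
  by rewrite -EFinM ltry.
have main Q Q' : B Q -> dil Q Q' -> exists a b : R,
   [/\ (0 < a)%R, (0 < b)%R, (a * b `^ s <= K)%R, nu Q' <= (a * c)%:E * mu Q &
     mu Q <= (2 * (2 * c * b) `^ s)%:E * nu Q].
  move=> BQ dQ; have [BQ' QQ' muQ'] := dilP BQ dQ.
  have [a [b [a0 b0 wa wb ab]]] := wA Q' BQ'.
  have mQ := mB BQ; have mQ' := mB BQ'.
  have [q q0 qE] := nu_fineE muB BQ.
  exists a, b; split => //.
    rewrite nuE; apply: le_trans wa _; rewrite EFinM -muleA.
    by rewrite lee_wpmul2l// lee_fin ltW.
  pose y := (2 * c * b)%R.
  have y0 : (0 < y)%R by rewrite !mulr_gt0.
  have ys0 : (0 < y `^ s)%R by rewrite powR_gt0.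
  have key : mu Q <= (y `^ s)%:E * nu Q + y^-1%:E * (b%:E * (c%:E * mu Q)).
    apply: (@le_trans _ _ (\int[mu]_(x in Q)
       ((y `^ s)%:E * (w x)%:E + y^-1%:E * (w x `^ (- s^-1))%:E))).
      rewrite -[leLHS]mul1e -integral_cst//; apply: ge0_le_integral => //.
        apply: measurable_funTS; apply: emeasurable_funD; apply: measurable_funeM.
          exact/measurable_EFinP.
        by apply/measurable_EFinP; exact: (measurableT_comp (measurable_powR _)).
      move=> x _; rewrite -!EFinM -EFinD lee_fin.
      have sg0 : (0 < w x `^ (- s^-1))%R by rewrite powR_gt0.
      have [h|h] := leP y (w x `^ (- s^-1))%R.
        apply: ler_wpDl; first by rewrite mulr_ge0 ?powR_ge0// ltW.
        by rewrite mulrC ler_pdivlMr// mul1r.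
      apply: ler_wpDr; first by rewrite mulr_ge0 ?powR_ge0// invr_ge0 ltW.
      have -> : (w x = (w x `^ (- s^-1)) `^ (- s))%R.
        by rewrite -powRrM mulrNN mulVf ?gt_eqF// powRr1// ltW.
      rewrite powRN ler_pdivlMr ?powR_gt0// mul1r.
      by rewrite ge0_ler_powR// ?nnegrE ltW.
    rewrite ge0_integralD//; last 4 first.
    - by move=> x _; rewrite -EFinM lee_fin mulr_ge0// ltW// w0.
    - apply: measurable_funTS; apply: measurable_funeM; exact/measurable_EFinP.
    - by move=> x _; rewrite -EFinM lee_fin mulr_ge0 ?powR_ge0// invr_ge0 ltW.
    - apply: measurable_funTS; apply: measurable_funeM; apply/measurable_EFinP.
      exact: (measurableT_comp (measurable_powR _)).
    have mwQ : measurable_fun Q (fun x => (w x)%:E).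
      by apply: measurable_funTS; exact/measurable_EFinP.
    have msT : measurable_fun setT (fun x => (w x `^ (- s^-1))%:E).
      by apply/measurable_EFinP; exact: (measurableT_comp (measurable_powR _)).
    rewrite ge0_integralZl//; last 2 first.
    - by move=> x _; rewrite lee_fin ltW.
    - by rewrite lee_fin ltW.
    rewrite nuE leeD2l// ge0_integralZl//; last 3 first.
    - exact: measurable_funTS.
    - by move=> x _; rewrite lee_fin powR_ge0.
    - by rewrite lee_fin invr_ge0 ltW.
    rewrite lee_wpmul2l ?lee_fin ?invr_ge0 ?(ltW y0)//.
    apply: (@le_trans _ _ (b%:E * mu Q')); last by rewrite lee_wpmul2l ?lee_fin// ltW.
    apply: le_trans wb; apply: ge0_subset_integral => //; first exact: measurable_funTS.
    by move=> x _; rewrite lee_fin powR_ge0.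
  have : nu Q \is a fin_num by rewrite ge0_fin_numE ?measure_ge0// fin.
  move: key; rewrite qE; case: (nu Q) => [N| |] // + _.
  rewrite -/y -!EFinM.
  rewrite -EFinD !lee_fin.
  have -> : (y^-1 * (b * (c * q)) = q / 2)%R.
    by rewrite /y; field; rewrite !gt_eqF.
  by lra.
split.
  move=> Q BQ; rewrite fin// andbT; have [Q' dQ] := dilB BQ.
  have [a [b [_ b0 _ _ h]]] := main Q Q' BQ dQ.
  have := measure_ge0 nu Q; rewrite le_eqVlt => /predU1P[E|//].
  by move: h; rewrite -E mule0 leNgt; have /andP[-> _] := muB BQ.
move=> Q Q' BQ dQ; have [a [b [a0 b0 ab h1 h2]]] := main Q Q' BQ dQ.
apply: le_trans h1 _.
apply: (@le_trans _ _ ((a * c)%:E * ((2 * (2 * c * b) `^ s)%:E * nu Q))).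
  by rewrite lee_wpmul2l// lee_fin mulr_ge0// ltW.
rewrite muleA -EFinM lee_wpmul2r ?measure_ge0// lee_fin.
have -> : ((2 * c * b) `^ s = (2 * c) `^ s * b `^ s)%R.
  by rewrite powRM ?mulr_ge0// ltW.
have -> : (a * c * (2 * ((2 * c) `^ s * b `^ s)) = 2 * c * (2 * c) `^ s * (a * b `^ s))%R.
  by ring.
by rewrite ler_wpM2l// mulr_ge0 ?powR_ge0// mulr_ge0// ltW.
Qed.
End weights.

(** * Extrapolation of A_infty weights *)

Section extrapolation.
Context {d} {T : measurableType d} {R : realType}.
Variables (mu : {measure set T -> \bar R}) (B : set (set T)).
Implicit Types (w c : T -> R) (f g phi : T -> \bar R) (Q : set T).
Hypothesis mB : forall Q, B Q -> measurable Q.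
Hypothesis muB : forall Q, B Q -> 0 < mu Q < +oo.
Hypothesis measurable_sup_over : forall phi : set T -> \bar R,
  measurable_fun setT (sup_over B phi).
Variable E : nat -> set T.
Hypothesis BE : forall m, B (E m).
Hypothesis ndE : forall m, E m `<=` E m.+1.
Hypothesis covE : forall x, exists m, E m x.
Variables (dil : set T -> set T -> Prop) (cdil : R).
Hypothesis cdil0 : (0 < cdil)%R.
Hypothesis dilB : forall Q, B Q -> exists Q', dil Q Q'.
Hypothesis dilP : forall Q Q', B Q -> dil Q Q' ->
  [/\ B Q', Q `<=` Q' & mu Q' <= cdil%:E * mu Q].
Hypothesis maximal_theorem : forall D p : R, (1 < p)%R ->
  exists2 C : R, (0 < C)%R & forall nu : {measure set T -> \bar R},
  (forall Q, B Q -> 0 < nu Q < +oo) ->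
  (forall Q Q', B Q -> dil Q Q' -> nu Q' <= D%:E * nu Q) ->
  forall f, measurable_fun setT f -> (forall x, 0 <= f x) ->
  \int[nu]_x (mean_max B nu f x `^ p) <= C%:E * \int[nu]_x (f x `^ p).

Local Notation Muckenhoupt := (Muckenhoupt mu B).

Let covB x : exists2 Q, B Q & Q x.
Proof. by have [m Em] := covE x; exists (E m). Qed.

(** The condition A_1 for c with respect to the measure w d mu. *)
Definition A1_wrt w (K' : R) c := [/\ measurable_fun setT c,
  forall x, (0 < c x)%R & forall Q, B Q -> exists2 m : R, (0 < m)%R &
    \int[mu]_(x in Q) (c x * w x)%:E <= m%:E * \int[mu]_(x in Q) (w x)%:E /\
    {ae mu, forall x, Q x -> (m <= K' * c x)%R}].

(** The iteration of Rubio de Francia for the maximal operator of the measure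
    w d mu, bounded on L^p (w) because this measure is doubling. *)
Lemma A1_majorant (p s K : R) : (1 < p)%R -> (0 < s)%R ->
  exists C K' : R, [/\ (0 < C)%R, (0 < K')%R & forall w phi,
  Muckenhoupt s K w -> measurable_fun setT phi -> (forall x, 0 <= phi x) ->
  0 < \int[mu]_x (phi x `^ p * (w x)%:E) < +oo ->
  exists2 c, A1_wrt w K' c & {ae mu, forall x, phi x <= (c x)%:E} /\
    \int[mu]_x ((c x `^ p)%:E * (w x)%:E) <=
    C%:E * \int[mu]_x (phi x `^ p * (w x)%:E)].
Proof.
move=> p1 s0; have p0 : (0 < p)%R by exact: lt_trans p1.
pose D := (2 * cdil * (2 * cdil) `^ s * K)%R.
have [C0 C00 strong] := maximal_theorem D p1.
pose K1 := (C0 + 1)%R.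
have K10 : (0 < K1)%R by rewrite addr_gt0.
have K1p : (C0 <= K1 `^ p)%R.
  apply: (@le_trans _ _ K1); first by rewrite lerDl.
  by rewrite -[leLHS]powRr1 ?(ltW K10)// ler_powR ?(ltW p1)// lerDr ltW.
exists (2 `^ p * 2)%R, (4 * K1)%R; split; [by rewrite mulr_gt0// powR_gt0|by rewrite mulr_gt0|].
move=> w phi wA mphi phi0 phip.
have [mw w0 _] := wA.
have [nu [nuE nuI]] := exists_density_measure mu mw (fun x => ltW (w0 x)).
have [nuB nudil] := Muckenhoupt_doubling mB muB cdil0 dilB dilP s0 wA nuE.
have nuIT f : measurable_fun setT f -> (forall x, 0 <= f x) ->
  \int[nu]_x f x = \int[mu]_x (f x * (w x)%:E) by move=> *; exact: nuI.
have mpow f : measurable_fun setT f -> measurable_fun setT (fun x => f x `^ p).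
  by move=> mf; exact: (measurableT_comp (measurable_poweR _)).
have pow0 f x : 0 <= f x `^ p by exact: poweR_ge0.
pose I := \int[nu]_x (phi x `^ p).
have IE : I = \int[mu]_x (phi x `^ p * (w x)%:E) by apply: nuIT => //; exact: mpow.
rewrite -IE in phip *.
have [H [mH phiH MH HI]] : exists H, [/\ measurable_fun setT H,
    forall x, phi x <= H x, forall x, mean_max B nu H x <= (4 * K1)%:E * H x &
    \int[nu]_x (H x `^ p) <= (2 `^ p * 2)%:E * I].
  apply: (@rubio_de_francia _ _ _ (mean_max B nu)
    (fun f => \int[nu]_x (f x `^ p) <= I)
    (fun f => \int[nu]_x (f x `^ p) <= (2 `^ p * 2)%:E * I)) => //.
  - by move=> f _ _; exact: measurable_sup_over.
  - by move=> f _ f0 x; apply: mean_max_ge0.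
  - exact: mean_max_series.
  - by move=> f a; exact: mean_maxZ.
  - move=> f mf f0 fI.
    have M0 x : 0 <= mean_max B nu f x by apply: mean_max_ge0.
    under eq_integral do rewrite poweRM ?lee_fin ?invr_ge0 ?(ltW K10)//.
    have mM : measurable_fun setT (fun x => mean_max B nu f x `^ p).
      by apply: mpow; exact: measurable_sup_over.
    under eq_integral do rewrite poweR_EFin.
    rewrite ge0_integralZT ?powR_ge0//.
    apply: (@le_trans _ _ ((K1^-1 `^ p)%:E * (C0%:E * \int[nu]_x (f x `^ p)))).
      by rewrite lee_wpmul2l ?lee_fin ?powR_ge0// strong.
    rewrite muleA -EFinM; apply: le_trans fI.
    rewrite -[leRHS]mul1e lee_wpmul2r ?integral_ge0// lee_fin.
    rewrite -powR_inv1 ?(ltW K10)// powRAC powR_inv1 ?powR_ge0//.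
    by rewrite mulrC ler_pdivrMr ?powR_gt0// mul1r.
  - move=> f_ mf f0 fI.
    apply: (@le_trans _ _ (\int[nu]_x ((2 `^ p)%:E * \sum_(k <oo) (2 ^- k)%:E * f_ k x `^ p))).
      apply: ge0_le_integralT.
      + apply: mpow; apply: ge0_emeasurable_sum => [k x _ _|k _].
          by rewrite mule_ge0// lee_fin invr_ge0 exprn_ge0.
        exact: measurable_funeM.
      + apply: measurable_funeM; apply: ge0_emeasurable_sum => [k x _ _|k _].
          by rewrite mule_ge0// lee_fin invr_ge0 exprn_ge0.
        by apply: measurable_funeM; exact: mpow.
      + by move=> x; exact: poweR_ge0.
      + by move=> x; apply: poweR_series_le => //; exact: ltW.
    have mt k : measurable_fun setT (fun x => (2 ^- k)%:E * f_ k x `^ p).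
      by apply: measurable_funeM; exact: mpow.
    have t0 k x : 0 <= (2 ^- k)%:E * f_ k x `^ p.
      by rewrite mule_ge0// lee_fin invr_ge0 exprn_ge0.
    rewrite ge0_integralZT ?powR_ge0//; last 2 first.
    + exact: ge0_emeasurable_sum.
    + by move=> x; exact: nneseries_ge0.
    rewrite EFinM -muleA lee_wpmul2l ?lee_fin ?powR_ge0// integral_nneseries//.
    have Ifin : I \is a fin_num.
      by rewrite ge0_fin_numE; [case/andP: phip|rewrite ltW//; case/andP: phip].
    have I0 : (0 <= fine I)%R by rewrite fine_ge0// ltW//; case/andP: phip.
    apply: (@le_trans _ _ (\sum_(k <oo) (fine I * 2 ^- (0 + k))%:E)).
      apply: lee_nneseries => [k _ _|k _]; first exact: integral_ge0.
      rewrite ge0_integralZT//; last exact: mpow.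
      by rewrite mulrC EFinM fineK// lee_wpmul2l// lee_fin invr_ge0 exprn_ge0.
    apply: le_trans (nneseries_geometric_half 0 I0) _.
    by rewrite expr0 invr1 mulr1 EFinM fineK.
have H0 x : 0 <= H x by exact: le_trans (phiH x).
have /andP[I_gt0 I_fin] := phip.
have HIfin : \int[nu]_x (H x `^ p) < +oo.
  apply: le_lt_trans HI _; rewrite lte_mul_pinfty ?lee_fin ?mulr_ge0 ?powR_ge0//.
have Hpos : forall x, 0 < H x.
  apply: (A1_gt0 mB nuB BE ndE covE mH H0 _ MH) => Hz; move: I_gt0; rewrite /I.
  rewrite (ge0_ae_eq_integral measurableT (g := cst 0)) ?integral0 ?ltxx//; first exact: mpow.
  apply: filterS Hz => y Hy _ /=.
  have -> : phi y = 0 by apply/le_anti; rewrite phi0 andbT -[leRHS]Hy phiH.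
  by rewrite poweR0r// gt_eqF.
have ae_mu (P : set T) : {ae nu, forall x, P x} -> {ae mu, forall x, P x}.
  move=> [X [mX X0 PX]]; exists X; split => //.
  by apply: (null_density mw w0 mX); rewrite -nuE.
have Hfin : {ae nu, forall x, H x < +oo}.
  exists [set x | H x = +oo]; split; first exact: measurable_eq_pinfty.
    rewrite -(integral_fin_ae (mpow _ mH) _ HIfin)//; congr (nu _).
    apply/seteqP; split => x /=; first by move=> ->; rewrite poweRyr// gt_eqF.
    by move/poweR_eqy.
  by move=> x /= /negP; rewrite -leNgt leye_eq => /eqP.
have cH := real_weight_ae Hpos Hfin.
have mc := measurable_real_weight mH.
exists (real_weight H); last first.
  split; first by apply: filterS (ae_mu _ cH) => x ->.
  have -> : \int[mu]_x ((real_weight H x `^ p)%:E * (w x)%:E) =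
      \int[nu]_x (real_weight H x `^ p)%:E.
    rewrite nuIT// => [|x]; last by rewrite lee_fin powR_ge0.
    by apply/measurable_EFinP; exact: (measurableT_comp (measurable_powR _)).
  apply: le_trans HI; rewrite le_eqVlt; apply/orP; left; apply/eqP.
  apply: ge0_ae_eq_integral => //.
  - by apply/measurable_EFinP; exact: (measurableT_comp (measurable_powR _)).
  - exact: mpow.
  - by move=> x _; rewrite lee_fin powR_ge0.
  - by apply: filterS cH => x <- _; rewrite poweR_EFin.
split => [//||Q BQ]; first exact: real_weight_gt0.
have [m m0 [Im aem]] := A1_real_weight mB nuB mH Hpos Hfin (aeW _ MH) BQ.
exists m => //; split; last exact: ae_mu.
rewrite -nuE ?mB//; apply: le_trans Im; rewrite le_eqVlt; apply/orP; left; apply/eqP.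
under eq_integral do rewrite EFinM.
rewrite -(nuI Q (EFin \o real_weight H))//; last first.
- by move=> x; rewrite lee_fin ltW// real_weight_gt0.
- by apply/measurable_EFinP; exact: measurable_funTS.
- exact: mB.
Qed.

(** On Q the function c is almost everywhere at least k, a bound of its w-mean over Q
    divided by K', and this bounds the dual weight of c w by k^(-1/s) times that of w. *)
Lemma Muckenhoupt_mul s K K' w c : (0 < s)%R -> (0 < K')%R ->
  Muckenhoupt s K w -> A1_wrt w K' c ->
  Muckenhoupt s (K' * K) (fun x => c x * w x)%R.
Proof.
move=> s0 K'0 [mw w0 wA] [mc c0 cA]; split.
- exact: measurable_funM.
- by move=> x; rewrite mulr_gt0.
move=> Q BQ; have [a [b [a0 b0 wa wb ab]]] := wA Q BQ.
have [m m0 [cm mc']] := cA Q BQ; have mQ := mB BQ.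
pose k := (m / K')%R; have k0 : (0 < k)%R by rewrite divr_gt0.
exists (m * a)%R, (k `^ (- s^-1) * b)%R; split.
- by rewrite mulr_gt0.
- by rewrite mulr_gt0// powR_gt0.
- apply: le_trans cm _; rewrite EFinM -muleA lee_wpmul2l// lee_fin ltW//.
- apply: (@le_trans _ _ (\int[mu]_(x in Q) ((k `^ (- s^-1))%:E * (w x `^ (- s^-1))%:E))).
    apply: ae_ge0_le_integral => //.
    + by move=> x _; rewrite lee_fin powR_ge0.
    + apply: measurable_funTS; apply/measurable_EFinP; apply: measurable_fun_powR.
      exact: measurable_funM.
    + by move=> x _; rewrite -EFinM lee_fin mulr_ge0 ?powR_ge0.
    + apply: measurable_funTS; apply: measurable_funeM; apply/measurable_EFinP.
      exact: measurable_fun_powR.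
    + apply: filterS mc' => x /[apply] h; rewrite -EFinM lee_fin.
      rewrite powRM ?(ltW (c0 x)) ?(ltW (w0 x))// ler_wpM2r ?powR_ge0//.
      rewrite !powRN lef_pV2 ?posrE ?powR_gt0//.
      rewrite ge0_ler_powR ?nnegrE ?invr_ge0 ?(ltW s0) ?(ltW k0) ?(ltW (c0 x))//.
      by rewrite /k ler_pdivrMr// mulrC.
  rewrite ge0_integralZl//; last 3 first.
  + by apply: measurable_funTS; apply/measurable_EFinP; exact: measurable_fun_powR.
  + by move=> x _; rewrite lee_fin powR_ge0.
  + by rewrite lee_fin powR_ge0.
  by rewrite EFinM -muleA lee_wpmul2l// lee_fin powR_ge0.
- rewrite powRM ?powR_ge0 ?(ltW b0)// -powRrM mulNr mulVf ?gt_eqF//.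
  rewrite powR_inv1 ?(ltW k0)//.
  have -> : (m * a * (k^-1 * b `^ s) = K' * (a * b `^ s))%R.
    by rewrite /k; field; rewrite !gt_eqF.
  by rewrite ler_wpM2l// ltW.
Qed.

(** The exponent s' is chosen so that the dual weight of c^-t w is the product
    (c w)^th (w^(-1/s))^th' with th + th' = 1.  Once both factors are divided by
    the bounds of their means, X^th Y^th' <= X + Y bounds its mean. *)
Lemma Muckenhoupt_neg_power s K K' t w c : (0 < s)%R -> (0 < K')%R -> (0 < t)%R ->
  Muckenhoupt s K w -> A1_wrt w K' c ->
  let s' := (t + (1 + t) * s)%R in
  Muckenhoupt s' (K' `^ t * 2 `^ s' * K `^ (1 + t)) (fun x => c x `^ (- t) * w x)%R.
Proof.
move=> s0 K'0 t0 [mw w0 wA] [mc c0 cA] s'.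
have t10 : (0 < 1 + t)%R by rewrite addr_gt0.
have s'0 : (0 < s')%R by rewrite addr_gt0// mulr_gt0.
split.
- by apply: measurable_funM => //; exact: measurable_fun_powR.
- by move=> x; rewrite mulr_gt0// powR_gt0.
move=> Q BQ; have [a [b [a0 b0 wa wb ab]]] := wA Q BQ.
have [m m0 [cm mc']] := cA Q BQ; have mQ := mB BQ.
pose k := (m / K')%R; have k0 : (0 < k)%R by rewrite divr_gt0.
pose th := (t / s')%R; pose th' := ((1 + t) * s / s')%R.
have thE : (th + th' = 1)%R by rewrite /th /th' -mulrDl divff// gt_eqF.
pose kappa := ((m * a) `^ th * b `^ th')%R.
have ma0 : (0 < m * a)%R by rewrite mulr_gt0.
have th0 : (0 <= th)%R by rewrite divr_ge0// ltW.
have th'0 : (0 <= th')%R by rewrite divr_ge0 ?mulr_ge0// ltW.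
have kappa0 : (0 < kappa)%R by rewrite mulr_gt0// powR_gt0.
exists (k `^ (- t) * a)%R, (kappa * 2)%R; split.
- by rewrite mulr_gt0// powR_gt0.
- by rewrite mulr_gt0.
- apply: (@le_trans _ _ (\int[mu]_(x in Q) ((k `^ (- t))%:E * (w x)%:E))).
    apply: ae_ge0_le_integral => //.
    + by move=> x _; rewrite lee_fin mulr_ge0 ?powR_ge0// ltW.
    + apply: measurable_funTS; apply/measurable_EFinP; apply: measurable_funM => //.
      exact: measurable_fun_powR.
    + by move=> x _; rewrite -EFinM lee_fin mulr_ge0 ?powR_ge0// ltW.
    + apply: measurable_funTS; apply: measurable_funeM; exact/measurable_EFinP.
    + apply: filterS mc' => x /[apply] h; rewrite -EFinM lee_fin.
      rewrite ler_wpM2r ?(ltW (w0 x))// !powRN lef_pV2 ?posrE ?powR_gt0//.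
      rewrite ge0_ler_powR ?nnegrE ?(ltW t0) ?(ltW k0) ?(ltW (c0 x))//.
      by rewrite /k ler_pdivrMr// mulrC.
  rewrite ge0_integralZl//; last 3 first.
  + by apply: measurable_funTS; apply/measurable_EFinP.
  + by move=> x _; rewrite lee_fin ltW.
  + by rewrite lee_fin powR_ge0.
  by rewrite EFinM -muleA lee_wpmul2l// lee_fin powR_ge0.
- pose X x := ((m * a)^-1 * (c x * w x))%R.
  pose Y x := (b^-1 * w x `^ (- s^-1))%R.
  have X0 x : (0 < X x)%R by rewrite mulr_gt0 ?invr_gt0// mulr_gt0.
  have Y0 x : (0 < Y x)%R by rewrite mulr_gt0 ?invr_gt0// powR_gt0.
  have mX : measurable_fun setT X by apply: measurable_funM => //; exact: measurable_funM.
  have mY : measurable_fun setT Y by apply: measurable_funM => //; exact: measurable_fun_powR.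
  have mEX : measurable_fun Q (EFin \o X).
    by apply: measurable_funTS; exact/measurable_EFinP.
  have mEY : measurable_fun Q (EFin \o Y).
    by apply: measurable_funTS; exact/measurable_EFinP.
  have sE x : ((c x `^ (- t) * w x) `^ (- s'^-1) = kappa * (X x `^ th * Y x `^ th'))%R.
    have -> : (kappa * (X x `^ th * Y x `^ th') =
        (m * a * X x) `^ th * (b * Y x) `^ th')%R.
      rewrite (powRM _ (ltW ma0) (ltW (X0 x))) (powRM _ (ltW b0) (ltW (Y0 x))).
      by rewrite /kappa; ring.
    rewrite /X /Y !mulVKf ?gt_eqF//.
    rewrite powRM ?powR_ge0 ?(ltW (w0 x))// powRM ?(ltW (w0 x)) ?(ltW (c0 x))//.
    rewrite -!powRrM mulrNN -mulrA; congr (_ * _)%R.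
    rewrite -powRD; last by rewrite implybE (gt_eqF (w0 x)) orbT.
    congr (_ `^ _)%R; rewrite /th /th'; field.
    by rewrite !gt_eqF.
  have sXY x : ((c x `^ (- t) * w x) `^ (- s'^-1) <= kappa * (X x + Y x))%R.
    rewrite sE ler_wpM2l ?(ltW kappa0)//.
    have XY0 : (0 < X x + Y x)%R by rewrite addr_gt0.
    apply: (@le_trans _ _ ((X x + Y x) `^ th * (X x + Y x) `^ th')%R).
      apply: ler_pM; rewrite ?powR_ge0//; apply: ge0_ler_powR;
        by rewrite ?nnegrE ?(ltW XY0)// ?lerDl ?lerDr ltW.
    rewrite -powRD; last by rewrite implybE (gt_eqF XY0) orbT.
    by rewrite thE powRr1// ltW.
  apply: (@le_trans _ _ (\int[mu]_(x in Q) (kappa%:E * ((X x)%:E + (Y x)%:E)))).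
    apply: ge0_le_integral => //.
    + by move=> x _; rewrite lee_fin powR_ge0.
    + apply: measurable_funTS; apply/measurable_EFinP; apply: measurable_fun_powR.
      by apply: measurable_funM => //; exact: measurable_fun_powR.
    + by apply: measurable_funeM; exact: emeasurable_funD.
    + by move=> x _; rewrite -EFinD -EFinM lee_fin.
  rewrite ge0_integralZl//; last 3 first.
  + exact: emeasurable_funD.
  + by move=> x _; rewrite -EFinD lee_fin ltW// addr_gt0.
  + by rewrite lee_fin ltW.
  rewrite [X in _ <= X * _]EFinM -[leRHS]muleA lee_wpmul2l ?lee_fin ?(ltW kappa0)//.
  rewrite ge0_integralD//; last 2 first.
  + by move=> x _; rewrite lee_fin ltW.
  + by move=> x _; rewrite lee_fin ltW.
  have -> : 2%:E * mu Q = mu Q + mu Q.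
    by rewrite -[in RHS](mul1e (mu Q)) -ge0_muleDl// -EFinD.
  apply: leeD.
    rewrite /X; under eq_integral do rewrite EFinM.
    rewrite ge0_integralZl//; last 3 first.
    + apply: measurable_funTS; apply/measurable_EFinP; exact: measurable_funM.
    + by move=> x _; rewrite lee_fin mulr_ge0// ltW.
    + by rewrite lee_fin invr_ge0 ltW.
    rewrite lee_pdivrMl//; apply: le_trans cm _.
    by rewrite EFinM -muleA lee_wpmul2l// lee_fin ltW.
  rewrite /Y; under eq_integral do rewrite EFinM.
  rewrite ge0_integralZl//; last 3 first.
  + by apply: measurable_funTS; apply/measurable_EFinP; exact: measurable_fun_powR.
  + by move=> x _; rewrite lee_fin powR_ge0.
  + by rewrite lee_fin invr_ge0 ltW.
  by rewrite lee_pdivrMl.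
- have abs : (0 <= a * b `^ s)%R by rewrite mulr_ge0 ?powR_ge0// ltW.
  have -> : (k `^ (- t) * a * (kappa * 2) `^ s' =
      K' `^ t * 2 `^ s' * (a * b `^ s) `^ (1 + t))%R.
    rewrite powRM ?(ltW kappa0)// /kappa powRM ?powR_ge0// -!powRrM.
    have -> : (th * s' = t)%R by rewrite /th divfK// gt_eqF.
    have -> : (th' * s' = s * (1 + t))%R by rewrite /th' divfK ?gt_eqF// mulrC.
    rewrite (powRM _ (ltW a0) (powR_ge0 _ _)) -powRrM.
    have -> : (a `^ (1 + t) = a * a `^ t)%R.
      rewrite powRD; last by rewrite implybE (gt_eqF a0) orbT.
      by rewrite powRr1// ltW.
    rewrite /k powRM ?invr_ge0 ?(ltW m0) ?(ltW K'0)// -(powR_inv1 (ltW K'0)) -powRrM.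
    rewrite mulrNN mul1r powRM ?(ltW m0) ?(ltW a0)//.
    have mt : (m `^ (- t) * m `^ t = 1)%R by rewrite powRN mulVf// gt_eqF// powR_gt0.
    transitivity ((m `^ (- t) * m `^ t) * (K' `^ t * 2 `^ s' * (a * a `^ t * b `^ (s * (1 + t)))))%R.
      by ring.
    by rewrite mt mul1r.
  rewrite ler_wpM2l ?mulr_ge0 ?powR_ge0// ge0_ler_powR ?nnegrE ?(ltW t10)//.
  exact: le_trans ab.
Qed.

Let integral_eq0_sub f g : measurable_fun setT f -> measurable_fun setT g ->
  (forall x, 0 <= f x) -> (forall x, 0 <= g x) -> (forall x, f x = 0 -> g x = 0) ->
  \int[mu]_x f x = 0 -> \int[mu]_x g x = 0.
Proof.
move=> mf mg f0 g0 fg If.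
have : \int[mu]_x `|f x| = 0.
  by rewrite -[RHS]If; apply: eq_integral => y _; rewrite gee0_abs.
move/(ae_eq_integral_abs mu measurableT mf) => fz.
rewrite (ge0_ae_eq_integral measurableT (g := cst 0)) ?integral0//.
by apply: filterS fz => x /(_ Logic.I) /fg.
Qed.

Variables (F : set ((T -> \bar R) * (T -> \bar R))) (p0 : R).
Hypothesis F_family : forall f g, F (f, g) ->
  [/\ measurable_fun setT f, forall x, 0 <= f x,
      measurable_fun setT g & forall x, 0 <= g x].
Hypothesis p0_gt0 : (0 < p0)%R.
Hypothesis F_p0 : forall s K : R, (0 < s)%R -> exists2 C : R, (0 < C)%R &
  forall w, Muckenhoupt s K w -> forall f g, F (f, g) ->
  \int[mu]_x (f x `^ p0 * (w x)%:E) <= C%:E * \int[mu]_x (g x `^ p0 * (w x)%:E).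

(** For p0 > 1, take for c a majorant of g^(1/2) in L^2 (w), and c^-t w as weight.
    Since g <= c^2 one has g^p0 c^-t <= g, and f <= f^p0 c^-t + c^2 by comparing f
    with c^2; the hypothesis controls the first term, and the norm of c the
    second. *)
Let extrapolation_down s K : (1 < p0)%R -> (0 < s)%R ->
  exists2 C : R, (0 < C)%R & forall w, Muckenhoupt s K w ->
  forall f g, F (f, g) ->
  \int[mu]_x (f x * (w x)%:E) <= C%:E * \int[mu]_x (g x * (w x)%:E).
Proof.
move=> p1 s0.
have two1 : (1 < 2 :> R)%R by rewrite ltr1n.
have [C1 [K' [C10 K'0 maj]]] := A1_majorant K two1 s0.
pose t := (2 * (p0 - 1))%R.
have p10 : (0 < p0 - 1)%R by rewrite subr_gt0.
have t0 : (0 < t)%R by rewrite mulr_gt0.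
pose s' := (t + (1 + t) * s)%R.
have s'0 : (0 < s')%R by rewrite addr_gt0// mulr_gt0// addr_gt0.
have [C0 C00 H0] := F_p0 (K' `^ t * 2 `^ s' * K `^ (1 + t)) s'0.
have [C2 C20 H2] := F_p0 K s0.
exists (C0 + C1)%R; first by rewrite addr_gt0.
move=> w wA f g Ffg; have [mf f0 mg g0] := F_family Ffg.
have [mw w0 _] := wA.
have w0E x : 0 <= (w x)%:E by rewrite lee_fin ltW.
have gw0 x : 0 <= g x * (w x)%:E by rewrite mule_ge0.
have Ig0 : 0 <= \int[mu]_x (g x * (w x)%:E) by exact: integral_ge0.
have [Igy|Igfin] := eqVneq (\int[mu]_x (g x * (w x)%:E)) +oo.
  by rewrite Igy gt0_muley ?leey// lte_fin addr_gt0.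
have wne0 x : (w x)%:E != 0 by rewrite eqe gt_eqF.
have [Igz|Ignz] := eqVneq (\int[mu]_x (g x * (w x)%:E)) 0.
  have gp0 : \int[mu]_x (g x `^ p0 * (w x)%:E) = 0.
    apply: (@integral_eq0_sub (fun x => g x * (w x)%:E)) => //.
    - exact: measurable_funM_EFin.
    - by apply: measurable_funM_EFin => //; exact: measurable_fun_poweR.
    - by move=> x; rewrite mule_ge0// poweR_ge0.
    - move=> x /eqP; rewrite mule_eq0 (negbTE (wne0 x)) orbF => /eqP ->.
      by rewrite poweR0r ?gt_eqF// mul0e.
  have fp0 : \int[mu]_x (f x `^ p0 * (w x)%:E) = 0.
    apply/eqP; rewrite eq_le; apply/andP; split; last first.
      by apply: integral_ge0 => x _; rewrite mule_ge0// poweR_ge0.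
    by apply: le_trans (H2 w wA f g Ffg) _; rewrite gp0 mule0.
  rewrite Igz mule0 (@integral_eq0_sub (fun x => f x `^ p0 * (w x)%:E))//.
  - by apply: measurable_funM_EFin => //; exact: measurable_fun_poweR.
  - exact: measurable_funM_EFin.
  - by move=> x; rewrite mule_ge0// poweR_ge0.
  - by move=> x; rewrite mule_ge0.
  - move=> x /eqP; rewrite mule_eq0 (negbTE (wne0 x)) orbF poweR_eq0//.
    by move=> /andP[/eqP -> _]; rewrite mul0e.
have [] := maj w (fun x => g x `^ 2^-1) wA _ _ _.
- exact: measurable_fun_poweR.
- by move=> x; exact: poweR_ge0.
- have -> : \int[mu]_x ((g x `^ 2^-1) `^ 2 * (w x)%:E) = \int[mu]_x (g x * (w x)%:E).
    by apply: eq_integral => x _; rewrite -poweRrM mulVf// poweRe1.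
  by rewrite lt_neqAle eq_sym Ignz Ig0/= lt_neqAle Igfin leey.
move=> c cA1 [gc cI]; have [mc c0 _] := cA1.
have wA' := Muckenhoupt_neg_power s0 K'0 t0 wA cA1.
have gI2 : \int[mu]_x ((g x `^ 2^-1) `^ 2 * (w x)%:E) = \int[mu]_x (g x * (w x)%:E).
  by apply: eq_integral => x _; rewrite -poweRrM mulVf// poweRe1.
rewrite gI2 in cI.
have ct x : (c x `^ t = (c x `^ 2) `^ (p0 - 1))%R by rewrite -powRrM.
have c20 x : (0 < c x `^ 2)%R by rewrite powR_gt0.
have ctn x : (0 < c x `^ (- t))%R by rewrite powR_gt0.
have powp0 (y : R) : (0 <= y)%R -> (y `^ p0 = y * y `^ (p0 - 1))%R.
  move=> y0; have : (y `^ (1 + (p0 - 1)) = y `^ 1 * y `^ (p0 - 1))%R.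
    by apply: powRD; rewrite addrC subrK gt_eqF.
  by rewrite addrC subrK powRr1.
have fle x : f x <= f x `^ p0 * (c x `^ (- t))%:E + (c x `^ 2)%:E.
  case: (f x) (f0 x) => [y| |//] y0; last first.
    by rewrite poweRyr ?gt_eqF// gt0_mulye ?lte_fin// addye// leey.
  rewrite poweR_EFin -EFinM -EFinD lee_fin.
  have [h|h] := leP y (c x `^ 2)%R.
    by rewrite ler_wpDl// mulr_ge0 ?powR_ge0.
  rewrite ler_wpDr ?powR_ge0// powp0// -mulrA ler_peMr// powRN ct.
  by rewrite ler_pdivlMr ?powR_gt0// mul1r ge0_ler_powR ?nnegrE// ltW.
have gle : {ae mu, forall x, g x `^ p0 * (c x `^ (- t))%:E <= g x}.
  apply: filterS gc => x.
  case: (g x) (g0 x) => [y| |//] y0; last by rewrite poweRyr ?invr_eq0// leye_eq.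
  rewrite !poweR_EFin -EFinM !lee_fin => h.
  have y0' : (0 <= y)%R := y0.
  have yc : (y <= c x `^ 2)%R.
    have -> : (y = (y `^ 2^-1) `^ 2)%R by rewrite -powRrM mulVf// powRr1.
    by rewrite ge0_ler_powR ?nnegrE ?powR_ge0// ltW.
  rewrite powp0// -mulrA ler_piMr// powRN ct ler_pdivrMr ?powR_gt0// mul1r.
  by rewrite ge0_ler_powR ?nnegrE// ltW.
have E1 h x : h x `^ p0 * (c x `^ (- t))%:E * (w x)%:E =
    h x `^ p0 * ((c x `^ (- t) * w x)%R)%:E by rewrite EFinM muleA.
have mct : measurable_fun setT (fun x => (c x `^ (- t))%:E).
  by apply/measurable_EFinP; exact: measurable_fun_powR.
have mc2 : measurable_fun setT (fun x => (c x `^ 2)%:E).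
  by apply/measurable_EFinP; exact: measurable_fun_powR.
have mh h : measurable_fun setT h ->
    measurable_fun setT (fun x => h x `^ p0 * (c x `^ (- t))%:E * (w x)%:E).
  by move=> mh; apply: measurable_funM_EFin => //; apply: emeasurable_funM => //; exact: measurable_fun_poweR.
have h0 h x : 0 <= h x `^ p0 * (c x `^ (- t))%:E * (w x)%:E.
  by rewrite !mule_ge0 ?poweR_ge0// lee_fin ltW.
apply: (@le_trans _ _ (\int[mu]_x (f x `^ p0 * (c x `^ (- t))%:E * (w x)%:E +
   (c x `^ 2)%:E * (w x)%:E))).
  apply: ge0_le_integralT.
  - exact: measurable_funM_EFin.
  - by apply: emeasurable_funD; [exact: mh|exact: measurable_funM_EFin].
  - by move=> x; rewrite mule_ge0.
  - move=> x; rewrite -ge0_muleDl ?lee_fin ?powR_ge0//; last first.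
      by rewrite mule_ge0 ?poweR_ge0// lee_fin ltW.
    by rewrite lee_wpmul2r.
rewrite ge0_integralDT//; last 3 first.
- exact: mh.
- exact: measurable_funM_EFin.
- by move=> x; rewrite mule_ge0// lee_fin powR_ge0.
rewrite EFinD [leRHS]ge0_muleDl ?lee_fin ?(ltW C00) ?(ltW C10)//; apply: leeD => //.
under eq_integral do rewrite E1.
apply: le_trans (H0 _ wA' f g Ffg) _; rewrite lee_wpmul2l ?lee_fin ?(ltW C00)//.
under eq_integral do rewrite -E1.
apply: ae_ge0_le_integral => //.
- exact: mh.
- exact: measurable_funM_EFin.
- by apply: filterS gle => x h _; rewrite lee_wpmul2r.
Qed.

(** For p0 < 1, take for c a majorant of f^(1-p0) in L^(1/(1-p0)) (w), and c w as
    weight.  Then f <= f^p0 c, and g^p0 c is at most a multiple of g plus a small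
    multiple of c^(1/(1-p0)), by comparing A g with c^(1/(1-p0)); A is so
    large that the latter contributes at most half of int f w, and is absorbed.
    For this f is truncated first, so that int f w is finite. *)
Let extrapolation_up s K : (p0 < 1)%R -> (0 < s)%R ->
  exists2 C : R, (0 < C)%R & forall w, Muckenhoupt s K w ->
  forall f g, F (f, g) ->
  \int[mu]_x (f x * (w x)%:E) <= C%:E * \int[mu]_x (g x * (w x)%:E).
Proof.
move=> p1 s0.
have p10 : (0 < 1 - p0)%R by rewrite subr_gt0.
pose p := (1 - p0)^-1%R.
have p_gt0 : (0 < p)%R by rewrite invr_gt0.
have p_gt1 : (1 < p)%R by rewrite invf_gt1// ltrBlDr ltrDl.
have [C1 [K' [C10 K'0 maj]]] := A1_majorant K p_gt1 s0.
have [C0 C00 H0] := F_p0 (K' * K) s0.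
pose A := ((2 * C0 * C1) `^ p0^-1)%R.
have A0 : (0 < A)%R by rewrite powR_gt0// !mulr_gt0.
have Ap : (A `^ p0 = 2 * C0 * C1)%R.
  by rewrite -powRrM mulVf ?gt_eqF// powRr1// !mulr_ge0// ltW.
exists (2 * C0 * A `^ (1 - p0))%R; first by rewrite !mulr_gt0// powR_gt0.
move=> w wA f g Ffg; have [mf f0 mg g0] := F_family Ffg.
have [mw w0 wAQ] := wA.
have w0E x : 0 <= (w x)%:E by rewrite lee_fin ltW.
set C := (2 * C0 * A `^ (1 - p0))%R.
have mE m : measurable (E m) := mB (BE m).
pose fk m := EFin \o trunc E f m.
have mfk m : measurable_fun setT (fk m) by apply/measurable_EFinP; exact: measurable_trunc.
have fk0 m x : 0 <= fk m x by rewrite lee_fin trunc_ge0.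
suff main m : \int[mu]_x (fk m x * (w x)%:E) <= C%:E * \int[mu]_x (g x * (w x)%:E).
  have -> : \int[mu]_x (f x * (w x)%:E) = \int[mu]_x limn (fun m => fk m x * (w x)%:E).
    apply: eq_integral => x _; apply/esym/cvg_lim => //.
    by apply: cvgeZr => //; exact: trunc_cvg.
  rewrite monotone_convergence//; last 3 first.
  - by move=> m; exact: measurable_funM_EFin.
  - by move=> m x _; rewrite mule_ge0.
  - by move=> x _ i j ij; rewrite lee_wpmul2r// lee_fin; exact: trunc_nd.
  apply: lime_le; last exact: nearW.
  apply: ereal_nondecreasing_is_cvgn => i j ij; apply: ge0_le_integralT.
  - exact: measurable_funM_EFin.
  - exact: measurable_funM_EFin.
  - by move=> x; rewrite mule_ge0.
  - by move=> x; rewrite lee_wpmul2r// lee_fin; exact: trunc_nd.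
have If0 : 0 <= \int[mu]_x (fk m x * (w x)%:E).
  by apply: integral_ge0 => x _; rewrite mule_ge0.
have C_gt0 : (0 < C)%R by rewrite /C !mulr_gt0// powR_gt0.
have C_ge0 : (0 <= C)%R by exact: ltW.
have Iffin : \int[mu]_x (fk m x * (w x)%:E) < +oo.
  have [a [b [a0 b0 wa _ _]]] := wAQ _ (BE m).
  have [q q0 qE] := nu_fineE muB (BE m).
  apply: (@le_lt_trans _ _ (m%:R%:E * \int[mu]_(x in E m) (w x)%:E)).
    rewrite [X in _ <= _ * X]integral_mkcond -ge0_integralZT//; last 2 first.
    - apply/(measurable_restrictT _ (mE m)).
      by apply: measurable_funTS; exact/measurable_EFinP.
    - by move=> x; apply: erestrict_ge0.
    apply: ge0_le_integralT.
    - exact: measurable_funM_EFin.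
    - apply: measurable_funeM; apply/(measurable_restrictT _ (mE m)).
      by apply: measurable_funTS; exact/measurable_EFinP.
    - by move=> x; rewrite mule_ge0.
    - move=> x; rewrite patchE; have := trunc_le_indic E f0 m x; rewrite indicE.
      case: ifPn => xE; rewrite ?mulr1 ?mulr0 => h.
        by rewrite lee_wpmul2r// lee_fin.
      have -> : fk m x = 0 by apply/le_anti; rewrite fk0 andbT lee_fin.
      by rewrite mul0e mule0.
  apply: (@le_lt_trans _ _ (m%:R%:E * (a%:E * mu (E m)))).
    by rewrite lee_wpmul2l.
  by rewrite qE -!EFinM ltry.
have [Ifz|Ifnz] := eqVneq (\int[mu]_x (fk m x * (w x)%:E)) 0.
  by rewrite Ifz mule_ge0 ?lee_fin// integral_ge0// => x _; rewrite mule_ge0.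
have fkp x : (fk m x `^ (1 - p0)) `^ p = fk m x.
  by rewrite -poweRrM mulfV ?gt_eqF// poweRe1.
have [] := maj w (fun x => fk m x `^ (1 - p0)) wA _ _ _.
- exact: measurable_fun_poweR.
- by move=> x; exact: poweR_ge0.
- under eq_integral do rewrite fkp.
  by rewrite Iffin lt_neqAle eq_sym Ifnz If0.
move=> c cA1 [fc cI]; have [mc c0 _] := cA1.
have {}cI : \int[mu]_x ((c x `^ p)%:E * (w x)%:E) <=
    C1%:E * \int[mu]_x (fk m x * (w x)%:E).
  apply: le_trans cI _; rewrite lee_wpmul2l ?lee_fin ?(ltW C10)//.
  by under eq_integral do rewrite fkp.
have wA' := Muckenhoupt_mul s0 K'0 wA cA1.
have mcE : measurable_fun setT (fun x => (c x)%:E) by exact/measurable_EFinP.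
have mcp : measurable_fun setT (fun x => (c x `^ p)%:E).
  by apply/measurable_EFinP; exact: measurable_fun_powR.
have mh h : measurable_fun setT h ->
    measurable_fun setT (fun x => h x `^ p0 * ((c x * w x)%R)%:E).
  move=> mh; apply: emeasurable_funM; first exact: measurable_fun_poweR.
  by apply/measurable_EFinP; exact: measurable_funM.
have h0 h x : 0 <= h x `^ p0 * ((c x * w x)%R)%:E.
  by rewrite mule_ge0 ?poweR_ge0// lee_fin mulr_ge0// ltW.
have fle : {ae mu, forall x, fk m x * (w x)%:E <= f x `^ p0 * ((c x * w x)%R)%:E}.
  apply: filterS fc => x h; rewrite EFinM muleA lee_wpmul2r//.
  apply: (@le_trans _ _ (fk m x `^ p0 * fk m x `^ (1 - p0))).
    rewrite -poweRD; first by rewrite addrC subrK poweRe1.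
    by rewrite /poweRD_def addrC subrK oner_eq0.
  apply: lee_pmul => //; try exact: poweR_ge0.
  apply: gt0_ler_poweR; rewrite ?(ltW p0_gt0)//.
  - by rewrite in_itv/= leey fk0.
  - by rewrite in_itv/= leey f0.
  - exact: trunc_le.
have gle x : g x `^ p0 * ((c x * w x)%R)%:E <=
    (A `^ (1 - p0))%:E * (g x * (w x)%:E) +
    (A `^ (- p0))%:E * ((c x `^ p)%:E * (w x)%:E).
  rewrite !muleA -ge0_muleDl; last 2 first.
  - by rewrite mule_ge0// lee_fin powR_ge0.
  - by rewrite -EFinM lee_fin mulr_ge0 ?powR_ge0.
  rewrite EFinM muleA lee_wpmul2r//.
  case: (g x) (g0 x) => [y| |//] y0; last first.
    have -> : (A `^ (1 - p0))%:E * +oo = +oo by rewrite gt0_muley// lte_fin powR_gt0.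
    by rewrite addye// leey.
  rewrite poweR_EFin -!EFinM -EFinD lee_fin.
  have y0' : (0 <= y)%R := y0.
  have cp0 : (0 < c x `^ p)%R by rewrite powR_gt0.
  have cE : (c x = (c x `^ p) `^ (1 - p0))%R.
    by rewrite -powRrM mulVf ?gt_eqF// powRr1// ltW.
  have [h|h] := leP (c x `^ p)%R (A * y)%R.
    apply: ler_wpDr; first by rewrite mulr_ge0 ?powR_ge0.
    apply: (@le_trans _ _ (y `^ p0 * (A * y) `^ (1 - p0))%R).
      rewrite ler_wpM2l ?powR_ge0// {1}cE.
      by rewrite ge0_ler_powR ?nnegrE ?(ltW p10) ?(ltW cp0) ?mulr_ge0 ?(ltW A0).
    rewrite powRM ?(ltW A0)// mulrCA ler_wpM2l ?powR_ge0// -powRD.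
      by rewrite addrC subrK powRr1.
    by rewrite addrC subrK oner_eq0.
  apply: ler_wpDl; first by rewrite mulr_ge0 ?powR_ge0.
  apply: (@le_trans _ _ ((A^-1 * c x `^ p) `^ p0 * c x)%R).
    rewrite ler_wpM2r ?(ltW (c0 x))// ge0_ler_powR ?nnegrE ?(ltW p0_gt0)//.
      by rewrite mulr_ge0 ?invr_ge0 ?powR_ge0// ltW.
    by rewrite ler_pdivlMl// ltW.
  rewrite powRM ?invr_ge0 ?powR_ge0 ?(ltW A0)// -(powR_inv1 (ltW A0)) -powRrM mulN1r.
  rewrite -mulrA ler_wpM2l ?powR_ge0// {2}cE -powRD; last first.
    by rewrite addrC subrK oner_eq0.
  by rewrite addrC subrK powRr1// ltW.
have Ig0 : 0 <= \int[mu]_x (g x * (w x)%:E) by apply: integral_ge0 => x _; rewrite mule_ge0.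
have step : \int[mu]_x (fk m x * (w x)%:E) <= (C0 * A `^ (1 - p0))%:E *
    \int[mu]_x (g x * (w x)%:E) + (2^-1)%:E * \int[mu]_x (fk m x * (w x)%:E).
  apply: (@le_trans _ _ (\int[mu]_x (f x `^ p0 * ((c x * w x)%R)%:E))).
    apply: ae_ge0_le_integral => //.
    - by move=> x _; rewrite mule_ge0.
    - exact: measurable_funM_EFin.
    - exact: mh.
    - by apply: filterS fle.
  apply: le_trans (H0 _ wA' f g Ffg) _.
  apply: (@le_trans _ _ (C0%:E * ((A `^ (1 - p0))%:E * \int[mu]_x (g x * (w x)%:E) +
     (A `^ (- p0))%:E * \int[mu]_x ((c x `^ p)%:E * (w x)%:E)))).
    rewrite lee_wpmul2l ?lee_fin ?(ltW C00)//.
    have m1 : measurable_fun setT (fun x => g x * (w x)%:E) by exact: measurable_funM_EFin.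
    have m2 : measurable_fun setT (fun x => (c x `^ p)%:E * (w x)%:E) by exact: measurable_funM_EFin.
    have q1 x : 0 <= g x * (w x)%:E by rewrite mule_ge0.
    have q2 x : 0 <= (c x `^ p)%:E * (w x)%:E by rewrite mule_ge0// lee_fin powR_ge0.
    rewrite -!ge0_integralZT ?powR_ge0// -ge0_integralDT//; last 4 first.
    - exact: measurable_funeM.
    - exact: measurable_funeM.
    - by move=> x; rewrite mule_ge0// lee_fin powR_ge0.
    - by move=> x; rewrite mule_ge0// lee_fin powR_ge0.
    apply: ge0_le_integralT => //; first exact: mh.
    by apply: emeasurable_funD; exact: measurable_funeM.
  rewrite ge0_muleDr; last 2 first.
  - by rewrite mule_ge0// lee_fin powR_ge0.
  - rewrite mule_ge0// ?lee_fin ?powR_ge0//; apply: integral_ge0 => x _.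
    by rewrite mule_ge0// lee_fin powR_ge0.
  apply: leeD; first by rewrite muleA -EFinM.
  rewrite muleA -EFinM.
  apply: (@le_trans _ _ ((C0 * A `^ (- p0))%:E * (C1%:E * \int[mu]_x (fk m x * (w x)%:E)))).
    by rewrite lee_wpmul2l// lee_fin mulr_ge0 ?powR_ge0// ltW.
  rewrite muleA -EFinM lee_wpmul2r// lee_fin powRN Ap le_eqVlt; apply/orP; left.
  by apply/eqP; field; rewrite !gt_eqF.
move: step If0 Iffin; case: (\int[mu]_x (fk m x * (w x)%:E)) => [y| |//] step y0 _ //.
case: (\int[mu]_x (g x * (w x)%:E)) Ig0 step => [z| |//] z0 step; last first.
  by rewrite gt0_muley ?leey// lte_fin.
move: step; rewrite -!EFinM -EFinD !lee_fin /C -!mulrA.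
set X := (C0 * _)%R; lra.
Qed.

Theorem Ainfty_extrapolation s K : (0 < s)%R ->
  exists2 C : R, (0 < C)%R & forall w, Muckenhoupt s K w ->
  forall f g, F (f, g) ->
  \int[mu]_x (f x * (w x)%:E) <= C%:E * \int[mu]_x (g x * (w x)%:E).
Proof.
move=> s0; have [p1|p1|p1] := ltgtP p0 1%R.
- exact: extrapolation_up.
- exact: extrapolation_down.
have [C C0 H] := F_p0 K s0; exists C => // w wA f g Ffg.
have := H w wA f g Ffg; rewrite p1; have [_ f0 _ g0] := F_family Ffg.
under eq_integral do rewrite poweRe1//.
by under [in X in _ * X]eq_integral do rewrite poweRe1//.
Qed.
End extrapolation.

(** * Extrapolation by duality *)

Section core.
Context {d} {T : measurableType d} {R : realType}.
Variables (mu : {measure set T -> \bar R}) (B : set (set T)).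
Implicit Types (w a b : T -> R) (f g h : T -> \bar R) (Q : set T).
Hypothesis mB : forall Q, B Q -> measurable Q.
Hypothesis muB : forall Q, B Q -> 0 < mu Q < +oo.
Hypothesis measurable_sup_over : forall phi : set T -> \bar R,
  measurable_fun setT (sup_over B phi).
Variable E : nat -> set T.
Hypothesis BE : forall m, B (E m).
Hypothesis ndE : forall m, E m `<=` E m.+1.
Hypothesis covE : forall x, exists m, E m x.
Local Notation Muckenhoupt := (Muckenhoupt mu B).

(** The condition A_1 with constant K: m bounds the mean of a over Q, and K a is
    almost everywhere at least m on Q. *)
Definition A1 (K : R) a := [/\ measurable_fun setT a,
  forall x, (0 < a x)%R & forall Q, B Q -> exists2 m : R, (0 < m)%R &
    \int[mu]_(x in Q) (a x)%:E <= m%:E * mu Q /\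
    {ae mu, forall x, Q x -> (m <= K * a x)%R}].

(** The easy half of Jones' factorization.  The lower bounds of a and b on Q bound
    a^(-1/s) and b^(-s), and the powers of the two means cancel in the product. *)
Lemma Muckenhoupt_of_A1 s K K' a b : (0 < s)%R -> (0 < K)%R -> (0 < K')%R ->
  A1 K a -> A1 K' b ->
  Muckenhoupt s (K * K' `^ s) (fun x => a x * b x `^ (- s))%R.
Proof.
move=> s0 K0 K'0 [ma a0 aA] [mb b0 bA]; split.
- by apply: measurable_funM => //; exact: measurable_fun_powR.
- by move=> x; rewrite mulr_gt0// powR_gt0.
move=> Q BQ; have mQ := mB BQ.
have [m m0 [am aem]] := aA Q BQ; have [k k0 [bk aek]] := bA Q BQ.
pose m' := (m / K)%R; have m'0 : (0 < m')%R by rewrite divr_gt0.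
pose k' := (k / K')%R; have k'0 : (0 < k')%R by rewrite divr_gt0.
have mEa : measurable_fun setT (fun x => (a x)%:E) by exact/measurable_EFinP.
have mEb : measurable_fun setT (fun x => (b x)%:E) by exact/measurable_EFinP.
exists (k' `^ (- s) * m)%R, (m' `^ (- s^-1) * k)%R; split.
- by rewrite mulr_gt0// powR_gt0.
- by rewrite mulr_gt0// powR_gt0.
- apply: (@le_trans _ _ (\int[mu]_(x in Q) ((k' `^ (- s))%:E * (a x)%:E))).
    apply: ae_ge0_le_integral => //.
    + by move=> x _; rewrite lee_fin mulr_ge0 ?powR_ge0// ltW.
    + apply: measurable_funTS; apply/measurable_EFinP; apply: measurable_funM => //.
      exact: measurable_fun_powR.
    + by move=> x _; rewrite -EFinM lee_fin mulr_ge0 ?powR_ge0// ltW.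
    + by apply: measurable_funTS; exact: measurable_funeM.
    + apply: filterS aek => x /[apply] h; rewrite -EFinM lee_fin mulrC.
      rewrite ler_wpM2r ?(ltW (a0 x))// !powRN lef_pV2 ?posrE ?powR_gt0//.
      rewrite ge0_ler_powR ?nnegrE ?(ltW s0) ?(ltW k'0) ?(ltW (b0 x))//.
      by rewrite /k' ler_pdivrMr// mulrC.
  rewrite ge0_integralZl//; last 3 first.
  + exact: measurable_funTS.
  + by move=> x _; rewrite lee_fin ltW.
  + by rewrite lee_fin powR_ge0.
  by rewrite EFinM -muleA lee_wpmul2l// lee_fin powR_ge0.
- apply: (@le_trans _ _ (\int[mu]_(x in Q) ((m' `^ (- s^-1))%:E * (b x)%:E))).
    apply: ae_ge0_le_integral => //.
    + by move=> x _; rewrite lee_fin powR_ge0.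
    + apply: measurable_funTS; apply/measurable_EFinP; apply: measurable_fun_powR.
      by apply: measurable_funM => //; exact: measurable_fun_powR.
    + by move=> x _; rewrite -EFinM lee_fin mulr_ge0 ?powR_ge0// ltW.
    + by apply: measurable_funTS; exact: measurable_funeM.
    + apply: filterS aem => x /[apply] h; rewrite -EFinM lee_fin.
      rewrite powRM ?powR_ge0 ?(ltW (a0 x))// -powRrM mulrNN mulfV ?gt_eqF//.
      rewrite powRr1 ?(ltW (b0 x))// ler_wpM2r ?(ltW (b0 x))//.
      rewrite !powRN lef_pV2 ?posrE ?powR_gt0//.
      rewrite ge0_ler_powR ?nnegrE ?invr_ge0 ?(ltW s0) ?(ltW m'0) ?(ltW (a0 x))//.
      by rewrite /m' ler_pdivrMr// mulrC.
  rewrite ge0_integralZl//; last 3 first.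
  + exact: measurable_funTS.
  + by move=> x _; rewrite lee_fin ltW.
  + by rewrite lee_fin powR_ge0.
  by rewrite EFinM -muleA lee_wpmul2l// lee_fin powR_ge0.
- rewrite le_eqVlt; apply/orP; left; apply/eqP.
  rewrite (powRM _ (powR_ge0 _ _) (ltW k0)) -powRrM mulNr mulVf ?gt_eqF//.
  rewrite powR_inv1 ?(ltW m'0)// /k' powRM ?(ltW k0) ?invr_ge0 ?(ltW K'0)//.
  rewrite -(powR_inv1 (ltW K'0)) -powRrM mulrNN mul1r powRN /m'.
  by field; rewrite !gt_eqF// powR_gt0.
Qed.

Variables (u v : T -> R) (N : (T -> \bar R) -> \bar R).
Hypothesis mu_ : measurable_fun setT u.
Hypothesis u0 : forall x, (0 < u x)%R.
Hypothesis mv : measurable_fun setT v.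
Hypothesis v0 : forall x, (0 < v x)%R.
Hypothesis N_ge0 : forall f : T -> \bar R, measurable_fun setT f -> 0 <= N f.
Hypothesis N_eq0 : forall f : T -> \bar R, measurable_fun setT f -> N f = 0 ->
  {ae mu, forall x, f x = 0}.
Hypothesis N_le : forall f g : T -> \bar R, measurable_fun setT f ->
  measurable_fun setT g -> (forall x, 0 <= f x) -> (forall x, 0 <= g x) ->
  {ae mu, forall x, f x <= g x} -> N f <= N g.
Hypothesis N_triangle : forall f g : T -> \bar R, measurable_fun setT f ->
  measurable_fun setT g -> (forall x, 0 <= f x) -> (forall x, 0 <= g x) ->
  N (f \+ g) <= N f + N g.
Hypothesis N_homogeneous : forall (a : R) (f : T -> \bar R), measurable_fun setT f ->
  (forall x, 0 <= f x) -> (0 <= a)%R -> N (fun x => a%:E * f x) = a%:E * N f.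
Hypothesis N_fatou : forall (f_ : nat -> T -> \bar R) (f : T -> \bar R) (y : \bar R),
  (forall k, measurable_fun setT (f_ k)) -> measurable_fun setT f ->
  (forall k x, 0 <= f_ k x) -> (forall x, 0 <= f x) ->
  (forall x, nondecreasing_seq (f_ ^~ x)) ->
  (forall x, f_ ^~ x @ \oo --> f x) -> (forall k, N (f_ k) <= y) -> N f <= y.
Hypothesis N_indic : forall A : set T, measurable A ->
  \int[mu]_(x in A) (v x)%:E < +oo -> N (fun x => (\1_A x)%:E) < +oo.

(** The associate norm of h is at most k. *)
Definition dual_le h (k : R) := forall g : T -> \bar R, measurable_fun setT g ->
  (forall x, 0 <= g x) -> N g <= 1 -> \int[mu]_x (h x * g x * (v x)%:E) <= k%:E.

Let v0E x : 0 <= (v x)%:E. Proof. by rewrite lee_fin ltW. Qed.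

(** Homogeneity; functions of norm 0 vanish almost everywhere. *)
Lemma dual_le_norm h g (k : R) : (0 <= k)%R -> measurable_fun setT h ->
  (forall x, 0 <= h x) -> dual_le h k -> measurable_fun setT g ->
  (forall x, 0 <= g x) -> N g < +oo ->
  \int[mu]_x (h x * g x * (v x)%:E) <= k%:E * N g.
Proof.
move=> k0 mh h0 hk mg g0 Ngfin.
have : N g \is a fin_num by rewrite ge0_fin_numE// N_ge0.
case E1 : (N g) => [n| |] // _.
have := N_ge0 mg; rewrite E1 lee_fin le_eqVlt => /predU1P[n0|n0].
  rewrite -n0 mule0.
  have gz : {ae mu, forall x, g x = 0} by apply: N_eq0 => //; rewrite E1 -n0.
  rewrite (ge0_ae_eq_integral measurableT (g := cst 0)) ?integral0//.
  - by apply: measurable_funM_EFin => //; exact: emeasurable_funM.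
  - by move=> x _; rewrite !mule_ge0.
  - by apply: filterS gz => x -> _; rewrite mule0 mul0e.
pose g' x := n^-1%:E * g x.
have n'0 : (0 <= n^-1)%R by rewrite invr_ge0 ltW.
have g'0 x : 0 <= g' x by rewrite mule_ge0.
have mg' : measurable_fun setT g' by exact: measurable_funeM.
have := hk g' mg' g'0.
rewrite /g' N_homogeneous// E1 -EFinM mulVf ?gt_eqF// lexx => /(_ isT).
have -> : \int[mu]_x (h x * (n^-1%:E * g x) * (v x)%:E) =
    n^-1%:E * \int[mu]_x (h x * g x * (v x)%:E).
  rewrite -ge0_integralZT//.
  - by apply: eq_integral => x _; rewrite muleCA -!muleA.
  - by apply: measurable_funM_EFin => //; exact: emeasurable_funM.
  - by move=> x; rewrite !mule_ge0.
by rewrite lee_pdivrMl// muleC.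
Qed.

(** Sets on which v is integrable, so that their indicators have finite norm. *)
Let A m := E m `&` [set x | (v x <= m%:R)%R].

Let mA m : measurable (A m).
Proof.
apply: measurableI; first exact: mB.
rewrite (_ : [set x | _] = setT `&` [set x | (EFin \o v) x <= m%:R%:E]).
  by apply: emeasurable_fun_infty_c => //; exact/measurable_EFinP.
by apply/seteqP; split => x /=; rewrite lee_fin; [split|case].
Qed.

Let ndA m : A m `<=` A m.+1.
Proof.
move=> x [Ex vx]; split; first exact: ndE.
by apply: le_trans vx _; rewrite ler_nat.
Qed.

Let covA x : exists m, A m x.
Proof.
have [m0 Em0] := covE x.
pose m := maxn m0 (Num.truncn (v x)).+1; exists m; split.
  have : (m0 <= m)%N by exact: leq_maxl.
  by move=> /subnKC <-; elim: (m - m0)%N => [|i IH]; rewrite ?addn0// addnS; exact: ndE.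
by rewrite /=; apply: le_trans (ltW (truncnS_gt _)) _; rewrite ler_nat leq_maxr.
Qed.

Let vA m : \int[mu]_(x in A m) (v x)%:E < +oo.
Proof.
have [q q0 qE] := nu_fineE muB (BE m).
apply: (@le_lt_trans _ _ (\int[mu]_(x in A m) (cst m%:R%:E x))).
  apply: ge0_le_integral => //.
    by apply: measurable_funTS; exact/measurable_EFinP.
  by move=> x [_ vm]; rewrite lee_fin.
rewrite integral_cst//; apply: (@le_lt_trans _ _ (m%:R%:E * mu (E m))).
  rewrite lee_wpmul2l// le_measure ?inE//; first exact: mB.
  by move=> x [].
by rewrite qE -EFinM ltry.
Qed.

(** Test h against the indicators of the sets A m. *)
Lemma dual_le_fin h (k : R) : (0 <= k)%R -> measurable_fun setT h ->
  (forall x, 0 <= h x) -> dual_le h k -> {ae mu, forall x, h x < +oo}.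
Proof.
move=> k0 mh h0 hk.
have main m : {ae mu, forall x, A m x -> h x < +oo}.
  have mI : measurable_fun setT (fun x : T => (\1_(A m) x)%:E : \bar R).
    by apply/measurable_EFinP; exact: measurable_indic.
  have I0 x : 0 <= (\1_(A m) x)%:E :> \bar R by rewrite lee_fin.
  have := dual_le_norm k0 mh h0 hk mI I0 (N_indic (mA m) (vA m)).
  have mf : measurable_fun setT (fun x => h x * (\1_(A m) x)%:E * (v x)%:E).
    by apply: measurable_funM_EFin => //; exact: emeasurable_funM.
  have f0 x : 0 <= h x * (\1_(A m) x)%:E * (v x)%:E by rewrite !mule_ge0.
  move=> hI; have Ifin : \int[mu]_x (h x * (\1_(A m) x)%:E * (v x)%:E) < +oo.
    apply: le_lt_trans hI _; have := N_indic (mA m) (vA m).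
    have := N_ge0 mI; case: (N _) => [y| |]// _ _; exact: ltry.
  have nz := integral_fin_ae mf f0 Ifin.
  exists [set x | h x * (\1_(A m) x)%:E * (v x)%:E = +oo]; split => //.
    exact: measurable_eq_pinfty.
  move=> x /= /not_implyP[Ax]; rewrite indicE mem_set// mule1 => /negP.
  by rewrite -leNgt leye_eq => /eqP ->; rewrite gt0_mulye// lte_fin.
have : {ae mu, forall x m, A m x -> h x < +oo} by exact/ae_foralln.
by apply: filterS => x hx; have [m Am] := covA x; exact: (hx m).
Qed.

(** The theorem of Lorentz and Luxemburg for the measure v d mu. *)
Lemma associate_dual (F : T -> \bar R) (C : R) : (0 < C)%R ->
  measurable_fun setT F -> (forall x, 0 <= F x) ->
  (forall h, measurable_fun setT h -> (forall x, 0 <= h x) -> dual_le h 1 ->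
    \int[mu]_x (F x * h x * (v x)%:E) <= C%:E) -> N F <= C%:E.
Proof.
move=> C0 mF F0 dual.
have [nu [nuE nuI]] := exists_density_measure mu mv (fun x => ltW (v0 x)).
have nuIT f : measurable_fun setT f -> (forall x, 0 <= f x) ->
  \int[nu]_x f x = \int[mu]_x (f x * (v x)%:E) by move=> *; exact: nuI.
apply: (lorentz_luxemburg (nu := nu) (N := N) _ _ _ _ (E := A)) => //.
- move=> f g mf mg f0 g0 [X [mX X0 fX]]; apply: N_le => //.
  by exists X; split => //; apply: (null_density mv v0 mX); rewrite -nuE.
- by move=> m; rewrite nuE.
move=> h mh h0 hN.
have mhE : measurable_fun setT (fun x => (h x)%:E) by exact/measurable_EFinP.
rewrite nuIT; last 2 first.
- exact: measurable_funM_EFin.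
- by move=> x; rewrite mule_ge0// lee_fin.
apply: (dual (EFin \o h)) => // g mg g0 Ng.
rewrite -(nuIT (fun x => (h x)%:E * g x)) ?hN//.
- exact: emeasurable_funM.
- by move=> x; rewrite mule_ge0// lee_fin.
Qed.

Variable K0 : R.
Hypothesis K0_gt0 : (0 < K0)%R.
Variable V : T -> R.
Hypothesis mV : measurable_fun setT V.
Hypothesis V0 : forall x, (0 < V x)%R.

(** The maximal operator conjugated by the multiplication by V; V is v^(1/r) in
    the application. *)
Definition twisted_max h : T -> \bar R := fun x =>
  mean_max B mu (fun y => h y * (V y)%:E) x * (V x)^-1%:E.

Hypothesis maximal_dual : forall h (k : R), measurable_fun setT h ->
  (forall x, 0 <= h x) -> (0 <= k)%R -> dual_le h k ->
  dual_le (twisted_max h) (K0 * k).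

Let covB x : exists2 Q, B Q & Q x.
Proof. by have [m Em] := covE x; exists (E m). Qed.

Let measurable_inv_gt0 (c : T -> R) : measurable_fun setT c ->
  (forall x, (0 < c x)%R) -> measurable_fun setT (fun x => (c x)^-1)%R.
Proof.
move=> mc c0; rewrite (_ : (fun x => _) = (fun x => c x `^ (- 1))%R).
  exact: measurable_fun_powR.
by apply/funext => x; rewrite powR_inv1// ltW.
Qed.

Let V0E x : 0 <= (V x)%:E. Proof. by rewrite lee_fin ltW. Qed.

Let Vi0E x : 0 <= (V x)^-1%:E. Proof. by rewrite lee_fin invr_ge0 ltW. Qed.

Lemma dual_le_scale (h : T -> \bar R) (k a : R) : (0 <= a)%R ->
  measurable_fun setT h -> (forall x, 0 <= h x) -> dual_le h k ->
  dual_le (fun x => a%:E * h x) (a * k).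
Proof.
move=> a0 mh h0 hk g mg g0 Ng.
have -> : \int[mu]_x (a%:E * h x * g x * (v x)%:E) =
    a%:E * \int[mu]_x (h x * g x * (v x)%:E).
  rewrite -ge0_integralZT//.
  - by apply: eq_integral => x _; rewrite !muleA.
  - by apply: measurable_funM_EFin => //; exact: emeasurable_funM.
  - by move=> x; rewrite !mule_ge0.
by rewrite EFinM lee_wpmul2l ?lee_fin// hk.
Qed.

Lemma dual_le_series (f_ : nat -> T -> \bar R) :
  (forall k, measurable_fun setT (f_ k)) -> (forall k x, 0 <= f_ k x) ->
  (forall k, dual_le (f_ k) 1) ->
  dual_le (fun x => \sum_(k <oo) (4 ^- k)%:E * f_ k x) 2.
Proof.
move=> mf f0 fk g mg g0 Ng.
have c0 k : (0 <= 4 ^- k :> R)%R by rewrite invr_ge0 exprn_ge0.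
have t0 k x : 0 <= (4 ^- k)%:E * f_ k x by rewrite mule_ge0.
have -> : \int[mu]_x ((\sum_(k <oo) (4 ^- k)%:E * f_ k x) * g x * (v x)%:E) =
    \int[mu]_x \sum_(k <oo) (4 ^- k)%:E * f_ k x * g x * (v x)%:E.
  apply: eq_integral => x _; rewrite -muleA nneseriesM//; last by rewrite mule_ge0.
  by apply: eq_eseriesr => k _; rewrite muleA.
rewrite integral_nneseries//; last 2 first.
- move=> k; apply: measurable_funM_EFin => //; apply: emeasurable_funM => //.
  exact: measurable_funeM.
- by move=> k x _; rewrite !mule_ge0.
apply: (@le_trans _ _ (\sum_(k <oo) (1 * 2 ^- (0 + k))%:E)).
  apply: lee_nneseries => [k _ _|k _].
    by apply: integral_ge0 => x _; rewrite !mule_ge0.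
  apply: le_trans (dual_le_scale (c0 k) (mf k) (f0 k) (fk k) mg g0 Ng) _.
  rewrite lee_fin mul1r mulr1 add0n lef_pV2 ?posrE ?exprn_gt0//.
  by rewrite lerXn2r ?nnegrE// ler_nat.
apply: le_trans (nneseries_geometric_half 0 ler01) _.
by rewrite expr0 invr1 !mulr1.
Qed.

(** The iteration of Rubio de Francia for the twisted maximal operator on the dual
    ball.  The inequality for the majorant H reads M (H V) <= 4 K0 H V, which is
    the A_1 condition for H V. *)
Lemma dual_A1_majorant h : measurable_fun setT h -> (forall x, 0 <= h x) ->
  dual_le h 1 -> ~ {ae mu, forall x, h x = 0} ->
  exists c : T -> R, [/\ measurable_fun setT c, forall x, (0 < c x)%R,
    {ae mu, forall x, h x <= (c x)%:E}, dual_le (EFin \o c) 2 &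
    A1 (4 * K0) (fun x => c x * V x)%R].
Proof.
move=> mh h0 h1 hn0.
have mhV f : measurable_fun setT f -> measurable_fun setT (fun x => f x * (V x)%:E).
  by move=> mf; exact: measurable_funM_EFin.
have mVi : measurable_fun setT (fun x => (V x)^-1)%R.
  exact: measurable_inv_gt0.
have mtw f : measurable_fun setT (twisted_max f).
  by apply: measurable_funM_EFin => //; exact: measurable_sup_over.
have tw0 f : (forall x, 0 <= f x) -> forall x, 0 <= twisted_max f x.
  move=> f0 x; rewrite mule_ge0// mean_max_ge0// => y.
  by rewrite mule_ge0.
have [H [mH hH MH HP]] : exists H, [/\ measurable_fun setT H,
    forall x, h x <= H x, forall x, twisted_max H x <= (4 * K0)%:E * H x &
    dual_le H 2].
  apply: (@rubio_de_francia _ _ _ twisted_max (fun f => dual_le f 1)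
    (fun f => dual_le f 2)) => //.
  - by move=> f mf f0; exact: tw0.
  - move=> f_ mf f0 x; rewrite /twisted_max.
    have -> : (fun y => (\sum_(k <oo) f_ k y) * (V y)%:E) =
        (fun y => \sum_(k <oo) (f_ k y * (V y)%:E)).
      apply/funext => y; rewrite muleC -nneseriesZl => [|k _]; last exact: f0.
      by apply: eq_eseriesr => k _; rewrite muleC.
    apply: (@le_trans _ _ ((\sum_(k <oo) mean_max B mu (fun y => f_ k y * (V y)%:E) x)
      * (V x)^-1%:E)).
      rewrite lee_wpmul2r//; apply: mean_max_series => // [k|k y]; first exact: mhV.
      by rewrite mule_ge0.
    rewrite nneseriesM// => k; rewrite mean_max_ge0// => y.
    by rewrite mule_ge0.
  - move=> f a mf f0 a0 x; rewrite /twisted_max muleA; congr (_ * _).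
    have -> : (fun y => a%:E * f y * (V y)%:E) = (fun y => a%:E * (f y * (V y)%:E)).
      by apply/funext => y; rewrite muleA.
    apply: mean_maxZ => //; first exact: mhV.
    by move=> y; rewrite mule_ge0.
  - move=> f mf f0 f1; have Ki0 : (0 <= K0^-1)%R by rewrite invr_ge0 ltW.
    have := dual_le_scale Ki0 (mtw f) (tw0 f f0) (maximal_dual mf f0 ler01 f1).
    by rewrite mulr1 mulVf// gt_eqF.
  - by move=> f_ mf f0 fk; exact: dual_le_series.
have H0 x : 0 <= H x by exact: le_trans (hH x).
have Hn0 : ~ {ae mu, forall x, H x * (V x)%:E = 0}.
  move=> Hz; apply: hn0; apply: filterS Hz => x /eqP.
  rewrite mule_eq0 eqe (gt_eqF (V0 x)) orbF => /eqP Hx.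
  by apply/le_anti; rewrite h0 andbT -Hx hH.
have MHV x : mean_max B mu (fun y => H y * (V y)%:E) x <=
    (4 * K0)%:E * (H x * (V x)%:E).
  by have := MH x; rewrite /twisted_max muleC lee_pdivrMl// muleC -muleA.
have HV0 x : 0 <= H x * (V x)%:E by rewrite mule_ge0.
have HVpos := A1_gt0 mB muB BE ndE covE (mhV _ mH) HV0 Hn0 MHV.
have Hfin := dual_le_fin (ler0n _ 2) mH H0 HP.
have HVfin : {ae mu, forall x, H x * (V x)%:E < +oo}.
  by apply: filterS Hfin => x Hx; rewrite muleC lte_mul_pinfty.
have mHV := mhV _ mH.
pose a := real_weight (fun x => H x * (V x)%:E).
have ma : measurable_fun setT a by exact: measurable_real_weight.
have a0 x : (0 < a x)%R by exact: real_weight_gt0.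
have aE := real_weight_ae HVpos HVfin.
exists (fun x => a x / V x)%R.
have cH : {ae mu, forall x, ((a x / V x)%R)%:E = H x}.
  apply: filterS aE => x ax; rewrite EFinM ax -muleA -EFinM divff ?mule1//.
  by rewrite gt_eqF.
split.
- exact: measurable_funM.
- by move=> x; rewrite divr_gt0.
- by apply: filterS cH => x ->.
- move=> g mg g0 Ng; apply: le_trans (HP g mg g0 Ng).
  rewrite le_eqVlt; apply/orP; left; apply/eqP; apply: ge0_ae_eq_integral => //.
  + apply: measurable_funM_EFin => //; apply: emeasurable_funM => //.
    by apply/measurable_EFinP; exact: measurable_funM.
  + by apply: measurable_funM_EFin => //; exact: emeasurable_funM.
  + by move=> x _; rewrite !mule_ge0// lee_fin divr_ge0// ltW.
  + by move=> x _; rewrite !mule_ge0.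
  + by apply: filterS cH => x /= -> _.
- have -> : (fun x => a x / V x * V x)%R = a.
    by apply/funext => x; rewrite divfK// gt_eqF.
  split => // Q BQ; apply: A1_real_weight BQ => //; exact: aeW.
Qed.

Variables (s Kb : R) (b : T -> R).
Hypothesis s_gt0 : (0 < s)%R.
Hypothesis Kb_gt0 : (0 < Kb)%R.
Hypothesis b_A1 : A1 Kb b.
Hypothesis bE : forall x, (V x * b x `^ (- s) = v x / u x)%R.
Variable F : set ((T -> \bar R) * (T -> \bar R)).
Hypothesis F_family : forall f g, F (f, g) ->
  [/\ measurable_fun setT f, forall x, 0 <= f x,
      measurable_fun setT g & forall x, 0 <= g x].
Hypothesis F_weighted : forall s K : R, (0 < s)%R ->
  exists2 C : R, (0 < C)%R & forall w, Muckenhoupt s K w ->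
  forall f g, F (f, g) ->
  \int[mu]_x (f x * (w x)%:E) <= C%:E * \int[mu]_x (g x * (w x)%:E).

(** With c as above, w = (c V) b^-s = c v / u, so that int (f / u) h v is at most
    int f w, and int g w = int (g / u) c v is at most twice the norm of g / u. *)
Theorem extrapolation_of_A1 : exists2 C : R, (0 < C)%R & forall f g, F (f, g) ->
  N (fun x => f x * (u x)^-1%:E) <= C%:E * N (fun x => g x * (u x)^-1%:E).
Proof.
have K40 : (0 < 4 * K0)%R by rewrite mulr_gt0.
have [C1 C10 main] := F_weighted (4 * K0 * Kb `^ s) s_gt0.
exists (2 * C1)%R; first by rewrite mulr_gt0.
move=> f g Ffg; have [mf f0 mg g0] := F_family Ffg.
have mui : measurable_fun setT (fun x => (u x)^-1)%R.
  exact: measurable_inv_gt0.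
have ui0 x : 0 <= (u x)^-1%:E by rewrite lee_fin invr_ge0 ltW.
set fu := fun x => f x * (u x)^-1%:E; set gu := fun x => g x * (u x)^-1%:E.
have mfu : measurable_fun setT fu by exact: measurable_funM_EFin.
have mgu : measurable_fun setT gu by exact: measurable_funM_EFin.
have fu0 x : 0 <= fu x by rewrite mule_ge0.
have gu0 x : 0 <= gu x by rewrite mule_ge0.
have C0 : (0 < 2 * C1)%R by rewrite mulr_gt0.
case E1 : (N gu) (N_ge0 mgu) => [y| |] // y0; last by rewrite gt0_muley ?leey// lte_fin.
rewrite lee_fin in y0.
(* The bound to be dualized has to be positive, and N gu may vanish. *)
apply/lee_addgt0Pr => e e0; rewrite -EFinM -EFinD.
apply: associate_dual => //; first by rewrite ltr_wpDl// mulr_ge0// ltW.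
move=> h mh h0 h1.
apply: (@le_trans _ _ ((2 * C1)%:E * N gu)); last first.
  by rewrite E1 -EFinM lee_fin lerDl ltW.
have [hz|hn0] := pselect {ae mu, forall x, h x = 0}.
  rewrite (ge0_ae_eq_integral measurableT (g := cst 0)) ?integral0//.
  - by rewrite E1 -EFinM lee_fin mulr_ge0// ltW.
  - by apply: measurable_funM_EFin => //; exact: emeasurable_funM.
  - by move=> x _; rewrite !mule_ge0.
  - by apply: filterS hz => x -> _; rewrite mule0 mul0e.
have [c [mc c0 hc c2 cA1]] := dual_A1_majorant mh h0 h1 hn0.
have := Muckenhoupt_of_A1 s_gt0 K40 Kb_gt0 cA1 b_A1.
have -> : (fun x => c x * V x * b x `^ (- s))%R = (fun x => c x * (v x / u x))%R.
  by apply/funext => x; rewrite -mulrA bE.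
move=> wA; have mw : measurable_fun setT (fun x => c x * (v x / u x))%R by case: wA.
apply: (@le_trans _ _ (\int[mu]_x (f x * ((c x * (v x / u x))%R)%:E))).
  apply: ae_ge0_le_integral => //.
  - by move=> x _; rewrite !mule_ge0.
  - by apply: measurable_funM_EFin => //; exact: emeasurable_funM.
  - by move=> x _; rewrite mule_ge0// lee_fin mulr_ge0 ?divr_ge0// ltW.
  - exact: measurable_funM_EFin.
  - apply: filterS hc => x hcx _; rewrite /fu -!muleA lee_wpmul2l//.
    have -> : ((c x * (v x / u x))%R)%:E = (u x)^-1%:E * ((c x)%:E * (v x)%:E).
      by rewrite -!EFinM; congr EFin; ring.
    by rewrite lee_wpmul2l// lee_wpmul2r.
apply: le_trans (main _ wA f g Ffg) _.
rewrite [X in _ <= X * _]EFinM [X in _ <= X * _]muleC -muleA lee_wpmul2l ?lee_fin ?(ltW C10)//.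
have mcE : measurable_fun setT (EFin \o c) by exact/measurable_EFinP.
have c0E x : 0 <= (EFin \o c) x by rewrite lee_fin ltW.
have := dual_le_norm (ler0n _ 2) mcE c0E c2 mgu gu0.
rewrite E1 ltry => /(_ isT); apply: le_trans; rewrite le_eqVlt; apply/orP; left.
apply/eqP; apply: eq_integral => x _; rewrite /gu /= -!muleA muleCA; congr (_ * _).
by rewrite -!EFinM; congr EFin; ring.
Qed.
End core.

(** * Weights and norms with extended real values *)

Lemma measurable_inve (R : realType) : measurable_fun setT (@inve R).
Proof.
have mpos (f : \bar R -> R) : measurable_fun setT f ->
    measurable_fun setT (fun x => (f x `^ (- 1))%:E).
  move=> mf; apply/measurable_EFinP.
  exact: (measurableT_comp (measurable_powR _) mf).
have mfine : measurable_fun setT (@fine R) by exact: fine_measurable.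
rewrite (_ : @inve R = fun x => if 0 < x < +oo then (fine x `^ (- 1))%:E else
  if x == 0 then +oo else if x == +oo then 0 else if x == -oo then -oo else
  - ((- fine x) `^ (- 1))%:E); last first.
  apply/funext => -[x| |]; rewrite ?invey ?inveNy ?ltxx ?andbF// ltry andbT lte_fin.
  rewrite inver eqe; case: ltgtP => [x0|x0|x0].
  - by rewrite powR_inv1// ltW.
  - by rewrite /= powR_inv1 ?oppr_ge0 ?(ltW x0)// invrN opprK.
  - by [].
have mid : measurable_fun setT (@id (\bar R)) by exact: measurable_id.
apply: measurable_fun_ifT; last 2 first.
- exact: mpos.
- apply: measurable_fun_ifT => //.
    exact: measurable_fun_eqe.
  apply: measurable_fun_ifT => //.
    exact: measurable_fun_eqe.
  apply: measurable_fun_ifT => //.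
    exact: measurable_fun_eqe.
  apply: measurableT_comp => //; apply: mpos.
  exact: measurableT_comp.
by apply: measurable_and; apply: measurable_fun_lte.
Qed.

Lemma sup_over_eq d (T : measurableType d) (R : realType) (B : set (set T))
    (phi psi : set T -> \bar R) x :
  (forall Q, B Q -> phi Q = psi Q) -> sup_over B phi x = sup_over B psi x.
Proof.
move=> E; apply/eqP; rewrite eq_le; apply/andP; split; apply: sup_over_le => Q BQ Qx.
  by rewrite E//; exact: sup_over_ub.
by rewrite -E//; exact: sup_over_ub.
Qed.

Section basis.
Context {d} {T : measurableType d} {R : realType}.
Variables (mu : {measure set T -> \bar R}) (B : set (set T)).
Implicit Types (f g h w : T -> \bar R) (Q : set T).
Hypothesis mB : forall Q, B Q -> measurable Q.
Hypothesis muB : forall Q, B Q -> 0 < mu Q < +oo.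
Hypothesis measurable_sup_over : forall phi : set T -> \bar R,
  measurable_fun setT (sup_over B phi).
Variable E : nat -> set T.
Hypothesis BE : forall m, B (E m).
Hypothesis ndE : forall m, E m `<=` E m.+1.
Hypothesis covE : forall x, exists m, E m x.
Local Notation Muckenhoupt := (Muckenhoupt mu B).

Lemma Muckenhoupt_weight s K (w : T -> R) : Muckenhoupt s K w ->
  measurable_fun setT (EFin \o w) /\
  {ae mu, forall x, 0 < (EFin \o w) x < +oo}.
Proof.
by move=> [mw w0 _]; split; [exact/measurable_EFinP|]; apply: aeW => x /=; rewrite lte_fin w0 ltry.
Qed.

(** The dual exponent of p = 1 + s is p' = 1 + 1 / s, so that 1 - p' = -1 / s and
    p - 1 = s. *)
Lemma Muckenhoupt_Ap s K (w : T -> R) Q : (0 < s)%R -> Muckenhoupt s K w -> B Q ->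
  (mu Q)^-1 * \int[mu]_(x in Q) (EFin \o w) x *
  ((mu Q)^-1 * \int[mu]_(x in Q) (EFin \o w) x `^ (1 - conjugate (1 + s)))
    `^ (1 + s - 1) <= K%:E.
Proof.
move=> s0 [mw w0 wA] BQ; have [a [b [a0 b0 wa wb ab]]] := wA Q BQ.
have [q q0 qE] := nu_fineE muB BQ.
have s1 : (0 < 1 + s)%R by rewrite addr_gt0.
have -> : (1 - conjugate (1 + s) = - s^-1)%R.
  rewrite /conjugate; have -> : (1 - (1 + s)^-1 = s / (1 + s))%R.
    by field; rewrite gt_eqF.
  by field; rewrite !gt_eqF.
rewrite addrAC subrr add0r.
have qi : (mu Q)^-1 = q^-1%:E by rewrite qE inver gt_eqF.
apply: (@le_trans _ _ (a%:E * (b `^ s)%:E)); last by rewrite -EFinM lee_fin.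
have I0 : 0 <= \int[mu]_(x in Q) (EFin \o w) x.
  by apply: integral_ge0 => x _; rewrite lee_fin ltW.
have J0 : 0 <= \int[mu]_(x in Q) (EFin \o w) x `^ (- s^-1).
  by apply: integral_ge0 => x _; rewrite lee_fin powR_ge0.
have qi0 : (0 <= q^-1)%R by rewrite invr_ge0 ltW.
rewrite qi; apply: lee_pmul; rewrite ?poweR_ge0 ?mule_ge0//.
  by rewrite lee_pdivrMl// muleC -qE.
rewrite -poweR_EFin; apply: gt0_ler_poweR; rewrite ?(ltW s0)//.
- by rewrite in_itv/= leey mule_ge0.
- by rewrite in_itv/= leey lee_fin ltW.
- by rewrite lee_pdivrMl// muleC -qE.
Qed.

Lemma weighted_norm_cancel (p C : R) w f g : (0 < p)%R -> (0 < C)%R ->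
  (forall x, 0 <= w x) -> (forall x, 0 <= f x) -> (forall x, 0 <= g x) ->
  (\int[mu]_x (`|f x| `^ p * w x)) `^ p^-1 <=
    C%:E * (\int[mu]_x (`|g x| `^ p * w x)) `^ p^-1 ->
  \int[mu]_x (f x `^ p * w x) <= (C `^ p)%:E * \int[mu]_x (g x `^ p * w x).
Proof.
move=> p0 C0 w0 f0 g0.
have absE k : (forall x, 0 <= k x) ->
    \int[mu]_x (`|k x| `^ p * w x) = \int[mu]_x (k x `^ p * w x).
  by move=> k0; apply: eq_integral => x _; rewrite gee0_abs.
have I0 k : 0 <= \int[mu]_x (k x `^ p * w x).
  by apply: integral_ge0 => x _; rewrite mule_ge0// poweR_ge0.
rewrite !absE// => h.
have pK (y : \bar R) : 0 <= y -> (y `^ p^-1) `^ p = y.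
  by move=> y0; rewrite -poweRrM mulVf ?gt_eqF// poweRe1.
rewrite -(pK _ (I0 f)) -[X in _ <= _ * X](pK _ (I0 g)) -poweR_EFin.
rewrite -poweRM ?lee_fin ?(ltW C0) ?poweR_ge0//.
apply: gt0_ler_poweR; rewrite ?(ltW p0)//.
- by rewrite in_itv/= leey poweR_ge0.
- by rewrite in_itv/= leey mule_ge0 ?poweR_ge0// lee_fin ltW.
Qed.

Definition basis_maximal f : T -> \bar R :=
  sup_over B (fun Q => (mu Q)^-1 * \int[mu]_(y in Q) (abse \o f) y).

Lemma basis_maximalE f g : measurable_fun setT f -> measurable_fun setT g ->
  {ae mu, forall x, `|f x| = g x} ->
  basis_maximal f = mean_max B mu g.
Proof.
move=> mf mg fg; apply/funext => x; apply: sup_over_eq => Q BQ.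
have [q q0 qE] := nu_fineE muB BQ.
rewrite qE inver gt_eqF//=; congr (_ * _); apply: ae_eq_integral; first exact: mB.
- by apply: measurableT_comp => //; exact: measurable_funTS.
- exact: measurable_funTS.
- by apply: filterS fg => y + _.
Qed.

(** A bound of M W / W in L^oo is the inequality M b <= K b almost everywhere, for
    a real representative b of W. *)
Lemma basis_maximal_A1 (W : T -> \bar R) (b : T -> R) : mu setT > 0 ->
  measurable_fun setT W -> measurable_fun setT b -> (forall x, (0 < b x)%R) ->
  {ae mu, forall x, W x = (b x)%:E} ->
  Lnorm mu +oo (fun x => basis_maximal W x / W x) < +oo ->
  exists2 K : R, (0 < K)%R & A1 mu B K b.
Proof.
move=> muT mW mb b0 Wb; rewrite unlock muT => Lfin.
have mbE : measurable_fun setT (EFin \o b) by exact/measurable_EFinP.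
have [K K0 KP] : exists2 K : R, (0 < K)%R &
    ess_sup mu (abse \o (fun x => basis_maximal W x / W x)) <= K%:E.
  case: (ess_sup _ _) Lfin => [y _| |_] //.
    by exists (Num.max y 1)%R; rewrite ?lt_max ?ltr01 ?orbT// lee_fin le_max lexx.
  by exists 1%R; rewrite ?leNye.
exists K => //; split => // Q BQ.
have bw : real_weight (EFin \o b) = b.
  by apply/funext => x; rewrite /real_weight /= lte_fin b0 ltry.
rewrite -bw; apply: A1_real_weight BQ => //.
- by apply: aeW => x; rewrite /= ltry.
have Mb : basis_maximal W = mean_max B mu (EFin \o b).
  apply: basis_maximalE => //; apply: filterS Wb => x ->.
  by rewrite gee0_abs// lee_fin ltW.
move/ess_supP : KP; apply: filterS2 Wb => x Wx /=.
rewrite Mb Wx inver gt_eqF// => /(le_trans (lee_abs _)).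
by rewrite muleC lee_pdivrMl// muleC.
Qed.

Variables (u v : T -> \bar R) (N : (T -> \bar R) -> \bar R).
Hypothesis mu_ : measurable_fun setT u.
Hypothesis u_ae : {ae mu, forall x, 0 < u x < +oo}.
Hypothesis mv : measurable_fun setT v.
Hypothesis v_ae : {ae mu, forall x, 0 < v x < +oo}.
Hypothesis N_abs : forall f, measurable_fun setT f -> N f = N (abse \o f).
Local Notation u0 := (real_weight u).
Local Notation v0 := (real_weight v).

Definition basis_associate f : \bar R :=
  ereal_sup [set \int[mu]_x (`|f x * g x| * v x) |
    g in [set g | measurable_fun setT g /\ N g <= 1]].

Let u0E : {ae mu, forall x, (u0 x)%:E = u x}.
Proof. by apply: filterS u_ae => x; exact: real_weightE. Qed.

Let v0E : {ae mu, forall x, (v0 x)%:E = v x}.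
Proof. by apply: filterS v_ae => x; exact: real_weightE. Qed.

Let mu0 : measurable_fun setT u0. Proof. exact: measurable_real_weight. Qed.
Let mv0 : measurable_fun setT v0. Proof. exact: measurable_real_weight. Qed.

Let mv0E : measurable_fun setT (fun x => (v0 x)%:E).
Proof. exact/measurable_EFinP. Qed.

(** Replacing g by |g| changes neither its norm nor the integral, in which v may be
    replaced by a function of its class. *)
Lemma basis_associate_le h (k : R) : measurable_fun setT h ->
  (forall x, 0 <= h x) -> dual_le mu v0 N h k -> basis_associate h <= k%:E.
Proof.
move=> mh h0 hk; apply: ge_ereal_sup => _ [g [mg Ng] <-].
have mag : measurable_fun setT (abse \o g) by exact: measurableT_comp.
have ag0 x : 0 <= (abse \o g) x by exact: abse_ge0.
apply: le_trans (hk _ mag ag0 _); last by rewrite -N_abs.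
rewrite le_eqVlt; apply/orP; left; apply/eqP; apply: ae_eq_integral => //.
- apply: emeasurable_funM => //; apply: measurableT_comp => //.
  exact: emeasurable_funM.
- by apply: emeasurable_funM => //; exact: emeasurable_funM.
- by apply: filterS v0E => x /= -> _; rewrite abseM gee0_abs.
Qed.

Lemma dual_le_of_associate f h (k : R) : measurable_fun setT f ->
  measurable_fun setT h -> (forall x, 0 <= h x) ->
  {ae mu, forall x, `|f x| = h x} -> basis_associate f <= k%:E ->
  dual_le mu v0 N h k.
Proof.
move=> mf mh h0 fh fk g mg g0 Ng; apply: le_trans fk.
apply: le_trans (ereal_sup_ubound _ ); last by exists g => //; split.
rewrite le_eqVlt; apply/orP; left; apply/eqP; apply: ae_eq_integral => //.
- by apply: emeasurable_funM => //; exact: emeasurable_funM.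
- apply: emeasurable_funM => //; apply: measurableT_comp => //.
  exact: emeasurable_funM.
- by apply: filterS2 v0E fh => x -> fx _; rewrite abseM fx (gee0_abs (g0 x)).
Qed.

Hypothesis N_ge0 : forall f, measurable_fun setT f -> 0 <= N f.
Hypothesis N_eq0 : forall f, measurable_fun setT f ->
  N f = 0 <-> {ae mu, forall x, f x = 0}.
Hypothesis N_triangle : forall f g, measurable_fun setT f ->
  measurable_fun setT g -> N (f \+ g) <= N f + N g.
Hypothesis N_homogeneous : forall (a : R) f, measurable_fun setT f ->
  N (fun x => a%:E * f x) = `|a|%:E * N f.
Hypothesis N_le : forall f g, measurable_fun setT f -> measurable_fun setT g ->
  {ae mu, forall x, `|f x| <= `|g x|} -> N f <= N g.
Hypothesis N_fatou : forall (f_ : nat -> T -> \bar R) f,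
  (forall j, measurable_fun setT (f_ j)) -> measurable_fun setT f ->
  {ae mu, forall x, nondecreasing_seq (fun j => `|f_ j x|) /\
                    (fun j => `|f_ j x|) @ \oo --> `|f x|} ->
  nondecreasing_seq (fun j => N (f_ j)) /\ (fun j => N (f_ j)) @ \oo --> N f.
Hypothesis N_indic : forall A : set T, measurable A ->
  \int[mu]_(x in A) v x < +oo -> N (fun x => (\1_A x)%:E) < +oo.

Variables (r s K0 p0 : R).
Hypothesis r_gt1 : (1 < r)%R.
Hypothesis s_gt0 : (0 < s)%R.
Hypothesis uv_A1 : Lnorm mu +oo (fun x =>
  basis_maximal (fun x => u x `^ s^-1 * v x `^ (- (s * conjugate r)^-1)) x /
  (u x `^ s^-1 * v x `^ (- (s * conjugate r)^-1))) < +oo.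

Definition basis_maximal' w f : T -> \bar R := fun x =>
  if w x != 0 then basis_maximal (f \* w) x / w x else 0.

Hypothesis K0_gt0 : (0 < K0)%R.
Hypothesis maximal'_bounded : forall f, measurable_fun setT f ->
  basis_associate (basis_maximal' (fun x => v x `^ r^-1) f) <=
  K0%:E * basis_associate f.

Variable F : set ((T -> \bar R) * (T -> \bar R)).
Hypothesis F_family : forall f g, F (f, g) ->
  [/\ measurable_fun setT f, forall x, 0 <= f x,
      measurable_fun setT g & forall x, 0 <= g x].
Hypothesis F_weighted : forall s K : R, (0 < s)%R ->
  exists2 C : R, (0 < C)%R & forall w : T -> R, Muckenhoupt s K w ->
  forall f g, F (f, g) ->
  \int[mu]_x (f x * (w x)%:E) <= C%:E * \int[mu]_x (g x * (w x)%:E).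

Let V x := (v0 x `^ r^-1)%R.
Let b x := (u0 x `^ s^-1 * v0 x `^ (- (s * conjugate r)^-1))%R.

Let mV : measurable_fun setT V. Proof. exact: measurable_fun_powR. Qed.

Let u0_gt0 x : (0 < u0 x)%R. Proof. exact: real_weight_gt0. Qed.
Let v0_gt0 x : (0 < v0 x)%R. Proof. exact: real_weight_gt0. Qed.
Let V_gt0 x : (0 < V x)%R. Proof. exact: powR_gt0. Qed.

(** b^-s = v^(1/r') / u, and 1 / r + 1 / r' = 1. *)
Let bE x : (V x * b x `^ (- s) = v0 x / u0 x)%R.
Proof.
have r0 : (0 < r)%R by exact: lt_trans r_gt1.
have r1 : (0 < r - 1)%R by rewrite subr_gt0.
have rc : (conjugate r = r / (r - 1))%R.
  rewrite /conjugate; have -> : (1 - r^-1 = (r - 1) / r)%R by field; rewrite gt_eqF.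
  by rewrite invf_div.
rewrite /V /b powRM ?powR_ge0// -!powRrM mulrN mulVf ?gt_eqF// powR_inv1 ?(ltW (u0_gt0 x))//.
rewrite mulrCA -powRD; last by rewrite implybE (gt_eqF (v0_gt0 x)) orbT.
have -> : (r^-1 + - (s * conjugate r)^-1 * - s = 1)%R.
  by rewrite rc; field; rewrite !gt_eqF.
by rewrite powRr1 ?(ltW (v0_gt0 x))// mulrC.
Qed.

(** Where 0 < v < +oo, the operator of the hypothesis is the twisted maximal
    operator with V = v^(1/r). *)
Let maximal_dual h (k : R) : measurable_fun setT h -> (forall x, 0 <= h x) ->
  (0 <= k)%R -> dual_le mu v0 N h k ->
  dual_le mu v0 N (twisted_max mu B V h) (K0 * k).
Proof.
move=> mh h0 k0 hk; set w := fun x => v x `^ r^-1.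
have mw : measurable_fun setT w by exact: measurable_fun_poweR.
have mhw : measurable_fun setT (h \* w) by exact: emeasurable_funM.
have mhV : measurable_fun setT (fun x => h x * (V x)%:E).
  by apply: emeasurable_funM => //; exact/measurable_EFinP.
have ME : basis_maximal (h \* w) = mean_max B mu (fun x => h x * (V x)%:E).
  apply: basis_maximalE => //; apply: filterS v0E => x vx.
  by rewrite /w -vx poweR_EFin gee0_abs// mule_ge0// lee_fin powR_ge0.
have mM : measurable_fun setT (basis_maximal (h \* w)) by exact: measurable_sup_over.
have mM' : measurable_fun setT (basis_maximal' w h).
  apply: measurable_fun_ifT => //.
    by apply: measurable_neg; exact: measurable_fun_eqe.
  by apply: emeasurable_funM => //; apply: measurableT_comp mw; exact: measurable_inve.
have tw0 x : 0 <= twisted_max mu B V h x.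
  rewrite mule_ge0//; last by rewrite lee_fin invr_ge0 powR_ge0.
  apply: mean_max_ge0; first by have [m Em] := covE x; exists (E m).
  by move=> y; rewrite mule_ge0// lee_fin powR_ge0.
apply: (@dual_le_of_associate (basis_maximal' w h)) => //.
- apply: emeasurable_funM; first exact: measurable_sup_over.
  apply/measurable_EFinP.
  rewrite (_ : (fun x => _) = (fun x => V x `^ (- 1))%R); first exact: measurable_fun_powR.
  by apply/funext => x; rewrite powR_inv1// ltW.
- apply: filterS v0E => x vx; rewrite /basis_maximal' /w -vx poweR_EFin eqe.
  rewrite (gt_eqF (V_gt0 x)) ME inver (gt_eqF (V_gt0 x)) gee0_abs//.
  exact: tw0.
- apply: le_trans (maximal'_bounded mh) _; rewrite EFinM lee_wpmul2l ?lee_fin ?(ltW K0_gt0)//.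
  exact: basis_associate_le.
Qed.

Let b_A1 : exists2 K : R, (0 < K)%R & A1 mu B K b.
Proof.
have mW : measurable_fun setT (fun x => u x `^ s^-1 * v x `^ (- (s * conjugate r)^-1)).
  by apply: emeasurable_funM; exact: measurable_fun_poweR.
apply: (basis_maximal_A1 _ mW) uv_A1.
- have /andP[q0 _] := muB (BE 0); apply: lt_le_trans q0 _.
  by rewrite le_measure ?inE//; exact: mB.
- by apply: measurable_funM; exact: measurable_fun_powR.
- by move=> x; rewrite mulr_gt0// powR_gt0.
- by apply: filterS2 u0E v0E => x <- <-; rewrite !poweR_EFin -EFinM.
Qed.

Let N_div f : measurable_fun setT f ->
  N (fun x => f x / u x) = N (fun x => f x * (u0 x)^-1%:E).
Proof.
move=> mf.
have mfu : measurable_fun setT (fun x => f x / u x).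
  by apply: emeasurable_funM => //; apply: measurableT_comp mu_; exact: measurable_inve.
have mfu0 : measurable_fun setT (fun x => f x * (u0 x)^-1%:E).
  apply: emeasurable_funM => //; apply/measurable_EFinP.
  rewrite (_ : (fun x => _) = (fun x => u0 x `^ (- 1))%R); first exact: measurable_fun_powR.
  by apply/funext => x; rewrite powR_inv1// ltW.
have E0 : {ae mu, forall x, `|f x / u x| = `|f x * (u0 x)^-1%:E|}.
  by apply: filterS u0E => x <-; rewrite inver gt_eqF.
by apply/eqP; rewrite eq_le !N_le//; apply: filterS E0 => x ->.
Qed.

Theorem basis_extrapolation : exists2 C : R, (0 < C)%R & forall f g, F (f, g) ->
  N (fun x => f x / u x) <= C%:E * N (fun x => g x / u x).
Proof.
have [Kb Kb0 bA1] := b_A1.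
have [] := @extrapolation_of_A1 _ T R mu B mB muB measurable_sup_over E BE ndE
  covE u0 v0 N mu0 u0_gt0 mv0 v0_gt0 N_ge0 _ _ _ _ _ _ K0 K0_gt0 V mV V_gt0
  maximal_dual s Kb b s_gt0 Kb0 bA1 bE F F_family F_weighted.
- by move=> f mf /N_eq0 - /(_ mf).
- move=> f g mf mg f0 g0 fg; apply: N_le => //.
  by apply: filterS fg => x; rewrite !gee0_abs.
- by move=> f g mf mg _ _; exact: N_triangle.
- by move=> a f mf _ a0; rewrite N_homogeneous// ger0_norm.
- move=> f_ f y mf_ mf f_0 f0 ndf fcvg fy.
  have absE x : (fun k => `|f_ k x|) = f_ ^~ x.
    by apply/funext => k; rewrite gee0_abs.
  have [] := N_fatou mf_ mf; first by apply: aeW => x; rewrite absE gee0_abs.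
  move=> _ cvN; rewrite -(cvg_lim _ cvN)//; apply: lime_le; last exact: nearW.
  by apply/cvg_ex; exists (N f).
- move=> A mA Av; apply: N_indic => //; apply: le_lt_trans Av.
  rewrite le_eqVlt; apply/orP; left; apply/eqP; apply: ae_eq_integral => //.
  + exact: measurable_funTS.
  + exact: measurable_funTS.
  + by apply: filterS v0E => x ->.
move=> C C0 CP; exists C => // f g Ffg; have [mf _ mg _] := F_family Ffg.
by rewrite !N_div//; exact: CP.
Qed.
End basis.

(** * Cubes in R^n *)

Section cubes_basis.
Context {R : realType} {n : nat}.
Local Notation RRn := (Rn R n).

Lemma lebesgue_cubes (Q : set RRn) : cubes Q -> 0 < lebesgue_n Q < +oo.
Proof.
move=> [c [l [l0 ->]]]; rewrite (lebesgue_n_cube c l0).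
by rewrite lte_fin exprn_gt0// ltry.
Qed.

Definition centered_cube (m : nat) : set RRn :=
  cube [tuple (- m.+1%:R)%R | i < n] (2 * m.+1%:R).

Lemma centered_cubeP m (x : RRn) :
  centered_cube m x <-> forall i, (`|tnth x i| < m.+1%:R)%R.
Proof.
by split=> h i; have := h i; rewrite tnth_mktuple ltr_norml => /andP[? ?];
  apply/andP; split; lra.
Qed.

Lemma cubes_centered m : cubes (centered_cube m).
Proof. by exists [tuple (- m.+1%:R)%R | i < n], (2 * m.+1%:R)%R; rewrite mulr_gt0. Qed.

Lemma centered_cube_nd m : centered_cube m `<=` centered_cube m.+1.
Proof.
move=> x /centered_cubeP h; apply/centered_cubeP => i.
by apply: lt_le_trans (h i) _; rewrite ler_nat.
Qed.

Lemma centered_cube_cover (x : RRn) : exists m, centered_cube m x.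
Proof.
exists (\max_(i < n) Num.truncn `|tnth x i|)%N; apply/centered_cubeP => i.
apply: lt_le_trans (truncnS_gt _) _; rewrite ler_nat ltnS.
exact: (leq_bigmax (F := fun i => Num.truncn `|tnth x i|)).
Qed.

Definition tripled (Q Q' : set RRn) := exists2 q : n.-tuple R * R, (0 < q.2)%R &
  Q = cube q.1 q.2 /\ Q' = cube (triple q).1 (triple q).2.

Lemma tripled_cubes Q : cubes Q -> exists Q', tripled Q Q'.
Proof.
move=> [c [l [l0 ->]]]; exists (cube (triple (c, l)).1 (triple (c, l)).2).
by exists (c, l).
Qed.

Lemma tripledP Q Q' : cubes Q -> tripled Q Q' ->
  [/\ cubes Q', Q `<=` Q' & lebesgue_n Q' <= (3 ^+ n)%:E * lebesgue_n Q].
Proof.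
move=> _ [[c l] l0 [-> ->]] /=; have l0' : (0 < 3 * l)%R by rewrite mulr_gt0.
split; first by exists (triple (c, l)).1, (3 * l)%R.
  move=> x Qx; apply: (@sub_triple _ _ (c, l) (c, l)) (Qx) => //.
  by exists x; split.
by rewrite (lebesgue_n_cube _ l0') (lebesgue_n_cube _ l0) exprMn EFinM.
Qed.

(** The constant depends on the measure only through D, hence is the same for all
    weights of a given Muckenhoupt constant. *)
Lemma cubes_maximal_theorem (D p : R) : (1 < p)%R ->
  exists2 C : R, (0 < C)%R & forall nu : {measure set RRn -> \bar R},
  (forall Q, cubes Q -> 0 < nu Q < +oo) ->
  (forall Q Q', cubes Q -> tripled Q Q' -> nu Q' <= D%:E * nu Q) ->
  forall f : RRn -> \bar R, measurable_fun setT f -> (forall x, 0 <= f x) ->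
  \int[nu]_x (mean_max cubes nu f x `^ p) <= C%:E * \int[nu]_x (f x `^ p).
Proof.
move=> p1; exists (Num.max (marcinkiewicz_constant D p) 1)%R.
  by rewrite lt_max ltr01 orbT.
move=> nu nuQ nuD f mf f0.
have doubling (q : n.-tuple R * R) : (0 < q.2)%R ->
    nu (cube (triple q).1 (triple q).2) <= D%:E * nu (cube q.1 q.2).
  by move=> q0; apply: nuD; [exists q.1, q.2|exists q].
apply: le_trans (mean_max_strong nuQ doubling p1 mf f0) _.
apply: lee_wpmul2r; last by rewrite lee_fin le_max lexx.
by apply: integral_ge0 => x _; exact: poweR_ge0.
Qed.
End cubes_basis.

(** The A_p characteristic is thus controlled by the constant alone, which is what
    the dependence of the constants on A_infty weights requires. *)
Lemma Muckenhoupt_Ap_char (R : realType) (n : nat) (s K : R) (w : Rn R n -> R) :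
  (0 < s)%R -> Muckenhoupt (@lebesgue_n R n) cubes s K w ->
  weight (EFin \o w) /\ Ap_char (1 + s) (EFin \o w) <= K%:E.
Proof.
move=> s0 wA; split; first exact: (Muckenhoupt_weight wA).
rewrite /Ap_char ifF; last by apply/negbTE; rewrite eq_sym -subr_eq0 opprD addNKr oppr_eq0 gt_eqF.
apply: ge_ereal_sup => _ [Q BQ <-].
exact: (Muckenhoupt_Ap lebesgue_cubes s0 wA BQ).
Qed.

Theorem theorem1p7 (R : realType) (n : nat) (n_gt0 : (0 < n)%N)
  (F : set ((Rn R n -> \bar R) * (Rn R n -> \bar R)))
  (F_family : extrapolation_family F)
  (u v : Rn R n -> \bar R) (u_weight : weight u) (v_weight : weight v)
  (v_locint : locally_integrable_n v)
  (N : (Rn R n -> \bar R) -> \bar R) (N_bfn : banach_function_norm v N)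
  (r s : R) (r_gt1 : (1 < r)%R) (s_gt0 : (0 < s)%R)
  (uv_A1 : Ap 1 (fun x => u x `^ s^-1 * v x `^ (- (s * conjugate r)^-1)))
  (K0 : R) (K0_gt0 : (0 < K0)%R)
  (maximal'_bounded : forall f : Rn R n -> \bar R, measurable_fun setT f ->
    associate_norm v N (maximal' (fun x => v x `^ r^-1) f) <=
    K0%:E * associate_norm v N f)
  (p0 : R) (p0_gt0 : (0 < p0)%R)
  (F_Ainfty : Ainfty_constant (fun w C => forall f g, F (f, g) ->
    weighted_norm p0 w f <= C%:E * weighted_norm p0 w g)) :
  exists2 C : R, (0 < C)%R & forall f g, F (f, g) ->
    N (fun x => f x / u x) <= C%:E * N (fun x => g x / u x).
Proof.
pose mu : {measure set (Rn R n) -> \bar R} := @lebesgue_n R n.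
have F_p0 (t K : R) : (0 < t)%R -> exists2 C : R, (0 < C)%R &
    forall w : Rn R n -> R, Muckenhoupt mu cubes t K w -> forall f g, F (f, g) ->
    \int[mu]_x (f x `^ p0 * (w x)%:E) <= C%:E * \int[mu]_x (g x `^ p0 * (w x)%:E).
  move=> t0; have t1 : (1 <= 1 + t)%R by rewrite lerDl ltW.
  have K1 : (1 <= Num.max K 1)%R by rewrite le_max lexx orbT.
  have [C C0 FC] := F_Ainfty.2 _ _ t1 K1.
  exists (C `^ p0)%R; first by rewrite powR_gt0.
  move=> w wA f g Ffg; have [_ f0 _ g0] := F_family f g Ffg.
  have [w_weight wK] := Muckenhoupt_Ap_char t0 wA.
  have w0 x : 0 <= (EFin \o w) x by case: wA => _ w0 _; rewrite lee_fin ltW.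
  apply: (weighted_norm_cancel p0_gt0 C0 w0 f0 g0).
  apply: FC => //; apply: le_trans wK _.
  by rewrite lee_fin le_max lexx.
have c3 : (0 < 3 ^+ n :> R)%R by rewrite exprn_gt0.
have F_1 := @Ainfty_extrapolation _ (Rn R n) R mu cubes measurable_cubes
  lebesgue_cubes measurable_sup_cubes centered_cube cubes_centered
  centered_cube_nd centered_cube_cover tripled _ c3 tripled_cubes tripledP
  cubes_maximal_theorem F p0 F_family p0_gt0 F_p0.
have [u_m u_ae] := u_weight; have [v_m v_ae] := v_weight.
have uv_Lnorm := uv_A1.2; rewrite /Ap_char eqxx in uv_Lnorm.
exact: (@basis_extrapolation _ (Rn R n) R mu cubes measurable_cubes
  lebesgue_cubes measurable_sup_cubes centered_cube cubes_centered
  centered_cube_nd centered_cube_cover u v N u_m u_ae v_m v_ae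
  (bfn_abs N_bfn) (bfn_ge0 N_bfn) (bfn_eq0 N_bfn) (bfn_triangle N_bfn)
  (bfn_homogeneous N_bfn) (bfn_le N_bfn) (bfn_fatou N_bfn)
  (fun A mA hA => (bfn_indic N_bfn mA hA).1)
  r s K0 r_gt1 s_gt0 uv_Lnorm K0_gt0 maximal'_bounded F F_family F_1).
Qed.
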